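(* Let $\widehat{f}^{p}_{1,h},\widehat{e}^{p}_{1,h}\in\widehat{\mathcal V}^{p}_{s,h}$, $\widehat{f}^{p-1}_{2,h},\widehat{e}^{p-1}_{2,h}\in\widehat{\mathcal V}^{p-1}_{s,h}$, $f^{q-1}_{1,h},e^{q-1}_{1,h}\in\mathcal V^{q-1}_{s,h}$, $f^{q}_{2,h},e^{q}_{2,h}\in\mathcal V^{q}_{s,h}$, $f^{q-1}_{\partial,h}\in\operatorname{tr}\mathcal V^{q-1}_{s,h}$ and $\widehat{e}^{p-1}_{\partial,h}\in\operatorname{tr}\widehat{\mathcal V}^{p-1}_{s,h}$ satisfy both the discrete primal Stokes-Dirac structure $$(\widehat v^p_h,\widehat f^p_{1,h})_M=(\widehat v^p_h,(-1)^r\mathrm d\widehat e^{p-1}_{2,h})_M\quad\forall\,\widehat v^p_h\in\widehat{\mathcal V}^p_{s,h},$$ $$(\widehat v^{p-1}_h,\widehat f^{p-1}_{2,h})_M=(-1)^{a_1}(\mathrm d\widehat v^{p-1}_h,\widehat e^p_{1,h})_M-(-1)^{a_1}\langle \widehat v^{p-1}_h\,|\,f^{q-1}_{\partial,h}\rangle_{\partial M}\quad\forall\,\widehat v^{p-1}_h\in\widehat{\mathcal V}^{p-1}_{s,h},$$ $$\widehat e^{p-1}_{\partial,h}=(-1)^p\operatorname{tr}\widehat e^{p-1}_{2,h},$$ and the discrete dual Stokes-Dirac structure $$(v^{q-1}_h,f^{q-1}_{1,h})_M=-(\mathrm d v^{q-1}_h,e^q_{2,h})_M-(-1)^{(p-1)(q-1)}\langle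 v^{q-1}_h\,|\,\widehat e^{p-1}_{\partial,h}\rangle_{\partial M}\quad\forall\,v^{q-1}_h\in\mathcal V^{q-1}_{s,h},$$ $$(v^q_h,f^q_{2,h})_M=(v^q_h,\mathrm d e^{q-1}_{1,h})_M\quad\forall\,v^q_h\in\mathcal V^q_{s,h},$$ $$f^{q-1}_{\partial,h}=\operatorname{tr}e^{q-1}_{1,h}.$$ Then $$\langle e^{q-1}_{1,h}\,|\,\widehat f^p_{1,h}\rangle_M+\langle\widehat e^{p-1}_{2,h}\,|\,f^q_{2,h}\rangle_M+\langle\widehat e^{p-1}_{\partial,h}\,|\,f^{q-1}_{\partial,h}\rangle_{\partial M}=0.$$
   Context: $M\subset\mathbb R^n$ is a compact oriented $n$-dimensional polyhedral domain with a Riemannian metric, triangulated by a simplicial mesh $\mathcal T_h$. Integers $p,q$ satisfy $1\le p,q\le n$ and $p+q=n+1$ (so $n-q=p-1$, $n-p=q-1$); $r=pq+1$ and $a_1=n(p+1)+1$. For $s\ge 1$, $\mathcal V^k_{s,h}=\mathcal P^-_s\Omega^k(\mathcal T_h)$ is the trimmed polynomial finite element space of $k$-forms: on every simplex the form lies in $\mathcal P_{s-1}\Lambda^k+\kappa\,\mathcal P_{s-1}\Lambda^{k+1}$, where $\mathcal P_{j}\Lambda^k$ are $k$-forms with polynomial coefficients of degree at most $j$ and $\kappa$ is contraction with the position vector field, and the traces (pullbacks) on facets shared by two simplices coincide. Hats denote outer-oriented (pseudo-)forms; since $M$ is oriented these may be identified with ordinary forms, so $\widehat{\mathcal V}^k_{s,h}$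 is a copy of $\mathcal V^k_{s,h}$. $\mathrm d$ is the exterior derivative (weak derivative, computed simplexwise), $\operatorname{tr}$ is pullback to $\partial M$, and $\operatorname{tr}\mathcal V^k_{s,h}$ is the space of traces on $\partial M$. The inner product is $(\alpha,\beta)_M=\int_M\alpha\wedge\star\beta$ with $\star$ the Hodge star; the duality products are $\langle\alpha\,|\,\beta\rangle_M=\int_M\alpha\wedge\beta$ for forms of degrees adding to $n$, and $\langle\alpha\,|\,\beta\rangle_{\partial M}=\int_{\partial M}\operatorname{tr}\alpha\wedge\operatorname{tr}\beta$ for forms of degrees adding to $n-1$ (the trace being omitted for forms already defined on $\partial M$). *)

(* Defs.v *)
From HB Require Import structures.
From mathcomp Require Import all_boot all_order all_algebra all_fingroup.
From mathcomp Require Import all_classical all_reals all_analysis.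
(* The notations of mpoly clash with those of mathcomp-analysis. *)
From mathcomp Require mpoly.
Import (canonicals, coercions) mpoly.

Set Implicit Arguments.
Unset Strict Implicit.
Unset Printing Implicit Defensive.

Import Order.TTheory GRing.Theory Num.Theory.
Import numFieldNormedType.Exports.

Local Open Scope classical_set_scope.
Local Open Scope ring_scope.

(* The list s without its i-th entry. *)
Definition del (A : Type) (i : nat) (s : seq A) : seq A := take i s ++ drop i.+1 s.

(* A (possibly inhomogeneous) covector takes a list of vectors of any length;
   covectors of degree k are the ones that vanish on lists of length <> k
   (see [alternating]).  In this way degrees such as p.-1.+1 and p need no cast.
   The codomain R^o is R as a module over itself, so that covectors, forms, and
   families of forms inherit the pointwise module structure of functions. *)
Notation covector R n := (seq 'rV[R]_n -> R^o).
Notation form R n := ('rV[R]_n -> covector R n).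

Section ExteriorAlgebra.
Context (R : realType) (n : nat).
Implicit Types (a b w : covector R n) (vs : seq 'rV[R]_n).

Definition alternating (k : nat) w : Prop :=
  [/\ (forall vs, size vs != k -> w vs = 0),
      (forall s1 s2 (c : R) (u v : 'rV[R]_n),
         w (s1 ++ (c *: u + v) :: s2)
         = c * w (s1 ++ u :: s2) + w (s1 ++ v :: s2)) &
      (forall s1 s2 s3 (u : 'rV[R]_n), w (s1 ++ u :: s2 ++ u :: s3) = 0)].

(* For a of degree k and b of degree l only the k-th summand is nonzero, and
   (a /\ b)(v_1, ..., v_(k+l)) = 1/(k! l!) \sum_sigma sgn(sigma)
     a(v_sigma(1), ..., v_sigma(k)) b(v_sigma(k+1), ..., v_sigma(k+l)). *)
Definition wedge_prod a b : covector R n := fun vs =>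
  \sum_(k < (size vs).+1)
    (k`! * (size vs - k)`!)%:R^-1 *
    \sum_(sigma : 'S_(size vs))
      let us := [seq nth 0 vs (sigma i) | i <- enum 'I_(size vs)] in
      (-1) ^+ sigma * a (take k us) * b (drop k us).

(* The Riemannian volume form of the metric matrix G, for the standard
   orientation of R^n if rev = false and for the opposite one otherwise. *)
Definition vol (G : 'M[R]_n) (rev : bool) : covector R n := fun vs =>
  if size vs == n then
    (-1) ^+ rev * Num.sqrt (\det G) * \det (\matrix_(i < n) nth 0 vs i)
  else 0.

(* In coordinates, for b of degree k,
   (star b)_J = 1/k! \sum_I b^I vol_(I J), where the indices of b are raised
   with the inverse metric; thus a /\ star b = <a, b>_G vol. *)
Definition hodge (G : 'M[R]_n) (rev : bool) b : covector R n := fun vs =>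
  let k := (n - size vs)%N in
  k`!%:R^-1 *
  \sum_(I : k.-tuple 'I_n)
    b [seq row i (invmx G) | i <- I] *
    vol G rev ([seq delta_mx 0 i | i <- I] ++ vs).

End ExteriorAlgebra.

Section Forms.
Context (R : realType) (n : nat).
Implicit Types w : form R n.

Definition ext_d w : form R n := fun x vs =>
  \sum_(i < size vs)
    (-1) ^+ i * 'D_(nth 0 vs i) (fun y => w y (del i vs)) x.

(* Contraction with the position vector field. *)
Definition koszul w : form R n := fun x vs => w x (x :: vs).

Definition poly_form (j k : nat) w : Prop :=
  (forall x, alternating k (w x)) /\
  (forall I : seq 'I_n, exists P : mpoly.mpoly n R,
     (mpoly.msize P <= j.+1)%N /\
     forall x : 'rV[R]_n,
       w x [seq delta_mx 0 i | i <- I] = mpoly.meval (fun i => x 0 i) P).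

(* P^-_s Lambda^k = P_(s-1) Lambda^k + kappa P_(s-1) Lambda^(k+1), for s >= 1. *)
Definition trimmed_form (s k : nat) w : Prop :=
  exists mu nu : form R n,
    [/\ poly_form s.-1 k mu, poly_form s.-1 k.+1 nu & w = mu + koszul nu].

(* An ordered m-simplex of R^n is the list of its m+1 vertices.  It is
   parametrized by t |-> s_0 + t *m edges m s, for t in the standard simplex
   {t | 0 <= t_i, t_1 + ... + t_m <= 1} of R^m. *)
Definition edges (m : nat) (s : seq 'rV[R]_n) : 'M[R]_(m, n) :=
  \matrix_(i < m) (nth 0 s i.+1 - nth 0 s 0).

Definition pull (m : nat) (s : seq 'rV[R]_n) w : form R m := fun t us =>
  w (nth 0 s 0 + t *m edges m s) [seq u *m edges m s | u <- us].

Definition hull (s : seq 'rV[R]_n) : set 'rV[R]_n :=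
  [set x | exists c : 'I_(size s) -> R,
     [/\ (forall i, 0 <= c i), \sum_i c i = 1 &
         x = \sum_i c i *: nth 0 s i]].

(* C^oo on the open set U: all iterated directional derivatives exist and are
   differentiable on U. *)
Definition smooth_on (U : set 'rV[R]_n) (f : 'rV[R]_n -> R) : Prop :=
  forall (vs : seq 'rV[R]_n) (x : 'rV[R]_n), U x ->
    differentiable (foldr (fun v h => 'D_v h) (f : 'rV[R]_n -> R^o) vs) x.

(* A smooth Riemannian metric on the closed set M, given by its coordinate
   matrices; smoothness on M means smoothness of an extension to a
   neighborhood of M, and the values of g outside M play no other role. *)
Definition riemannian_metric (M : set 'rV[R]_n) (g : 'rV[R]_n -> 'M[R]_n) :
    Prop :=
  [/\ (exists2 U : set 'rV[R]_n, open U /\ M `<=` U &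
         forall i j, smooth_on U (fun x => g x i j)),
      (forall x, M x -> (g x)^T = g x) &
      (forall x (v : 'rV[R]_n), M x -> v != 0 -> 0 < (v *m g x *m v^T) 0 0)].

End Forms.
Arguments pull {R n} m s w.

Section Integration.
Context (R : realType).

(* The integral of f over {t in R^m | 0 <= t_i, t_1 + ... + t_m <= c}, as an
   iterated integral. *)
Fixpoint int_std (m : nat) (c : R) (f : seq R -> R) : R :=
  if m is m'.+1 then
    \int[lebesgue_measure]_(t in `[0, c])
      int_std m' (c - t) (fun ts => f (t :: ts))
  else f [::].

(* The integral of the degree m part of w over the standard simplex of R^m. *)
Definition int_ref (m : nat) (w : form R m) : R :=
  int_std m 1 (fun ts =>
    w (\row_i nth 0 ts i) [seq delta_mx 0 i | i <- enum 'I_m]).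

End Integration.
Arguments int_ref {R} m w.

(* A simplicial mesh, given by its n-simplices: two simplices meet exactly in
   the convex hull of their common vertices. *)
Record mesh (R : realType) (n : nat) := Mesh {
  cell : finType;
  vertices : cell -> n.+1.-tuple 'rV[R]_n;
  mesh_nondegenerate : forall c, edges n (vertices c) \in unitmx;
  mesh_distinct : forall c d, perm_eq (vertices c) (vertices d) -> c = d;
  mesh_conforming : forall c d,
    hull (vertices c) `&` hull (vertices d)
    = hull [seq v <- vertices c | v \in (vertices d : seq 'rV[R]_n)]
}.

Section Mesh.
Context (R : realType) (n : nat) (T : mesh R n).

Definition triangulates (M : set 'rV[R]_n) : Prop :=
  M = [set x | exists c : cell T, hull (vertices c) x].

Definition facet (f : cell T * 'I_n.+1) : seq 'rV[R]_n := del f.2 (vertices f.1).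

(* An orientation of the triangulated domain: on each simplex it is the standard
   orientation of R^n (rev c = false) or the opposite one (rev c = true), and
   simplices sharing a facet are oriented in the same way. *)
Definition orientation (rev : cell T -> bool) : Prop :=
  forall f f', perm_eq (facet f) (facet f') -> rev f.1 = rev f'.1.

Definition boundary_facet (f : cell T * 'I_n.+1) : bool :=
  [forall f', perm_eq (facet f) (facet f') ==> (f'.1 == f.1)].

(* The facets that triangulate the boundary of the domain. *)
Definition bfacet : finType := {f : cell T * 'I_n.+1 | boundary_facet f}.

(* Piecewise forms; the value on a simplex is meant there, but it is represented
   by an expression on R^n, which polynomial forms extend to uniquely. *)
Definition mform := cell T -> form R n.

(* Forms on the boundary of the domain: each one is a family of forms on the
   boundary facets, read in the affine charts of these facets. *)
Definition bform := bfacet -> form R n.-1.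

(* Trimmed finite element space of k-forms.  The pullbacks of the two pieces to
   a shared facet are compared in the same chart of this facet. *)
Definition FE (s k : nat) (w : mform) : Prop :=
  (forall c, trimmed_form s k (w c)) /\
  (forall f f', perm_eq (facet f) (facet f') ->
     pull n.-1 (facet f) (w f.1) = pull n.-1 (facet f) (w f'.1)).

Definition tr (w : mform) : bform := fun f =>
  pull n.-1 (facet (val f)) (w (val f).1).

Definition trFE (s k : nat) (b : bform) : Prop := exists2 w, FE s k w & b = tr w.

Definition dh (w : mform) : mform := fun c => ext_d (w c).

(* The sign of the ordered simplex c for the orientation rev. *)
Definition cell_sign (rev : cell T -> bool) (c : cell T) : R :=
  (-1) ^+ rev c * Num.sg (\det (edges n (vertices c))).

Definition int_M (rev : cell T -> bool) (w : mform) : R :=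
  \sum_c cell_sign rev c * int_ref n (pull n (vertices c) (w c)).

(* The boundary has the induced (outward normal first) orientation: the facet
   opposite to the i-th vertex gets the sign (-1)^i relative to its cell. *)
Definition int_bd (rev : cell T -> bool) (b : bform) : R :=
  \sum_(f : bfacet)
    (-1) ^+ (val f).2 * cell_sign rev (val f).1 * int_ref n.-1 (b f).

(* <a | b>_M *)
Definition pair_M (rev : cell T -> bool) (a b : mform) : R :=
  int_M rev (fun c x => wedge_prod (a c x) (b c x)).

(* <a | b>_(dM) *)
Definition pair_bd (rev : cell T -> bool) (a b : bform) : R :=
  int_bd rev (fun f t => wedge_prod (a f t) (b f t)).

(* (a , b)_M *)
Definition inner_M (rev : cell T -> bool) (g : 'rV[R]_n -> 'M[R]_n)
    (a b : mform) : R :=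
  pair_M rev a (fun c x => hodge (g x) (rev c) (b c x)).

End Mesh.

(* Main.v *)
(* The weak equations hf1 = (-1)^r d he2 and f2 = d e1 hold strongly: d maps the
   trimmed spaces into each other (the traces agree because pullbacks commute with
   d), so the difference v of both sides is a test form, and (v, v)_M = 0 forces
   v = 0 on every simplex, since the integrand is continuous and positive definite
   (a /\ star a is a positive multiple of |a|^2, by a Cholesky factorization of the
   metric). The power balance then becomes
   (-1)^(p-1) (int_M d w - int_(dM) tr w) with w = he2 /\ e1, by the Leibniz rule and
   the graded commutativity of the wedge product. This vanishes by Stokes' theorem,
   simplex by simplex: two simplices that share a facet lie on opposite sides of it
   (otherwise their interiors would meet), so the interior facets cancel. On a
   simplex, Stokes' theorem for polynomial forms reduces to monomials. *)
Require Import Defs.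
From mathcomp Require Import all_boot all_order all_algebra all_fingroup.
From mathcomp Require Import all_classical all_reals all_analysis.
From mathcomp Require Import ring lra zify.
From mathcomp Require mpoly.
Import (canonicals, coercions) mpoly.

Set Implicit Arguments.
Unset Strict Implicit.
Unset Printing Implicit Defensive.

Import Order.TTheory GRing.Theory Num.Theory.
Import numFieldNormedType.Exports.

Local Open Scope classical_set_scope.
Local Open Scope ring_scope.

(* These names of Defs are shadowed by all_algebra. *)
Local Notation alternating := Defs.alternating.
Local Notation form R n := ('rV[R]_n -> covector R n).

(** * Iterated integrals over a simplex *)

(** The sign (-1)^(p-1) arises as follows. Moving the p-form d [he2] past the (q-1)-form [e1] costs
    (-1)^(p(q-1)), and the equation for [hf1] carries (-1)^r with r = pq+1; the exponents add up to
    p-1 modulo 2. The term he2 /\ d e1 is (-1)^(p-1) times the second term of the Leibniz rule, and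
    the boundary flow carries (-1)^p, the opposite sign. Two cells list a common facet in different
    orders and thus read it in different charts. No change of variables is used to compare the two
    integrals: Dirichlet's formula is symmetric in the barycentric coordinates, so the integral sees
    the order only through a sign. Signs are handled by one notion: determinants, coefficients of
    forms and orientations are all antisymmetric functions of lists, and a product of two such
    functions is invariant under permutations. The metric is controlled on M alone, so the strong
    equations are derived, and used, at the points of the closed simplices. *)

Section SegmentIntegral.
Context {R : realType}.
Notation mu := (@lebesgue_measure R).
Implicit Types (f g : R -> R) (c : R).

Lemma itv_integrable f a c : continuous f ->
  mu.-integrable `[a, c] (EFin \o f).
Proof.
move=> cf; apply: (@continuous_compact_integrable R f).
  exact: segment_compact.
exact: continuous_subspaceT.
Qed.

Lemma int_itvD f g c : continuous f -> continuous g ->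
  \int[mu]_(t in `[0, c]) (f t + g t)
  = \int[mu]_(t in `[0, c]) f t + \int[mu]_(t in `[0, c]) g t.
Proof. by move=> cf cg; rewrite RintegralD//; exact: itv_integrable. Qed.

Lemma int_itvZ f c r : continuous f ->
  \int[mu]_(t in `[0, c]) (r * f t) = r * \int[mu]_(t in `[0, c]) f t.
Proof. by move=> cf; rewrite RintegralZl//; exact: itv_integrable. Qed.

Lemma int_itv_lt0 f c : c <= 0 -> \int[mu]_(t in `[0, c]) f t = 0.
Proof.
rewrite le_eqVlt => /predU1P[->|c0].
  by rewrite set_itv1 Rintegral_set1.
by rewrite set_itv_ge ?Rintegral_set0// bnd_simp -ltNge.
Qed.

Lemma int_itv_horner (p : {poly R}) c : 0 <= c ->
  \int[mu]_(t in `[0, c]) p^`().[t] = p.[c] - p.[0].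
Proof.
rewrite le_eqVlt => /predU1P[<-|c0]; first by rewrite int_itv_lt0// subrr.
rewrite /Rintegral (@continuous_FTC2 R (horner p^`()) (horner p))//.
- by apply: continuous_subspaceT => x; exact: continuous_horner.
- split => [x _||]; first exact: derivable_horner.
    by apply: cvg_at_right_filter; exact: continuous_horner.
  by apply: cvg_at_left_filter; exact: continuous_horner.
- by move=> x _; rewrite derivE.
Qed.

(** The polynomial t^(a+1) (c-t)^(b+1) vanishes at 0 and at c, so its derivative has integral 0;
    this trades one factor c-t for one factor t, whence the induction on [b] for all [a]. *)
Lemma int_beta a b c : 0 <= c ->
  \int[mu]_(t in `[0, c]) (t ^+ a * (c - t) ^+ b)
  = (a`! * b`!)%:R / (a + b).+1`!%:R * c ^+ (a + b).+1.
Proof.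
move=> c0; elim: b a => [|b IHb] a.
  under eq_Rintegral do rewrite expr0 mulr1.
  pose p : {poly R} := a.+1%:R^-1 *: 'X^(a.+1).
  have hp t : t ^+ a = p^`().[t].
    rewrite /p derivZ derivXn hornerZ hornerMn hornerXn /= -[X in _ * X]mulr_natr mulrCA.
    by rewrite mulVf ?pnatr_eq0// mulr1.
  under eq_Rintegral do rewrite hp.
  rewrite int_itv_horner// /p !hornerZ !hornerXn expr0n mulr0 subr0.
  rewrite addn0 muln1 factS natrM; congr (_ * _).
  by rewrite invfM mulrCA divff ?mulr1// pnatr_eq0 -lt0n fact_gt0.
pose p : {poly R} := 'X^(a.+1) * (c%:P - 'X) ^+ b.+1.
have hp t : p^`().[t] = a.+1%:R * (t ^+ a * (c - t) ^+ b.+1)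
    + (- b.+1%:R) * (t ^+ a.+1 * (c - t) ^+ b).
  rewrite /p derivM derivXn deriv_exp derivB derivC derivX sub0r.
  by rewrite !(hornerMn, horner_exp, hornerE) /=; ring.
have cq (i j : nat) : continuous (fun t : R => t ^+ i * (c - t) ^+ j).
  have -> : (fun t : R => t ^+ i * (c - t) ^+ j)
     = horner ('X^i * (c%:P - 'X) ^+ j).
    by apply/funext => t; rewrite !(hornerE, horner_exp).
  exact: continuous_horner.
have := int_itv_horner p c0.
under eq_Rintegral do rewrite hp.
have cz (k : R) (i j : nat) : continuous (fun t : R => k * (t ^+ i * (c - t) ^+ j)).
  by move=> x; apply: cvgMr; exact: cq.
rewrite (int_itvD (f := fun t => a.+1%:R * (t ^+ a * (c - t) ^+ b.+1)))//.
rewrite (int_itvZ (f := fun t => (t ^+ a * (c - t) ^+ b.+1)))//.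
rewrite (int_itvZ (f := fun t => (t ^+ a.+1 * (c - t) ^+ b)))// IHb.
have -> : p.[c] - p.[0] = 0.
  by rewrite /p !(hornerE, horner_exp) subrr !expr0n /= mulr0 !mul0r subr0.
have a0 : (a.+1%:R : R) != 0 by rewrite pnatr_eq0.
rewrite mulNr => /subr0_eq h; apply: (mulfI a0); rewrite h.
rewrite addSn addnS !factS !natrM; ring.
Qed.

(** The value at 1 is the left limit. It is used along segments that end at a boundary point, of an
    interval and later of a simplex. *)
Lemma continuous_zero_closure f : continuous f ->
  (forall t, 0 < t < 1 -> f t = 0) -> f 1 = 0.
Proof.
move=> cf f0; have h : f t @[t --> (1 : R)^'-] --> f 1.
  by apply: cvg_at_left_filter; exact: cf.
rewrite -(cvg_lim (@Rhausdorff R) h); apply: cvg_lim; first exact: Rhausdorff.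
have : (fun=> 0 : R) @ (1 : R)^'- --> (0 : R) by exact: cvg_cst.
apply: cvg_trans; apply: near_eq_cvg; near=> t.
by rewrite f0//; apply/andP; split => //; near: t; exact: nbhs_left_gt.
Unshelve. all: by end_near. Qed.

(** The primitive of [f] is nondecreasing from 0 to 0, hence constant, and its derivative [f]
    vanishes inside; the endpoints follow by continuity. *)
Lemma int_itv_eq0 f c : 0 < c -> continuous f ->
  (forall t, 0 <= t <= c -> 0 <= f t) -> \int[mu]_(t in `[0, c]) f t = 0 ->
  forall t, 0 <= t <= c -> f t = 0.
Proof.
move=> c0 cf f0 If.
have oo t : 0 < t < c -> f t = 0.
  move=> /andP[t0 tc].
  have [dF <-] := continuous_FTC1_closed tc (itv_integrable 0 c cf) t0 (cf t).
  rewrite derive1E.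
  rewrite -[RHS](@derive_cst _ _ _ (0 : R^o) t 1).
  apply: near_eq_derive.
  near=> y; rewrite /cst /=.
  have y0 : 0 < y by near: y; exact: lt_nbhsr.
  have yc : y < c by near: y; exact: lt_nbhsl.
  have fge (a b : R) : 0 <= a -> b <= c -> 0 <= \int[mu]_(t in `[a, b]) f t.
    move=> a0 bc; apply: Rintegral_ge0 => x /=; rewrite in_itv/= => /andP[ax xb].
    by rewrite f0// (le_trans a0 ax) (le_trans xb bc).
  have : 0 <= \int[mu]_(t in `[0, c]) f t - \int[mu]_(t in `[0, y]) f t.
    rewrite (@Rintegral_itvB R f (BLeft 0) (BRight c) y);
      [|exact: itv_integrable|by rewrite bnd_simp ltW|by rewrite bnd_simp ltW].
    apply: Rintegral_ge0 => x /=; rewrite in_itv/= => /andP[ax xb].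
    by rewrite f0// xb andbT (le_trans (ltW y0))// ltW.
  rewrite If sub0r oppr_ge0 => h; apply/eqP.
  by rewrite eq_le h (fge 0 y (lexx 0) (ltW yc)).
have half t : 0 <= t < c -> f t = 0.
  move=> /andP[t0 tc].
  (* The segment from the midpoint of [t] and [c] to [t] stays in the open interval before its end,
     even for t = 0. *)
  have := @continuous_zero_closure (fun s => f (s * t + (1 - s) * ((t + c) / 2))).
  rewrite mul1r subrr mul0r addr0; apply.
    move=> s; apply: continuous_comp; last exact: cf.
    apply: cvgD; first by apply: cvgMl; exact: cvg_id.
    by apply: cvgMl; apply: cvgB; [exact: cvg_cst|exact: cvg_id].
  by move=> s s01; apply: oo; nra.
move=> t /andP[t0]; rewrite le_eqVlt => /predU1P[->|tc]; last first.
  by apply: half; rewrite t0.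
have := @continuous_zero_closure (fun s => f (s * c)).
rewrite mul1r; apply => [s|s s01].
  apply: continuous_comp; last exact: cf.
  by apply: cvgMl; exact: cvg_id.
by apply: half; nra.
Unshelve. all: by end_near. Qed.

End SegmentIntegral.

(** * Iterated integrals depending on parameters, and Dirichlet's formula *)

Section ParametricIntegral.
Context {R : realType}.
Notation mu := (@lebesgue_measure R).

(** The flag [b] covers both the closed interval and the half-open one that remains when an integral
    is split at a point. *)
Lemma int_itv_norm_le (b : bool) (f : R -> R) (a c K : R) :
  continuous f -> a <= c -> (forall t, a <= t <= c -> `|f t| <= K) ->
  `|\int[mu]_(t in [set` Interval (BSide b a) (BRight c)]) f t| <= K * (c - a).
Proof.
move=> cf ac fK.
have sub : [set` Interval (BSide b a) (BRight c)] `<=` `[a, c].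
  by apply: subset_itvr; case: b; rewrite bnd_simp.
have If : mu.-integrable [set` Interval (BSide b a) (BRight c)] (EFin \o f).
  by apply: integrableS (itv_integrable a c cf).
apply: (le_trans (le_normr_Rintegral (mu := mu) _ If)) => //.
have IK : mu.-integrable [set` Interval (BSide b a) (BRight c)] (EFin \o cst K).
  apply: integrableS (itv_integrable a c _) => //.
  by move=> x; exact: cvg_cst.
apply: (@le_trans _ _ (\int[mu]_(t in [set` Interval (BSide b a) (BRight c)]) K)).
  apply: le_Rintegral => //.
    by apply: integrable_norm.
  by move=> x /sub /=; rewrite in_itv/=; exact: fK.
rewrite Rintegral_cst//.
have -> : fine (mu [set` Interval (BSide b a) (BRight c)]) = c - a.
  have E := @lebesgue_measure_itv R (Interval (BSide b a) (BRight c)).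
  rewrite [X in fine X]E /= lte_fin.
  by move: ac; rewrite le_eqVlt => /predU1P[->|->//]; rewrite ltxx subrr.
by [].
Qed.

Lemma int_itv_maxr0 (f : R -> R) a :
  \int[mu]_(t in `[0, a]) f t = \int[mu]_(t in `[0, Num.max a 0]) f t.
Proof.
case: (leP a 0) => a0 //.
by rewrite !int_itv_lt0.
Qed.

(** Negative endpoints are allowed: the integral over an empty interval is 0, so an endpoint can be
    truncated at 0, and truncation is 1-Lipschitz. *)
Lemma int_itv_lipschitz (f : R -> R) (B K a c : R) :
  continuous f -> (forall t, 0 <= t <= B -> `|f t| <= K) -> 0 <= K ->
  a <= B -> c <= B -> 0 <= B ->
  `|\int[mu]_(t in `[0, a]) f t - \int[mu]_(t in `[0, c]) f t| <= K * `|a - c|.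
Proof.
move=> cf fK K0 aB cB B0.
rewrite (int_itv_maxr0 f a) (int_itv_maxr0 f c).
set a' := Num.max a 0; set c' := Num.max c 0.
have a'0 : 0 <= a' by rewrite le_max lexx orbT.
have c'0 : 0 <= c' by rewrite le_max lexx orbT.
have a'B : a' <= B by rewrite ge_max aB.
have c'B : c' <= B by rewrite ge_max cB.
have ac' : `|a' - c'| <= `|a - c|.
  rewrite /a' /c'; case: (leP a 0) => a0; case: (leP c 0) => c0.
  - by rewrite subrr normr0.
  - have h : a - c <= 0 by lra.
    by rewrite sub0r normrN (gtr0_norm c0) (ler0_norm h); lra.
  - have h : 0 <= a - c by lra.
    by rewrite subr0 (gtr0_norm a0) (ger0_norm h); lra.
  - by [].
apply: le_trans (ler_wpM2l K0 ac').
have key (x y : R) : 0 <= x -> x <= y -> y <= B ->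
  `|\int[mu]_(t in `[0, y]) f t - \int[mu]_(t in `[0, x]) f t| <= K * (y - x).
  move=> x0 xy yB.
  rewrite (@Rintegral_itvB R f (BLeft 0) (BRight y) x);
    [|exact: itv_integrable|by rewrite bnd_simp|by rewrite bnd_simp].
  apply: int_itv_norm_le => // t /andP[xt ty].
  by rewrite fK// (le_trans x0 xt) (le_trans ty).
case: (leP a' c') => ac.
  have h : a' - c' <= 0 by rewrite subr_le0.
  by rewrite distrC (ler0_norm h) opprB; exact: key.
have h : 0 < a' - c' by rewrite subr_gt0.
by rewrite (gtr0_norm h); apply: key => //; exact: ltW.
Qed.

Lemma continuous_uncurry2 (X : topologicalType) (F : X * R -> R) x :
  continuous F -> continuous (fun t => F (x, t)).
Proof.
move=> cF t.
apply: (@continuous2_cvg R X R R (nbhs t) _ (fun=> x) id (fun x t => F (x, t)) x t).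
- have := cF (x, t); rewrite (_ : F = (fun xy : X * R => F (xy.1, xy.2)))//.
  by apply/funext => -[].
- exact: cvg_cst.
- exact: cvg_id.
Qed.

(** The variation is split into that of the integrand, which is uniformly small on a compact
    interval containing all nearby domains, and that of the endpoint, in which the integral is
    Lipschitz. *)
Lemma continuous_int_itv (X : topologicalType) (F : X * R -> R) (b : X -> R) :
  continuous b -> continuous F ->
  continuous (fun x => \int[mu]_(t in `[0, b x]) F (x, t)).
Proof.
move=> cb cF x0; apply/cvgrPdist_le => e e0.
(* [B] bounds [b x] as soon as [b x] is within 1 of [b x0]. *)
set B := `|b x0| + 1.
have B0 : 0 < B by rewrite ltr_pwDr.
have cF0 x : continuous (fun t => F (x, t)) by exact: continuous_uncurry2.
have [K K0 FK] : exists2 K, 0 <= K & forall t, 0 <= t <= B -> `|F (x0, t)| <= K.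
  have /compact_bounded[M [Mr MP]] : compact ((fun t => F (x0, t)) @` `[0, B]).
    apply: continuous_compact; last exact: segment_compact.
    exact: continuous_subspaceT.
  exists (`|M| + 1); first by rewrite addr_ge0.
  move=> t tB; apply: MP; last by exists t => //=; rewrite in_itv.
  by rewrite (le_lt_trans (ler_norm _))// ltrDl.
(* Compactness of [0, B] makes the closeness uniform in t; half of the bound pays for the step from
   (x, t') to (x0, t), half for the step from there to (x0, t'). *)
have nF : \forall x \near x0, `[0, B] `<=`
    [set t | `|F (x, t) - F (x0, t)| <= e / (2 * B)].
  have := @segment_compact R 0 B.
  move=> /compact_near_coveringP; apply => t tB.
  have h : 0 < e / (2 * B) / 2 by rewrite !divr_gt0 ?mulr_gt0.
  have /cvgrPdist_le/(_ _ h) := cF (x0, t).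
  move=> [[/= U V] [Ux Vt] UV].
  exists (V, U); first by split.
  move=> [t' x] /= [Vt' Ux'].
  have /= h1 := UV (x, t') (conj Ux' Vt').
  have /= h2 := UV (x0, t') (conj (nbhs_singleton Ux) Vt').
  rewrite (_ : F (x, t') - F (x0, t') =
    (F (x0, t) - F (x0, t')) - (F (x0, t) - F (x, t'))); last by lra.
  by rewrite (le_trans (ler_normB _ _))// [leRHS]splitr lerD.
(* K + 1 instead of K, which may be 0. *)
have nb : \forall x \near x0, `|b x - b x0| <= e / (2 * (K + 1)).
  have h : 0 < e / (2 * (K + 1)) by rewrite divr_gt0// mulr_gt0// ltr_wpDl.
  have /cvgrPdist_le/(_ _ h) := cb x0.
  by apply: filterS => x; rewrite distrC.
have nb1 : \forall x \near x0, `|b x - b x0| <= 1.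
  have /cvgrPdist_le/(_ _ ltr01) := cb x0.
  by apply: filterS => x; rewrite distrC.
near=> x.
have bx : b x <= B.
  have : `|b x - b x0| <= 1 by near: x; exact: nb1.
  have := ler_norm (b x0); have := ler_norm (b x - b x0); rewrite /B; lra.
have bx0 : b x0 <= B by have := ler_norm (b x0); rewrite /B; lra.
rewrite distrC.
rewrite (_ : _ - _ = (\int[mu]_(t in `[0, b x]) F (x, t)
    - \int[mu]_(t in `[0, b x]) F (x0, t))
   + (\int[mu]_(t in `[0, b x]) F (x0, t)
    - \int[mu]_(t in `[0, b x0]) F (x0, t))); last by rewrite addrA subrK.
rewrite (le_trans (ler_normD _ _))// [leRHS]splitr lerD//.
  rewrite (int_itv_maxr0 _ (b x)) (int_itv_maxr0 (fun t => F (x0, t)) (b x)).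
  rewrite -RintegralB//; try exact: itv_integrable.
  set b' := Num.max (b x) 0.
  have b'0 : 0 <= b' by rewrite le_max lexx orbT.
  have b'B : b' <= B by rewrite ge_max bx ltW.
  apply: (@le_trans _ _ (e / (2 * B) * (b' - 0))).
    apply: int_itv_norm_le => // [t|t /andP[t0 tb]].
      by apply: cvgB; exact: cF0.
    have : `[0, B] `<=` [set t | `|F (x, t) - F (x0, t)| <= e / (2 * B)].
      by near: x; exact: nF.
    by apply; rewrite /= in_itv/= t0 (le_trans tb).
  rewrite subr0 (le_trans (ler_wpM2l _ b'B))//.
    by rewrite divr_ge0 ?mulr_ge0// ltW.
  by rewrite invfM mulrA divfK// gt_eqF.
apply: (le_trans (int_itv_lipschitz (B := B) (cF0 x0) FK K0 bx bx0 (ltW B0))).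
have : `|b x - b x0| <= e / (2 * (K + 1)) by near: x; exact: nb.
move=> /(ler_wpM2l K0) /le_trans; apply.
rewrite mulrA ler_pdivrMr ?mulr_gt0 ?ltr_wpDl//.
by have := mulr_ge0 K0 (ltW e0); lra.
Unshelve. all: by end_near. Qed.

(* Joint continuity in x and the m entries of ts; these are moved one by one
   into the parameter space, since the domains of the inner integrals of
   [int_std] depend on the outer variables. *)
Fixpoint jcont (m : nat) (X : topologicalType) (f : X -> seq R -> R) : Prop :=
  if m is m'.+1 then
    jcont m' (fun (xt : X * R) ts => f xt.1 (xt.2 :: ts))
  else continuous (fun x => f x [::]).

(** In the induction the outer variable t joins the parameter, and the inner bound b x - t is
    continuous in the pair (x, t). *)
Lemma continuous_int_std m (X : topologicalType) (f : X -> seq R -> R)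
    (b : X -> R) :
  continuous b -> jcont m f -> continuous (fun x => int_std m (b x) (f x)).
Proof.
elim: m X f b => [|m IHm] X f b cb //= jf.
have /(_ (fun xt : X * R => b xt.1 - xt.2)) := IHm _ _ _ _ jf.
move=> h; apply: (continuous_int_itv cb (h _)) => xt.
apply: cvgB; last exact: cvg_snd.
by apply: (@continuous_comp _ _ _ fst b); [exact: cvg_fst|exact: cb].
Qed.

Lemma continuous_int_std_cons m (X : topologicalType) (f : X -> seq R -> R)
    (c : R) x : jcont m.+1 f ->
  continuous (fun t => int_std m (c - t) (fun ts => f x (t :: ts))).
Proof.
move=> jf.
have cb : continuous (fun xt : X * R => c - xt.2).
  by move=> xt; apply: cvgB; [exact: cvg_cst|exact: cvg_snd].
exact: (@continuous_uncurry2 _ (fun xt : X * R =>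
  int_std m (c - xt.2) (fun ts => f xt.1 (xt.2 :: ts))) x
  (continuous_int_std cb jf)).
Qed.

(** Additivity of the outer integral needs its integrands, which are inner integrals, to be
    continuous. The parameter serves the induction, where [x] becomes (x, t). *)
Lemma int_stdD m (X : topologicalType) (f g : X -> seq R -> R) (c : R) x :
  jcont m f -> jcont m g ->
  int_std m c (fun ts => f x ts + g x ts)
  = int_std m c (f x) + int_std m c (g x).
Proof.
elim: m X f g c x => [|m IHm] X f g c x // jf jg /=.
rewrite -int_itvD; try exact: continuous_int_std_cons.
by apply: eq_Rintegral => t _; rewrite -(IHm _ _ _ _ (x, t) jf jg).
Qed.

Lemma int_stdZ m (X : topologicalType) (f : X -> seq R -> R) (c k : R) x :
  jcont m f ->
  int_std m c (fun ts => k * f x ts) = k * int_std m c (f x).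
Proof.
elim: m X f c x => [|m IHm] X f c x // jf /=.
rewrite -int_itvZ; last exact: continuous_int_std_cons.
by apply: eq_Rintegral => t _; rewrite -(IHm _ _ _ (x, t) jf).
Qed.

Definition in_simplex m (c : R) (ts : seq R) : Prop :=
  [/\ size ts = m, all (fun t => 0 <= t) ts & \sum_(t <- ts) t <= c].

Lemma in_simplex_cons m c t ts : 0 <= t <= c -> in_simplex m (c - t) ts ->
  in_simplex m.+1 c (t :: ts).
Proof.
move=> /andP[t0 tc] [sz ts0 le]; split => /=; rewrite ?sz ?t0//.
by rewrite big_cons -lerBrDl.
Qed.

Lemma eq_int_std m (c : R) (f g : seq R -> R) :
  (forall ts, in_simplex m c ts -> f ts = g ts) -> 0 <= c ->
  int_std m c f = int_std m c g.
Proof.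
elim: m c f g => [|m IHm] c f g fg c0 /=.
  by apply: fg; split => //; rewrite big_nil.
apply: eq_Rintegral => t; rewrite inE/= in_itv/= => tc.
apply: IHm; last by rewrite subr_ge0; case/andP: tc.
by move=> ts h; apply: fg; exact: in_simplex_cons.
Qed.

Lemma int_std_ge0 m (c : R) (f : seq R -> R) : 0 <= c ->
  (forall ts, in_simplex m c ts -> 0 <= f ts) -> 0 <= int_std m c f.
Proof.
elim: m c f => [|m IHm] c f c0 f0 /=.
  by apply: f0; split => //; rewrite big_nil.
apply: Rintegral_ge0 => t /=; rewrite in_itv/= => tc.
apply: IHm; first by rewrite subr_ge0; case/andP: tc.
by move=> ts h; apply: f0; exact: in_simplex_cons.
Qed.

(** The face where the sum of the coordinates is [c] is left out, since the inner simplices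
    degenerate there: the induction needs the size c - t to be positive. [Int_ge0_eq0] recovers this
    face by continuity. *)
Lemma int_std_eq0 m (X : topologicalType) (f : X -> seq R -> R) (c : R) x :
  0 < c -> jcont m f -> (forall ts, in_simplex m c ts -> 0 <= f x ts) ->
  int_std m c (f x) = 0 ->
  forall ts, in_simplex m c ts -> \sum_(t <- ts) t < c -> f x ts = 0.
Proof.
elim: m X f c x => [|m IHm] X f c x c0 jf f0 If ts.
  by case: ts => [|? ?] [].
case: ts => [|t ts] [] // [sz] /= /andP[t0 ts0] le lt.
have st : 0 <= \sum_(t <- ts) t.
  rewrite big_seq sumr_ge0// => i its; exact: (allP ts0).
rewrite big_cons in le lt.
have tc : t < c by lra.
apply: (IHm _ _ (c - t) (x, t) _ jf _ _ ts).
- by rewrite subr_gt0.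
- move=> us us'; apply: f0; apply: in_simplex_cons => //.
  by rewrite t0 ltW.
- have := int_itv_eq0 c0 (continuous_int_std_cons (c := c) (x := x) jf).
  apply => //; last by rewrite t0 ltW.
  move=> s sc; apply: int_std_ge0; first by rewrite subr_ge0; case/andP: sc.
  by move=> us us'; apply: f0; exact: in_simplex_cons.
- by split => //; lra.
- lra.
Qed.

Fixpoint monom (al : seq nat) (ts : seq R) : R :=
  match al, ts with
  | a :: al', t :: ts' => t ^+ a * monom al' ts'
  | _, _ => 1
  end.

(* Dirichlet's formula. It is symmetric in all the barycentric coordinates, which
   gives the invariance of the integral under permutations of the vertices and,
   applied to a monomial and to its derivative, Stokes' theorem. *)
Lemma int_std_dirichlet (al : seq nat) (b : nat) (c k : R) : 0 <= c ->
  int_std (size al) c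
    (fun ts => k * (monom al ts * (c - \sum_(t <- ts) t) ^+ b))
  = k * ((\prod_(a <- al) a`! * b`!)%:R / (size al + sumn al + b)`!%:R
         * c ^+ (size al + sumn al + b)).
Proof.
elim: al c k => [|a al IHal] c k c0.
  by rewrite /= !big_nil subr0 mul1r mul1n add0n divff ?mul1r//
    pnatr_eq0 -lt0n fact_gt0.
rewrite [LHS]/=.
set N := (size al + sumn al + b)%N.
set C := (\prod_(a <- al) a`! * b`!)%N.
(* By induction the inner integral is a multiple of (c - t)^N, which leaves a Beta integral. *)
transitivity (\int[mu]_(t in `[0, c])
  ((k * (C%:R / N`!%:R)) * (t ^+ a * (c - t) ^+ N))).
  apply: eq_Rintegral => t; rewrite inE/= in_itv/= => /andP[t0 tc].
  rewrite (_ : _ * (t ^+ a * _) = k * t ^+ a * (C%:R / N`!%:R * (c - t) ^+ N));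
    last by ring.
  rewrite -IHal ?subr_ge0//; apply: eq_int_std; last by rewrite subr_ge0.
  by move=> ts _; rewrite big_cons opprD addrA; ring.
rewrite int_itvZ; last first.
  have -> : (fun t : R => t ^+ a * (c - t) ^+ N)
     = horner ('X^a * (c%:P - 'X) ^+ N).
    by apply/funext => t; rewrite !(hornerE, horner_exp).
  by move=> t; exact: continuous_horner.
rewrite int_beta// big_cons -/C.
have -> : (size (a :: al) + sumn (a :: al) + b = (a + N).+1)%N.
  by rewrite /= /N; lia.
have fn0 (i : nat) : i`!%:R != 0 :> R by rewrite pnatr_eq0 -lt0n fact_gt0.
rewrite {}/C; set P := (\prod_(j <- al) j`!)%N.
rewrite (natrM R a`! N`!) (natrM R P) (natrM R (a`! * P)%N) (natrM R a`!).
move: (fn0 N) (fn0 (a + N).+1).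
move: (N`!%:R) ((a + N).+1`!%:R) => x y x0 y0; field.
by rewrite x0 y0.
Qed.

End ParametricIntegral.

(** * Alternating covectors *)

Section Antisymmetry.
Context {R : realType}.

Lemma big_tuple_cons (T : finType) k (F : seq T -> R) :
  \sum_(I : k.+1.-tuple T) F I = \sum_(i : T) \sum_(I : k.-tuple T) F (i :: I).
Proof.
rewrite pair_big /=.
rewrite (reindex (fun p : T * k.-tuple T => [tuple of p.1 :: p.2])) //=.
exists (fun I : k.+1.-tuple T => (thead I, [tuple of behead I])) => [[i I] _|I _] /=.
  by rewrite theadE; congr (_, _); apply: val_inj.
by case/tupleP: I => i I; apply: val_inj.
Qed.

(** Stated for lists over any type, so that it applies alike to arguments of covectors, to lists of
    indices and to lists of vertices. *)
Definition antisym (T : Type) (F : seq T -> R) : Prop :=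
  forall s1 x y s2, F (s1 ++ x :: y :: s2) = - F (s1 ++ y :: x :: s2).

Lemma antisym_catCA T (F : seq T -> R) s1 s s' s2 : antisym F ->
  F (s1 ++ s ++ s' ++ s2) = (-1) ^+ (size s * size s') * F (s1 ++ s' ++ s ++ s2).
Proof.
move=> aF; elim: s s1 => [|x s IHs] s1.
  by rewrite mul0n expr0 mul1r.
rewrite -cat1s -(catA [:: x]) (catA s1) IHs -catA /=.
rewrite mulSn exprD -mulrA mulrCA; congr (_ * _).
elim: s' s1 {IHs} => [|y s' IHs'] s1; first by rewrite expr0 mul1r.
rewrite /= aF -cat1s catA IHs' exprS -catA /= mulN1r; ring.
Qed.

(** Exchanges of adjacent blocks generate all permutations, and each multiplies both factors by the
    same sign. No sign of a list permutation has to be defined: [G] plays its role. *)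
Lemma antisym_perm (T : eqType) (F G : seq T -> R) s t :
  antisym F -> antisym G -> perm_eq s t -> F s * G s = F t * G t.
Proof.
move=> aF aG st.
apply: (catCA_perm_ind (P := fun u => F s * G s = F u * G u) _ st) => //.
move=> s1 s2 s3 ->.
rewrite -[s1 ++ _]cat0s -[s2 ++ _]cat0s.
rewrite (antisym_catCA [::] s1 s2 s3 aF) (antisym_catCA [::] s1 s2 s3 aG).
by rewrite mulrACA -expr2 sqrr_sign mul1r.
Qed.

Definition detrows (N : nat) (rows : seq (seq R)) : R :=
  \det (\matrix_(i < N, j < N) nth 0 (nth [::] rows i) j).

Lemma detrows_antisym N s1 x y s2 : size (s1 ++ x :: y :: s2) = N ->
  detrows N (s1 ++ x :: y :: s2) = - detrows N (s1 ++ y :: x :: s2).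
Proof.
move=> sN.
have h0 : (size s1 < N)%N by rewrite -sN size_cat /=; lia.
have h1 : ((size s1).+1 < N)%N by rewrite -sN size_cat /=; lia.
pose s := tperm (Ordinal h0) (Ordinal h1).
rewrite /detrows.
have -> : (\matrix_(i < N, j < N) nth 0 (nth [::] (s1 ++ x :: y :: s2) i) j)
  = row_perm s (\matrix_(i < N, j < N) nth 0 (nth [::] (s1 ++ y :: x :: s2) i) j).
  apply/matrixP => i j; rewrite !mxE; congr (nth 0 _ j).
  rewrite /s; case: tpermP => [->|->|] /=.
  - by rewrite !nth_cat ltnn subnn ltnNge leqnSn /= subSn// subnn.
  - by rewrite !nth_cat ltnn subnn ltnNge leqnSn /= subSn// subnn.
  - move=> /eqP; rewrite -val_eqE /= => i0 /eqP; rewrite -val_eqE /= => i1.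
    rewrite !nth_cat; case: ltnP => // si.
    by case E : (i - size s1)%N => [|[|m]] //=; lia.
rewrite row_permE det_mulmx det_perm odd_tperm -val_eqE /=.
by rewrite neq_ltn ltnSn /= expr1 mulN1r.
Qed.

(** A general [phi] covers the coordinates of vectors, which give [dx], and the Kronecker symbol,
    which gives signs of permutations. *)
Definition gram (A B : Type) (phi : A -> B -> R) (s : seq A) (t : seq B) : R :=
  if size s == size t then detrows (size s) [seq [seq phi a b | b <- t] | a <- s]
  else 0.

Lemma gram_tr A B (phi : A -> B -> R) s t :
  gram phi s t = gram (fun b a => phi a b) t s.
Proof.
rewrite /gram eq_sym; case: eqP => // st.
rewrite /detrows -det_tr st; congr (\det _); apply/matrixP => i j; rewrite !mxE.
case: t s st i j => [|b0 t]; first by case=> [|//] ? [m i]; have := i; rewrite ltn0.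
move=> [|a0 s] // st i j.
have ib (k : 'I_(size (a0 :: s))) : (k < size (b0 :: t))%N by rewrite st.
rewrite (nth_map a0)// (nth_map b0)// (nth_map b0)//.
by rewrite (nth_map a0).
Qed.

Lemma gram_antisym A B (phi : A -> B -> R) t : antisym (gram phi ^~ t).
Proof.
move=> s1 x y s2; rewrite /gram !size_cat /=; case: eqP => [st|]; last by rewrite oppr0.
by rewrite !map_cat /= detrows_antisym// !size_cat /= !size_map.
Qed.

Lemma gram_antisymr A B (phi : A -> B -> R) s : antisym (gram phi s).
Proof. by move=> s1 x y s2; rewrite !(gram_tr phi) (gram_antisym _ _). Qed.

Lemma gram_leibniz A B (phi : A -> B -> R) N (f : 'I_N -> A) (h : 'I_N -> B) :
  gram phi [seq f i | i <- enum 'I_N] [seq h i | i <- enum 'I_N]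
  = \sum_(s : 'S_N) (-1) ^+ s * \prod_i phi (f i) (h (s i)).
Proof.
rewrite /gram (size_map f) (size_map h) eqxx size_enum_ord /detrows /determinant.
apply: eq_bigr => s _; congr (_ * _); apply: eq_bigr => i _.
have nth_enum T (u : 'I_N -> T) x0 (j : 'I_N) : nth x0 [seq u i | i <- enum 'I_N] j = u j.
  by rewrite (nth_map j) ?size_enum_ord// nth_ord_enum.
rewrite !mxE (nth_map (f i)) ?(size_map f) ?size_enum_ord// nth_enum.
by rewrite (nth_map (h i)) ?(size_map h) ?size_enum_ord// nth_enum.
Qed.

(** By [antisym_perm], [F] is compared with the determinant of Kronecker symbols [G], whose value on
    the list of a permutation is the sign of this permutation by the Leibniz formula. *)
Lemma antisym_sign (T : Type) (F : seq T -> R) k (f : 'I_k -> T) (s : 'S_k) :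
  antisym F ->
  F [seq f (s i) | i <- enum 'I_k] = (-1) ^+ s * F [seq f i | i <- enum 'I_k].
Proof.
move=> aF.
pose G := gram (fun i j : 'I_k => (i == j)%:R : R) ^~ (enum 'I_k).
have aF' : antisym (fun L => F [seq f i | i <- L]).
  by move=> s1 x y s2; rewrite !map_cat /= aF.
have pe : perm_eq [seq s i | i <- enum 'I_k] (enum 'I_k).
  apply: uniq_perm => [||i].
  - by rewrite (map_inj_uniq (f := s)) ?enum_uniq//; exact: perm_inj.
  - exact: enum_uniq.
  - rewrite mem_enum inE; apply/mapP.
    by exists ((s^-1)%g i); rewrite ?mem_enum ?permKV.
have := antisym_perm aF' (gram_antisym _ _) pe (t := enum 'I_k) : _ * G _ = _ * G _.
have G1 (u : 'S_k) : G [seq u i | i <- enum 'I_k] = (-1) ^+ u.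
  rewrite /G -[X in gram _ _ X]map_id gram_leibniz (bigD1 u)//=.
  rewrite big1 ?mulr1; last by move=> i _; rewrite eqxx.
  rewrite big1 ?addr0// => v vu.
  have [i iv] : exists i, u i != v i.
    apply/existsP; rewrite -negb_forall; apply: contra vu => /forallP h.
    by apply/eqP/permP => i; rewrite (eqP (h i)).
  by rewrite (bigD1 i)//= (negbTE iv) mul0r mulr0.
have -> : G (enum 'I_k) = 1.
  have := G1 1%g; rewrite odd_perm1 expr0 => <-.
  by rewrite -[in LHS](map_id (enum 'I_k)); congr (G _); apply: eq_map => i; rewrite perm1.
rewrite G1 mulr1 -map_comp => <-.
by rewrite mulrCA -expr2 sqrr_sign mulr1.
Qed.

End Antisymmetry.

(** * Coordinates of alternating covectors *)

Section Covectors.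
Context {R : realType} {n : nat}.
Implicit Types (a b w : covector R n) (vs : seq 'rV[R]_n) (K : seq 'I_n).

Definition ebasis K : seq 'rV[R]_n := [seq delta_mx 0 i | i <- K].

(* A covector is a combination of the tensors of its coefficients, whether or not
   it is alternating; [dx K] is the antisymmetrization of [tensor K], that is,
   the wedge product of the coordinate covectors listed by K. *)
Definition tensor K vs : R :=
  \prod_(p <- zip vs K) p.1 0 p.2.

Definition dx K : covector R n :=
  fun vs => gram (fun (v : 'rV[R]_n) (l : 'I_n) => v 0 l) vs K.

Lemma alt_zero k a s1 s2 : alternating k a -> a (s1 ++ 0 :: s2) = 0.
Proof.
case=> _ lin _; have := lin s1 s2 1 0 0; rewrite scaler0 addr0 mul1r => /eqP.
by rewrite -subr_eq0 opprD addrA subrr sub0r oppr_eq0 => /eqP.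
Qed.

Lemma alt_scale k a s1 s2 c v : alternating k a ->
  a (s1 ++ (c *: v) :: s2) = c * a (s1 ++ v :: s2).
Proof.
by move=> aa; case: (aa) => _ lin _; rewrite -[c *: v]addr0 lin (alt_zero _ _ aa) addr0.
Qed.

Lemma alt_add k a s1 s2 u v : alternating k a ->
  a (s1 ++ (u + v) :: s2) = a (s1 ++ u :: s2) + a (s1 ++ v :: s2).
Proof. by case=> _ lin _; rewrite -[u]scale1r lin mul1r scale1r. Qed.

Lemma alt_opp k a s1 s2 v : alternating k a ->
  a (s1 ++ (- v) :: s2) = - a (s1 ++ v :: s2).
Proof. by move=> aa; rewrite -scaleN1r (alt_scale _ _ _ _ aa) mulN1r. Qed.

Lemma alt_sum k a s1 s2 (I : finType) (c : I -> R) (u : I -> 'rV[R]_n) :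
  alternating k a ->
  a (s1 ++ (\sum_i c i *: u i) :: s2) = \sum_i c i * a (s1 ++ u i :: s2).
Proof.
move=> aa; elim/big_rec2 : _ => [|i y1 y2 _ <-]; first exact: alt_zero aa.
by rewrite (alt_add _ _ _ _ aa) (alt_scale _ _ _ _ aa).
Qed.

Lemma alt_antisym k a : alternating k a -> antisym a.
Proof.
move=> aa s1 x y s2; have [_ _ alt] := aa.
have := alt s1 [::] s2 (x + y); rewrite /= (alt_add _ _ _ _ aa).
rewrite -cat_rcons (alt_add _ _ _ _ aa) !cat_rcons.
rewrite -[s1 ++ y :: (x + y) :: s2]cat_rcons (alt_add _ _ _ _ aa) !cat_rcons.
rewrite (alt s1 [::] s2 x) (alt s1 [::] s2 y) add0r addr0 => /eqP.
by rewrite addr_eq0 => /eqP.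
Qed.

(** Full multilinear expansion; the prefix [s] is there for the induction. The family [u] will be
    the standard basis as well as the rows of a Cholesky factor, and [c] the coordinates or the
    entries of the inverse metric. *)
Lemma alt_family k a s (T : Type) (J : finType) (c : T -> J -> R)
    (u : J -> 'rV[R]_n) (us : seq T) : alternating k a ->
  a (s ++ [seq \sum_j c t j *: u j | t <- us])
  = \sum_(I : (size us).-tuple J)
      (\prod_(q <- zip us I) c q.1 q.2) * a (s ++ [seq u j | j <- I]).
Proof.
move=> aa; elim: us s => [|t us IHus] s /=.
  rewrite (big_pred1 [tuple])/= => [|I]; last by apply/esym/eqP; rewrite [I]tuple0.
  by rewrite big_nil mul1r.
rewrite (big_tuple_cons _ (fun I : seq J =>
  (\prod_(q <- zip (t :: us) I) c q.1 q.2) * a (s ++ [seq u j | j <- I]))).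
rewrite (alt_sum _ _ _ _ aa); apply: eq_bigr => i _.
rewrite -cat_rcons IHus mulr_sumr; apply: eq_bigr => I _.
by rewrite cat_rcons mulrA /= big_cons.
Qed.

Lemma alt_expand k a vs : alternating k a -> size vs = k ->
  a vs = \sum_(I : k.-tuple 'I_n) tensor I vs * a (ebasis I).
Proof.
move=> aa <-.
rewrite -(alt_family [::] (fun (v : 'rV_n) i => v 0 i) (fun i => delta_mx 0 i) vs aa).
by rewrite /= -[in LHS](map_id vs); congr a; apply: eq_map => v; exact: row_sum_delta.
Qed.

Lemma alt_ext k a b : alternating k a -> alternating k b ->
  (forall I : k.-tuple 'I_n, a (ebasis I) = b (ebasis I)) -> a = b.
Proof.
move=> aa ab h; apply/funext => vs.
have [sz|sz] := eqVneq (size vs) k; last first.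
  by case: aa ab => [a0 _ _] [b0 _ _]; rewrite a0// b0.
by rewrite (alt_expand aa sz) (alt_expand ab sz); apply: eq_bigr => I _; rewrite h.
Qed.

Lemma nth_enum_map T N (u : 'I_N -> T) x0 (j : 'I_N) :
  nth x0 [seq u i | i <- enum 'I_N] j = u j.
Proof. by rewrite (nth_map j) ?size_enum_ord// nth_ord_enum. Qed.

Lemma size_enum_map T N (u : 'I_N -> T) : size [seq u i | i <- enum 'I_N] = N.
Proof. by rewrite (size_map u) size_enum_ord. Qed.

Lemma seq_enum T N x0 (s : seq T) : size s = N ->
  s = [seq nth x0 s (i : 'I_N) | i <- enum 'I_N].
Proof.
move=> sN; apply: (@eq_from_nth _ x0); first by rewrite size_enum_map.
by move=> i; rewrite sN => iN; rewrite -[i]/(val (Ordinal iN)) nth_enum_map.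
Qed.

Lemma tuple_enum T N (t : N.-tuple T) : val t = [seq tnth t i | i <- enum 'I_N].
Proof.
case: N t => [|N] t; first by rewrite [t]tuple0 /= enum_ord0.
rewrite [LHS](@seq_enum _ _ (tnth t ord0) _ (size_tuple t)).
by apply: eq_map => i; rewrite -tnth_nth.
Qed.

Lemma tensorE N (I : N.-tuple 'I_n) vs : size vs = N ->
  tensor I vs = \prod_(i < N) (nth 0 vs i) 0 (tnth I i).
Proof.
move=> sN; rewrite /tensor {1}(seq_enum 0 sN) tuple_enum zip_map big_map big_enum.
by [].
Qed.

Lemma tensor_cat I J vs us : size vs = size I ->
  tensor (I ++ J) (vs ++ us) = tensor I vs * tensor J us.
Proof. by move=> sz; rewrite /tensor zip_cat// big_cat. Qed.

Lemma dx_size K vs : size vs != size K -> dx K vs = 0.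
Proof. by rewrite /dx /gram => /negbTE ->. Qed.

Lemma dx_sign N (I : N.-tuple 'I_n) vs : size vs = N ->
  dx I vs = \sum_(s : 'S_N) (-1) ^+ s * tensor I [seq nth 0 vs (s i) | i <- enum 'I_N].
Proof.
move=> sN; rewrite /dx gram_tr [X in gram _ X]tuple_enum.
rewrite [X in gram _ _ X](seq_enum 0 sN) gram_leibniz.
apply: eq_bigr => s _; congr (_ * _); rewrite tensorE ?size_enum_map//.
by apply: eq_bigr => i _; rewrite nth_enum_map.
Qed.

Lemma dx_antisym K : antisym (dx K).
Proof. exact: gram_antisym. Qed.

Lemma dx_antisymr vs : antisym (dx ^~ vs).
Proof. exact: gram_antisymr. Qed.

Lemma antisym_dup (T : eqType) (F : seq T -> R) s1 s2 s3 u :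
  antisym F -> F (s1 ++ u :: s2 ++ u :: s3) = 0.
Proof.
move=> aF; rewrite -cat1s (antisym_catCA s1 [:: u] s2 _ aF) /= mul1n.
suff -> : F (s1 ++ s2 ++ u :: u :: s3) = 0 by rewrite mulr0.
have := aF (s1 ++ s2) u u s3; rewrite -!catA => /eqP.
by rewrite -addr_eq0 -mulr2n mulrn_eq0 => /eqP.
Qed.

Lemma dx_alternating K : alternating (size K) (dx K).
Proof.
split; first exact: dx_size.
- move=> s1 s2 c u v; rewrite /dx /gram !size_cat /=; case: eqP => sz; last first.
    by rewrite mulr0 addr0.
  have h : (size s1 < size s1 + (size s2).+1)%N by lia.
  rewrite /detrows (determinant_multilinear (A := _)
    (B := \matrix_(i, j) nth 0 (nth [::] [seq [seq (v : 'rV[R]_n) 0 l | l <- K] | v <- s1 ++ u :: s2] i) j)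
    (C := \matrix_(i, j) nth 0 (nth [::] [seq [seq (v : 'rV[R]_n) 0 l | l <- K] | v <- s1 ++ v :: s2] i) j)
    (i0 := Ordinal h) (b := c) (c := 1)).
  + by rewrite mul1r.
  + apply/rowP => j; rewrite !mxE /= !map_cat /= !nth_cat !size_map ltnn subnn /=.
    have jK : (j < size K)%N by rewrite -sz.
    case: K sz jK => // l0 K sz jK.
    by rewrite !(nth_map l0)// !mxE mul1r.
  + apply/matrixP => i j; rewrite !mxE /= !map_cat /= !nth_cat !size_map.
    rewrite /bump; case: (leqP (size s1) i) => si.
      by rewrite ltnNge leqW//= subSn ?leqW//.
    by rewrite add0n si.
  + apply/matrixP => i j; rewrite !mxE /= !map_cat /= !nth_cat !size_map.
    rewrite /bump; case: (leqP (size s1) i) => si.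
      by rewrite ltnNge leqW//= subSn ?leqW//.
    by rewrite add0n si.
- by move=> s1 s2 s3 u; apply: antisym_dup; exact: dx_antisym.
Qed.

Lemma size_ebasis K : size (ebasis K) = size K.
Proof. by rewrite size_map. Qed.

Lemma antisym_ebasis k a : alternating k a -> antisym (fun K => a (ebasis K)).
Proof.
by move=> aa s1 x y s2; rewrite /ebasis !map_cat /= (alt_antisym aa).
Qed.

(** [dx I] is a signed sum of permuted tensors; permuting the indices of [I] accordingly moves the
    sign into [c], where it cancels, so all k! permutations contribute the same sum. *)
Lemma sum_dx_antisym k (c : seq 'I_n -> R) vs : antisym c -> size vs = k ->
  \sum_(I : k.-tuple 'I_n) dx I vs * c I
  = k`!%:R * \sum_(I : k.-tuple 'I_n) tensor I vs * c I.
Proof.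
move=> ac sz.
under eq_bigr do rewrite dx_sign// mulr_suml.
rewrite exchange_big /=.
rewrite (eq_bigr (fun=> \sum_(I : k.-tuple 'I_n) tensor I vs * c I)); last first.
  move=> s _.
  pose act (u : 'S_k) (I : k.-tuple 'I_n) := [tuple tnth I (u i) | i < k].
  rewrite (reindex_inj (h := act s)); last first.
    move=> I J /(congr1 (act (s^-1)%g)) IJ; apply: eq_from_tnth => i.
    by have := congr1 (fun t : k.-tuple 'I_n => tnth t i) IJ; rewrite !tnth_mktuple permKV.
  apply: eq_bigr => I _.
  have -> : c (act s I) = (-1) ^+ s * c I.
    rewrite (tuple_enum (act s I)) (tuple_enum I) -antisym_sign//.
    by congr c; apply: eq_map => i; rewrite tnth_mktuple.
  rewrite mulrACA -expr2 sqrr_sign mul1r; congr (_ * _).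
  rewrite !tensorE ?size_enum_map// [RHS](reindex_inj (@perm_inj _ s)).
  by apply: eq_bigr => i _; rewrite nth_enum_map tnth_mktuple.
by rewrite sumr_const card_Sn mulr_natl.
Qed.

(** The sum is over all tuples of indices, not over increasing ones, so that every set of k indices
    is counted k! times. *)
Lemma alt_dx k a vs : alternating k a -> size vs = k ->
  a vs = k`!%:R^-1 * \sum_(I : k.-tuple 'I_n) a (ebasis I) * dx I vs.
Proof.
move=> aa sz; rewrite (alt_expand aa sz).
under [in RHS]eq_bigr do rewrite mulrC.
rewrite (sum_dx_antisym (antisym_ebasis aa) sz) mulrA mulVf ?mul1r// ?pnatr_eq0 -?lt0n ?fact_gt0.
Qed.

Lemma tensor_ebasis k (I L : k.-tuple 'I_n) : tensor I (ebasis L) = (I == L)%:R.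
Proof.
rewrite tensorE ?size_ebasis ?size_tuple//.
have [->|IL] := eqVneq I L.
  rewrite big1// => i _.
  by rewrite /ebasis (nth_map (tnth L i)) ?size_tuple// -tnth_nth !mxE !eqxx.
have [i Ii] : exists i, tnth I i != tnth L i.
  apply/existsP; rewrite -negb_forall; apply: contra IL => /forallP h.
  by apply/eqP/eq_from_tnth => i; apply/eqP; rewrite h.
rewrite (bigD1 i)//= /ebasis (nth_map (tnth L i)) ?size_tuple// -tnth_nth.
by rewrite mxE eqxx (negbTE Ii) mul0r.
Qed.

Lemma dx_ebasisC K L : dx K (ebasis L) = dx L (ebasis K).
Proof.
have gram_map (s t : seq 'I_n) (phi : 'rV[R]_n -> 'I_n -> R) :
    gram phi (ebasis s) t = gram (fun l => phi (delta_mx 0 l)) s t.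
  by rewrite /gram size_ebasis -map_comp.
rewrite /dx !gram_map gram_tr; congr (gram _ _ _).
by apply/funext => i; apply/funext => j; rewrite !mxE eqxx eq_sym.
Qed.

(** [dx L (ebasis I)] is the generalized Kronecker symbol, and contraction with it is
    antisymmetrization up to the factor k!. *)
Lemma sum_dx_ebasis k (c : seq 'I_n -> R) (L : k.-tuple 'I_n) : antisym c ->
  \sum_(I : k.-tuple 'I_n) dx L (ebasis I) * c I = k`!%:R * c L.
Proof.
move=> ac; under eq_bigr do rewrite dx_ebasisC.
rewrite (sum_dx_antisym ac) ?size_ebasis ?size_tuple//; congr (_ * _).
rewrite (bigD1 L)//= tensor_ebasis eqxx mul1r big1 ?addr0// => I IL.
by rewrite tensor_ebasis (negbTE IL) mul0r.
Qed.

End Covectors.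

(** * Wedge product and Hodge star *)

Section WedgeHodge.
Context {R : realType} {n : nat}.
Implicit Types (a b w : covector R n) (vs : seq 'rV[R]_n) (K : seq 'I_n).

Lemma factR_neq0 k : k`!%:R != 0 :> R.
Proof. by rewrite pnatr_eq0 -lt0n fact_gt0. Qed.

Lemma alternatingZ k a (c : R) : alternating k a -> alternating k (fun vs => c * a vs).
Proof.
move=> aa; have [a0 lin alt] := aa; split.
- by move=> vs sz; rewrite a0// mulr0.
- by move=> s1 s2 d u v; rewrite lin; ring.
- by move=> s1 s2 s3 u; rewrite alt mulr0.
Qed.

Lemma alternatingD k a b : alternating k a -> alternating k b ->
  alternating k (fun vs => a vs + b vs).
Proof.
move=> [a0 alin aalt] [b0 blin balt]; split.
- by move=> vs sz; rewrite a0// b0// addr0.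
- by move=> s1 s2 d u v; rewrite alin blin; ring.
- by move=> s1 s2 s3 u; rewrite aalt balt addr0.
Qed.

Lemma alternating0 k : alternating k (fun _ : seq 'rV[R]_n => 0 : R^o).
Proof. by split => // *; rewrite mulr0 addr0. Qed.

Lemma alternating_sum k (J : finType) (F : J -> covector R n) :
  (forall j, alternating k (F j)) -> alternating k (fun vs => \sum_j F j vs).
Proof.
move=> aF; elim: (index_enum J) => [|j r IHr].
  rewrite (_ : (fun vs => _) = (fun _ => 0)); first exact: alternating0.
  by apply/funext => vs; rewrite big_nil.
rewrite (_ : (fun vs => _) = (fun vs => F j vs + \sum_(i <- r) F i vs)).
  exact: alternatingD.
by apply/funext => vs; rewrite big_cons.
Qed.

Lemma alt_mul_expand k l a b (c : R) us : alternating k a -> alternating l b ->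
  size us = (k + l)%N ->
  c * a (take k us) * b (drop k us)
  = \sum_(I : k.-tuple 'I_n) \sum_(J : l.-tuple 'I_n)
      a (ebasis I) * b (ebasis J) * (c * tensor (I ++ J) us).
Proof.
move=> aa ab us_sz.
have tk : size (take k us) = k by rewrite size_takel// us_sz leq_addr.
have dk : size (drop k us) = l by rewrite size_drop us_sz addKn.
rewrite (alt_expand aa tk) (alt_expand ab dk) -mulrA big_distrl big_distrr /=.
apply: eq_bigr => I _; rewrite big_distrr big_distrr /=; apply: eq_bigr => J _.
rewrite -{3}(cat_take_drop k us) tensor_cat ?tk ?size_tuple//.
have mulE (x y z t : R) : c * (x * z * (y * t)) = z * t * (c * (x * y)) by ring.
exact: mulE.
Qed.

(** For degree reasons only the summand that gives [k] vectors to [a] survives, and the signed sum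
    of the tensors of I ++ J over all permutations is [dx (I ++ J)]. Identities between wedge
    products thereby become identities between index lists. *)
Lemma wedge_dx k l a b : alternating k a -> alternating l b ->
  wedge_prod a b = fun vs => (k`! * l`!)%:R^-1 *
    \sum_(I : k.-tuple 'I_n) \sum_(J : l.-tuple 'I_n)
      a (ebasis I) * b (ebasis J) * dx (I ++ J) vs.
Proof.
move=> aa ab; apply/funext => vs.
have [a0 _ _] := aa; have [b0 _ _] := ab.
rewrite /wedge_prod.
have size_us (s : 'S_(size vs)) :
  size [seq nth 0 vs (s i) | i <- enum 'I_(size vs)] = size vs by rewrite size_enum_map.
have [sz|sz] := eqVneq (size vs) (k + l)%N; last first.
  rewrite big1 => [|k' _].
    rewrite big1 ?mulr0// => I _; rewrite big1// => J _.
    by rewrite dx_size ?mulr0// size_cat !size_tuple.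
  rewrite big1 ?mulr0// => s _ /=.
  have k'v : (k' <= size vs)%N by rewrite -ltnS.
  have [kk|kk] := eqVneq (k' : nat) k; last first.
    by rewrite a0 ?mulr0 ?mul0r// size_takel ?size_us.
  rewrite b0 ?mulr0// size_drop size_us; apply: contra sz => /eqP <-.
  by rewrite -kk subnKC.
have kl : (k < (size vs).+1)%N by rewrite sz ltnS leq_addr.
rewrite (bigD1 (Ordinal kl))//= [X in _ + X]big1 ?addr0; last first.
  move=> k' /eqP kk; rewrite big1 ?mulr0// => s _ /=.
  have k'v : (k' <= size vs)%N by rewrite -ltnS.
  rewrite a0 ?mulr0 ?mul0r// size_takel ?size_us//.
  by apply/eqP => kk'; apply: kk; apply: val_inj.
have -> : (size vs - k = l)%N by rewrite sz addKn.
congr (_ * _); clear kl size_us a0 b0; rewrite sz.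
transitivity (\sum_(s : 'S_(k + l)) \sum_(I : k.-tuple 'I_n) \sum_(J : l.-tuple 'I_n)
  a (ebasis I) * b (ebasis J) *
  ((-1) ^+ s * tensor (I ++ J) [seq nth 0 vs (s i) | i <- enum 'I_(k + l)])).
  apply: eq_bigr => s _; set us := map _ _.
  have us_sz : size us = (k + l)%N by rewrite size_enum_map.
  exact: (alt_mul_expand ((-1) ^+ s) aa ab us_sz).
rewrite exchange_big /=; apply: eq_bigr => I _.
rewrite exchange_big /=; apply: eq_bigr => J _.
by rewrite -mulr_sumr (dx_sign [tuple of I ++ J] sz).
Qed.

Lemma wedge_alternating k l a b : alternating k a -> alternating l b ->
  alternating (k + l) (wedge_prod a b).
Proof.
move=> aa ab; rewrite (wedge_dx aa ab); apply: alternatingZ.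
apply: alternating_sum => I; apply: alternating_sum => J; apply: alternatingZ.
by have := dx_alternating (R := R) (I ++ J); rewrite size_cat !size_tuple.
Qed.

Lemma wedge_comm k l a b vs : alternating k a -> alternating l b ->
  wedge_prod b a vs = (-1) ^+ (k * l) * wedge_prod a b vs.
Proof.
move=> aa ab; rewrite (wedge_dx aa ab) (wedge_dx ab aa).
rewrite [in RHS]mulrCA mulnC; congr (_ * _); rewrite exchange_big mulr_sumr.
apply: eq_bigr => I _; rewrite mulr_sumr; apply: eq_bigr => J _.
have := antisym_catCA [::] J I [::] (dx_antisymr vs).
rewrite /= !cats0 !size_tuple => ->; rewrite mulnC; ring.
Qed.

Lemma size_enum_n : size (enum 'I_n) = n.
Proof. by rewrite size_enum_ord. Qed.

Lemma volE (G : 'M[R]_n) rev : vol G rev =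
  fun vs => (-1) ^+ rev * Num.sqrt (\det G) * dx (enum 'I_n) vs.
Proof.
apply/funext => vs; rewrite /vol; case: eqP => sz; last first.
  by rewrite dx_size ?mulr0// size_enum_n; apply/eqP.
congr (_ * _); rewrite /dx /gram size_enum_n sz eqxx /detrows.
congr (\det _); apply/matrixP => i j; rewrite !mxE.
by rewrite (nth_map 0) ?sz// nth_enum_map.
Qed.

Lemma hodge_alternating k (G : 'M[R]_n) rev b : (k <= n)%N -> alternating k b ->
  alternating (n - k) (hodge G rev b).
Proof.
move=> kn [b0 lin alt].
have av : alternating n (vol G rev).
  by rewrite volE; apply: alternatingZ; have := dx_alternating (R := R) (enum 'I_n);
    rewrite size_enum_n.
have [v0 vlin valt] := av.
split => [vs sz|s1 s2 c u v|s1 s2 s3 u]; rewrite /hodge.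
- rewrite big1 ?mulr0// => I _.
  (* On lists longer than [n] the truncated difference is 0, and it is the volume form that
     vanishes. *)
  have [le|gt] := leqP (size vs) n; last first.
    by rewrite v0 ?mulr0// size_cat size_map size_tuple; lia.
  by rewrite b0 ?mul0r// size_map size_tuple; lia.
- rewrite !size_cat /=; rewrite mulrCA -mulrDr; congr (_ * _).
  rewrite mulr_sumr -big_split /=; apply: eq_bigr => I _.
  by rewrite !catA vlin; ring.
- rewrite big1 ?mulr0// => I _.
  by rewrite catA valt mulr0.
Qed.

(* Sign of the permutation listed by K, and 0 if K is not one. *)
Definition eps K : R := dx K (ebasis (enum 'I_n)).

Lemma eps_antisym : antisym eps.
Proof. exact: dx_antisymr. Qed.

Lemma perm_enum K : size K = n -> uniq K -> perm_eq K (enum 'I_n).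
Proof.
move=> sz uK; apply: uniq_perm; rewrite ?enum_uniq//.
have sub : {subset K <= enum 'I_n} by move=> j _; rewrite mem_enum.
by have [] := uniq_min_size uK sub; rewrite ?size_enum_n ?sz.
Qed.

Lemma dx_row_mul K (A : 'M[R]_n) : size K = n ->
  dx K [seq row i A | i <- enum 'I_n] = \det A * eps K.
Proof.
move=> sz; rewrite /eps /dx /gram size_enum_map size_ebasis size_enum_n sz eqxx.
rewrite /detrows -det_mulmx; congr (\det _); apply/matrixP => i j; rewrite !mxE.
have jK : (j < size K)%N by rewrite sz.
have i0 : 'I_n by [].
rewrite (nth_map 0) ?size_enum_map// (nth_map i0)// nth_enum_map mxE.
rewrite (bigD1 (nth i0 K j))//= big1 ?addr0 => [|l lj]; rewrite !mxE.
  rewrite (nth_map 0) ?size_enum_map// (nth_map i0)// nth_enum_map mxE !eqxx.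
  by rewrite mulr1.
rewrite (nth_map 0) ?size_enum_map// (nth_map i0)// nth_enum_map mxE eqxx /=.
by rewrite eq_sym (negbTE lj) mulr0.
Qed.

Lemma eps_enum : eps (enum 'I_n) = 1.
Proof.
rewrite /eps /dx /gram size_ebasis size_enum_n eqxx /detrows -(det1 _ n).
congr (\det _); apply/matrixP => i j; rewrite !mxE.
rewrite (nth_map 0) ?size_enum_map// (nth_map j) ?size_enum_n// nth_enum_map.
by rewrite nth_ord_enum mxE eqxx eq_sym.
Qed.

Lemma antisym_notuniq (T : eqType) (F : seq T -> R) s : antisym F -> ~~ uniq s ->
  F s = 0.
Proof.
move=> aF; case: s => [//|x0 s] /(uniqPn x0) [i [j [ij js e]]].
move: (x0 :: s) ij js e => {}s ij js e.
have := cat_take_drop j s; rewrite (drop_nth x0 js) => <-.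
have it : (i < size (take j s))%N by rewrite size_takel// ltnW.
have := cat_take_drop i (take j s); rewrite (drop_nth x0 it) nth_take// e => <-.
by rewrite -catA /=; apply: antisym_dup.
Qed.

Lemma eps_sqr K : size K = n -> eps K * eps K = (uniq K)%:R.
Proof.
move=> sz; have [uK|nK] := boolP (uniq K); last first.
  by rewrite (antisym_notuniq eps_antisym nK) mul0r.
by rewrite (antisym_perm eps_antisym eps_antisym (perm_enum sz uK)) eps_enum mul1r.
Qed.

(** The contraction of two Levi-Civita symbols over [l] indices. A nonzero term forces both [I] and
    [I'] to list the complement of [J], so [I] rearranges [I'], and the signs of [b] and of the
    first symbol cancel. It remains to count. *)
Lemma sum_eps_eps k l b (I' : k.-tuple 'I_n) : (k + l)%N = n -> alternating k b ->
  \sum_(J : l.-tuple 'I_n) \sum_(I : k.-tuple 'I_n)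
    b (ebasis I) * eps (I ++ J) * eps (I' ++ J)
  = (k`! * l`!)%:R * b (ebasis I').
Proof.
move=> kl ab.
have szc (I : k.-tuple 'I_n) (J : l.-tuple 'I_n) : size (I ++ J) = n.
  by rewrite size_cat !size_tuple.
have term (J : l.-tuple 'I_n) (I : k.-tuple 'I_n) :
  b (ebasis I) * eps (I ++ J) * eps (I' ++ J)
  = b (ebasis I') * ((uniq (I' ++ J))%:R * (perm_eq I I')%:R).
  have [uI'|nI'] := boolP (uniq (I' ++ J)); last first.
    by rewrite (antisym_notuniq eps_antisym nI') mul0r !mulr0.
  have [pI|pI] := boolP (perm_eq I I').
    have aJ : antisym (fun K => eps (K ++ J)).
      by move=> s1 x y s2; rewrite -!catA /= eps_antisym.
    rewrite (antisym_perm (antisym_ebasis ab) aJ pI) -mulrA eps_sqr//.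
    by rewrite uI' mul1r.
  rewrite !mulr0; have [uI|nI] := boolP (uniq (I ++ J)); last first.
    by rewrite (antisym_notuniq eps_antisym nI) mulr0 mul0r.
  move: pI; rewrite -(perm_cat2r J).
  by rewrite (perm_trans (perm_enum (szc _ _) uI))// perm_sym perm_enum.
under eq_bigr do under eq_bigr do rewrite term.
have [uI'|nI'] := boolP (uniq I'); last first.
  rewrite (antisym_notuniq (antisym_ebasis ab) nI') mulr0 big1// => J _.
  by rewrite big1// => I _; rewrite mul0r.
under eq_bigr do rewrite -mulr_sumr -mulr_sumr.
rewrite -mulr_sumr -mulr_suml mulrC; congr (_ * _).
rewrite natrM mulrC; congr (_ * _).
  (* There are k! rearrangements [I] of [I']. *)
  rewrite -(ffactnn k).
  have cI' : #|[pred i | i \in I']| = k.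
    by rewrite -[RHS](size_tuple I'); apply/card_uniqP.
  rewrite -[X in (X ^_ _)%:R]cI' -card_uniq_tuples -sum1_card natr_sum.
  rewrite [RHS]big_mkcond /=; apply: eq_bigr => I _; rewrite inE.
  suff -> : perm_eq I I' = all [in [pred i | i \in I']] I && uniq I by case: ifP.
  apply/idP/andP => [pI|[aI uI]].
    split; last by rewrite (perm_uniq pI).
    by apply/allP => i iI; rewrite inE -(perm_mem pI).
  have sub : {subset I <= I'} by move=> i /(allP aI).
  have [|_ h] := uniq_min_size uI sub; first by rewrite !size_tuple.
  exact: uniq_perm.
(* There are l! listings [J] of the complement of [I']. *)
rewrite -(ffactnn l).
have cI' : #|[pred i | i \notin I']| = l.
  have := cardC [pred i | i \in I']; rewrite card_ord -[RHS]kl.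
  have -> : #|[pred i | i \in I']| = k by rewrite -[RHS](size_tuple I'); apply/card_uniqP.
  by move=> /addnI <-; apply: eq_card => i; rewrite !inE.
rewrite -[X in (X ^_ _)%:R]cI' -card_uniq_tuples -sum1_card natr_sum.
rewrite [RHS]big_mkcond /=; apply: eq_bigr => J _; rewrite inE cat_uniq uI' /=.
suff -> : ~~ has [in I'] J = all [in [pred i | i \notin I']] J by case: ifP.
by rewrite -all_predC; apply: eq_all => i; rewrite !inE.
Qed.

(** The identity a /\ star b = <a, b> vol, evaluated on the rows of [A]; these will be the edges of
    a simplex. The indices [J] of star b occur in two symbols [eps], which [sum_eps_eps]
    contracts. *)
Lemma wedge_hodge k (G : 'M[R]_n) rev a b (A : 'M[R]_n) : (k <= n)%N ->
  alternating k a -> alternating k b ->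
  wedge_prod a (hodge G rev b) [seq row i A | i <- enum 'I_n]
  = (-1) ^+ rev * Num.sqrt (\det G) * \det A / k`!%:R *
    \sum_(I : k.-tuple 'I_n) a (ebasis I) * b [seq row i (invmx G) | i <- I].
Proof.
move=> kn aa ab.
have kl : (k + (n - k))%N = n by rewrite subnKC.
rewrite (wedge_dx aa (hodge_alternating G rev kn ab)).
set l := (n - k)%N in kl *.
set s := (-1) ^+ rev * Num.sqrt (\det G).
have szc (I : k.-tuple 'I_n) (J : l.-tuple 'I_n) : size (I ++ J) = n.
  by rewrite size_cat !size_tuple.
have := dx_row_mul A; move: (\det A) => d dxd.
pose bI (I : k.-tuple 'I_n) : R := b [seq row i (invmx G) | i <- I].
have hJ (J : l.-tuple 'I_n) : hodge G rev b (ebasis J)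
    = k`!%:R^-1 * \sum_(I' : k.-tuple 'I_n) bI I' * (s * eps (I' ++ J)).
  rewrite /hodge size_ebasis size_tuple subKn//; congr (_ * _).
  apply: eq_bigr => I' _; congr (_ * _).
  by rewrite volE -/s -/(ebasis I') /ebasis -map_cat dx_ebasisC.
transitivity ((k`! * l`!)%:R^-1 * (s * d / k`!%:R *
   \sum_(I' : k.-tuple 'I_n) bI I' *
     \sum_(J : l.-tuple 'I_n) \sum_(I : k.-tuple 'I_n)
        a (ebasis I) * eps (I ++ J) * eps (I' ++ J))).
  congr (_ * _).
  under [in RHS]eq_bigr do rewrite mulr_sumr.
  rewrite [in RHS]exchange_big /= mulr_sumr exchange_big /=.
  apply: eq_bigr => J _; rewrite mulr_sumr.
  under [in RHS]eq_bigr do rewrite !mulr_sumr.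
  rewrite [in RHS]exchange_big /=; apply: eq_bigr => I _.
  rewrite dxd// hJ !mulr_sumr mulr_suml; apply: eq_bigr => I' _.
  have mulE (x e1 e2 d' f t y : R) : x * (f * (y * (t * e2))) * (d' * e1)
     = t * d' * f * (y * (x * e1 * e2)) by ring.
  exact: mulE.
under eq_bigr do rewrite (sum_eps_eps _ kl aa).
rewrite mulrCA; congr (_ * _).
rewrite mulr_sumr; apply: eq_bigr => I _; rewrite /bI.
have kl0 : (k`! * l`!)%:R != 0 :> R by rewrite natrM mulf_neq0// factR_neq0.
by rewrite mulrCA mulKf// mulrC.
Qed.

End WedgeHodge.

(** * Positive definite matrices and the norm of a covector *)

Section PositiveDefinite.
Context {R : realType}.

Definition posdef n (G : 'M[R]_n) : Prop :=
  G^T = G /\ forall v : 'rV[R]_n, v != 0 -> 0 < (v *m G *m v^T) 0 0.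

(** Induction on the Schur complement of the top left entry, which is again positive definite. *)
Lemma cholesky n (G : 'M[R]_n) : posdef G ->
  exists2 L : 'M[R]_n, L \in unitmx & G = L *m L^T.
Proof.
elim: n G => [|n IHn] G [sG pG].
  by exists 1%:M; [rewrite unitmx1|apply/matrixP => -[]].
rewrite -[n.+1]/(1 + n)%N in G sG pG *.
set a := G 0 0.
have a0 : 0 < a.
  have := pG (delta_mx 0 0); rewrite trmx_delta -rowE -colE !mxE; apply.
  apply/eqP => /matrixP/(_ 0 0); rewrite !mxE !eqxx => /eqP.
  by rewrite oner_eq0.
pose b : 'rV[R]_n := ursubmx G; pose C : 'M[R]_n := drsubmx G.
have ulG : ulsubmx G = a%:M.
  by apply/matrixP => i j; rewrite !ord1 !mxE eqxx mulr1n /a; congr (G _ _);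
    apply: val_inj.
have dlG : dlsubmx G = b^T by rewrite /b trmx_ursub sG.
have CT : C^T = C by rewrite /C trmx_drsub sG.
have EG : G = block_mx a%:M b b^T C by rewrite -[LHS]submxK ulG dlG.
have [L' uL' EL'] : exists2 L : 'M[R]_n, L \in unitmx &
    C - a^-1 *: (b^T *m b) = L *m L^T.
  apply: IHn; split.
    by rewrite linearB /= linearZ /= trmx_mul trmxK CT.
  move=> v v0.
  (* For a given [v], this first coordinate minimizes the quadratic form of [G], and the minimum is
     the value of the Schur complement at [v]. *)
  pose c : 'M[R]_1 := - a^-1 *: (v *m b^T).
  have := pG (row_mx c v).
  have -> : row_mx c v *m G *m (row_mx c v)^T
     = v *m (C - a^-1 *: (b^T *m b)) *m v^T.
    rewrite EG mul_row_block tr_row_mx mul_row_col.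
    have -> : c *m a%:M + v *m b^T = 0.
      by rewrite mul_mx_scalar /c scalerA mulrN divff ?gt_eqF// scaleN1r addNr.
    rewrite mul0mx add0r mulmxBr /c -scalemxAl -mulmxA scaleNr.
    by rewrite -scalemxAr addrC.
  apply; apply: contra v0 => /eqP /(congr1 rsubmx).
  by rewrite row_mxKr linear0 => ->.
exists (block_mx (Num.sqrt a)%:M 0 ((Num.sqrt a)^-1 *: b^T) L').
  rewrite unitmxE det_lblock det_scalar1 unitrM -unitmxE uL' andbT unitfE.
  by rewrite gt_eqF// sqrtr_gt0.
have sa0 : Num.sqrt a != 0 by rewrite gt_eqF// sqrtr_gt0.
rewrite EG tr_block_mx mulmx_block !tr_scalar_mx trmx0 !mulmx0 !mul0mx !addr0.
rewrite -EL' linearZ /= trmxK -scalar_mxM -expr2 sqr_sqrtr ?ltW//.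
rewrite mul_scalar_mx scalerA divff// scale1r mul_mx_scalar scalerA divff// scale1r.
rewrite -scalemxAl -scalemxAr scalerA -invfM -expr2 sqr_sqrtr ?ltW//.
by rewrite addrC subrK.
Qed.

Lemma posdef_det n (G : 'M[R]_n) : posdef G -> 0 < \det G.
Proof.
move=> /cholesky [L uL ->]; rewrite det_mulmx det_tr -expr2 exprn_even_gt0//=.
by move: uL; rewrite unitmxE unitfE.
Qed.

(** With G = L L^T, the rows of B = L^-1 are orthonormal for [G], and the sum equals the sum of the
    squares of the values of [a] on tuples of these rows. If all of them vanish then so does [a],
    because the rows of [B] form a basis. *)
Lemma alt_norm_ge0 n k (G : 'M[R]_n) (a : covector R n) : posdef G ->
  alternating k a ->
  0 <= \sum_(I : k.-tuple 'I_n) a (ebasis I) * a [seq row i (invmx G) | i <- I]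
  /\ (\sum_(I : k.-tuple 'I_n) a (ebasis I) * a [seq row i (invmx G) | i <- I] = 0
      -> a = fun _ => 0).
Proof.
move=> pG aa; have [L uL EG] := cholesky pG.
pose B := invmx L.
have uLT : L^T \in unitmx by rewrite unitmx_tr.
have iG : invmx G = B^T *m B.
  have uG : G \in unitmx by rewrite EG unitmx_mul uL.
  apply: (can_inj (mulKmx uG)); rewrite mulmxV// EG mulmxA -(mulmxA L) -trmx_mul.
  by rewrite mulVmx// trmx1 mulmx1 mulmxV.
pose aB (J : k.-tuple 'I_n) : R := a [seq row j B | j <- J].
have raise (I : k.-tuple 'I_n) : a [seq row i (invmx G) | i <- I]
    = \sum_(J : k.-tuple 'I_n) (\prod_(q <- zip I J) B q.2 q.1) * aB J.
  rewrite (_ : [seq row i (invmx G) | i <- I]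
     = [seq \sum_j B j t *: row j B | t <- I]); last first.
    apply: eq_map => i; rewrite iG row_mul mulmx_sum_row.
    by apply: eq_bigr => j _; rewrite !mxE.
  have := alt_family [::] (fun t j => B j t) (fun j => row j B) I aa.
  by rewrite /= size_tuple.
have aBE (J : k.-tuple 'I_n) : aB J
    = \sum_(I : k.-tuple 'I_n) (\prod_(q <- zip I J) B q.2 q.1) * a (ebasis I).
  have szJ : size [seq row j B | j <- J] = k by rewrite size_map size_tuple.
  rewrite /aB (alt_expand aa szJ); apply: eq_bigr => I _; congr (_ * _).
  rewrite tensorE// [in RHS](tuple_enum J) [in RHS](tuple_enum I).
  rewrite zip_map big_map big_enum /=; apply: eq_bigr => i _.
  by rewrite (nth_map (tnth J i)) ?size_tuple// -tnth_nth mxE.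
have E : \sum_(I : k.-tuple 'I_n) a (ebasis I) * a [seq row i (invmx G) | i <- I]
   = \sum_(J : k.-tuple 'I_n) aB J ^+ 2.
  under eq_bigr do rewrite raise mulr_sumr.
  rewrite exchange_big /=; apply: eq_bigr => J _.
  rewrite expr2 [X in _ = X * _]aBE mulr_suml; apply: eq_bigr => I _.
  by rewrite mulrCA mulrA.
rewrite E; split; first by rewrite sumr_ge0// => J _; exact: sqr_ge0.
move=> s0.
have aB0 (J : k.-tuple 'I_n) : aB J = 0.
  have /eqP : aB J ^+ 2 = 0 by apply: (psumr_eq0P _ s0) => // J' _; exact: sqr_ge0.
  by rewrite sqrf_eq0 => /eqP.
have := alternating0 (R := R) (n := n) k => a0.
apply: (alt_ext aa a0) => I.
rewrite /ebasis (_ : [seq delta_mx 0 i | i <- I]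
   = [seq \sum_j L t j *: row j B | t <- I]); last first.
  apply: eq_map => i.
  have -> : \sum_j L i j *: row j B = row i (L *m B).
    by rewrite row_mul mulmx_sum_row; apply: eq_bigr => j _; rewrite mxE.
  by rewrite /B mulmxV// row1.
have := alt_family [::] (fun t j => L t j) (fun j => row j B) I aa.
rewrite /= size_tuple => ->; rewrite big1// => J _.
by rewrite -/(aB J) aB0 mulr0.
Qed.

End PositiveDefinite.

(** * Polynomial forms *)

Section PolynomialFunctions.
Context {R : realType}.

Definition peval n (P : mpoly.mpoly n R) (x : 'rV[R]_n) : R :=
  mpoly.meval (fun i => x 0 i) P.

Definition mono n (m : 'I_n -> nat) (x : 'rV[R]_n) : R := \prod_i x 0 i ^+ m i.

Definition ispoly n (f : 'rV[R]_n -> R) : Prop :=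
  exists P : mpoly.mpoly n R, f = peval P.

(** Reduces identities that are linear in [f] to monomials. *)
Lemma ispolyP n (f : 'rV[R]_n -> R) : ispoly f ->
  exists (J : finType) (c : J -> R) (m : J -> 'I_n -> nat),
    f = fun x => \sum_j c j * mono (m j) x.
Proof.
move=> [P ->].
pose s := mpoly.msupp P.
exists 'I_(size s), (fun j : 'I_(size s) => mpoly.mcoeff (nth mpoly.mnm0 s j) P),
  (fun (j : 'I_(size s)) i => nth mpoly.mnm0 s j i).
by apply/funext => x; rewrite /peval mpoly.mevalE (big_nth mpoly.mnm0) big_mkord.
Qed.

Lemma ispoly_cst n (c : R) : ispoly (fun _ : 'rV[R]_n => c).
Proof.
by exists (mpoly.mpolyC n c); apply/funext => x; rewrite /peval mpoly.mevalC.
Qed.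

Lemma ispoly_coord n (i : 'I_n) : ispoly (fun x : 'rV[R]_n => x 0 i).
Proof.
exists (mpoly.mpolyX R (mpoly.mnm1 i)); apply/funext => x.
by rewrite /peval mpoly.mevalXU.
Qed.

Lemma ispolyD n (f g : 'rV[R]_n -> R) : ispoly f -> ispoly g ->
  ispoly (fun x => f x + g x).
Proof.
by move=> [P ->] [Q ->]; exists (P + Q); apply/funext => x; rewrite /peval mpoly.mevalD.
Qed.

Lemma ispolyM n (f g : 'rV[R]_n -> R) : ispoly f -> ispoly g ->
  ispoly (fun x => f x * g x).
Proof.
by move=> [P ->] [Q ->]; exists (P * Q); apply/funext => x; rewrite /peval mpoly.mevalM.
Qed.

Lemma ispolyZ n (f : 'rV[R]_n -> R) c : ispoly f -> ispoly (fun x => c * f x).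
Proof. by apply: ispolyM; exact: ispoly_cst. Qed.

Lemma ispoly_sum n (J : Type) (r : seq J) (F : J -> 'rV[R]_n -> R) :
  (forall j, ispoly (F j)) -> ispoly (fun x => \sum_(j <- r) F j x).
Proof.
move=> pF; elim: r => [|j r IHr].
  rewrite (_ : (fun x => _) = (fun=> 0)); first exact: ispoly_cst.
  by apply/funext => x; rewrite big_nil.
rewrite (_ : (fun x => _) = (fun x => F j x + \sum_(i <- r) F i x)).
  exact: ispolyD.
by apply/funext => x; rewrite big_cons.
Qed.

Lemma ispoly_prod n (J : Type) (r : seq J) (F : J -> 'rV[R]_n -> R) :
  (forall j, ispoly (F j)) -> ispoly (fun x => \prod_(j <- r) F j x).
Proof.
move=> pF; elim: r => [|j r IHr].
  rewrite (_ : (fun x => _) = (fun=> 1)); first exact: ispoly_cst.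
  by apply/funext => x; rewrite big_nil.
rewrite (_ : (fun x => _) = (fun x => F j x * \prod_(i <- r) F i x)).
  exact: ispolyM.
by apply/funext => x; rewrite big_cons.
Qed.

Lemma ispolyX n (f : 'rV[R]_n -> R) k : ispoly f -> ispoly (fun x => f x ^+ k).
Proof.
move=> pf; elim: k => [|k IHk].
  by rewrite (_ : (fun x => _) = (fun=> 1)); [exact: ispoly_cst|apply/funext => x; rewrite expr0].
rewrite (_ : (fun x => _) = (fun x => f x * f x ^+ k)); first exact: ispolyM.
by apply/funext => x; rewrite exprS.
Qed.

Lemma ispoly_comp n m (f : 'rV[R]_n -> R) (phi : 'rV[R]_m -> 'rV[R]_n) :
  ispoly f -> (forall i, ispoly (fun t => phi t 0 i)) -> ispoly (fun t => f (phi t)).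
Proof.
move=> /ispolyP [J [c [k ->]]] pphi; apply: ispoly_sum => j; apply: ispolyZ.
by apply: ispoly_prod => i; exact: ispolyX.
Qed.

Lemma is_derive_coord n (i : 'I_n) (x v : 'rV[R]_n) :
  is_derive x v (fun y : 'rV[R]_n => y 0 i : R^o) (v 0 i).
Proof.
pose f := fun y : 'rV[R]_n => y 0 i : R^o.
have h : h^-1 *: ((f \o shift x) (h *: v) - f x) @[h --> (0 : R)^'] --> (v 0 i : R^o).
  have : (fun=> v 0 i : R^o) @ (0 : R)^' --> (v 0 i : R^o) by exact: cvg_cst.
  apply: cvg_trans; apply: near_eq_cvg.
  near=> h; rewrite /f /= !mxE addrK -[_ *: _]/(h^-1 * (h * v 0 i)) mulKf//.
  by near: h; exact: nbhs_dnbhs_neq.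
split; first by rewrite /derivable; apply: (cvgP _ h).
exact: (cvg_lim (@Rhausdorff R) h).
Unshelve. all: by end_near. Qed.

(** Both the analytic and the formal derivative are additive and satisfy the product rule, so it
    suffices to compare them on constants and variables, which generate all polynomials. *)
Lemma is_derive_peval n (P : mpoly.mpoly n R) (x v : 'rV[R]_n) :
  is_derive x v (peval P : 'rV[R]_n -> R^o)
    (\sum_j v 0 j * peval (mpoly.mderiv j P) x).
Proof.
pose Q (P : mpoly.mpoly n R) := forall x v, is_derive x v (peval P : 'rV[R]_n -> R^o)
    (\sum_j v 0 j * peval (mpoly.mderiv j P) x).
have QC c : Q (mpoly.mpolyC n c).
  move=> y u; rewrite (_ : peval _ = cst c); last first.
    by apply/funext => z; rewrite /peval mpoly.mevalC.
  rewrite big1 => [|j _]; first exact: is_derive_cst.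
  by rewrite mpoly.mderivC /peval mpoly.meval0 mulr0.
have QX i : Q (mpoly.mpolyX R (mpoly.mnm1 i)).
  move=> y u; rewrite (_ : peval _ = (fun z => z 0 i)); last first.
    by apply/funext => z; rewrite /peval mpoly.mevalXU.
  rewrite (bigD1 i)//= big1 ?addr0 => [|j ji].
    rewrite mpoly.mderivX /peval mpoly.mnm1E eqxx scale1r.
    rewrite (_ : mpoly.mnm_sub _ _ = mpoly.mnm0); last first.
      by apply/mpoly.mnmP => k; rewrite mpoly.mnmBE subnn mpoly.mnm0E.
    by rewrite mpoly.mpolyX0 mpoly.meval1 mulr1; exact: is_derive_coord.
  by rewrite mpoly.mderivX mpoly.mnm1E eq_sym (negbTE ji) scale0r /peval
    mpoly.meval0 mulr0.
have QD P1 P2 : Q P1 -> Q P2 -> Q (P1 + P2).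
  move=> q1 q2 y u; rewrite (_ : peval _ = peval P1 + peval P2); last first.
    by apply/funext => z; rewrite /peval mpoly.mevalD.
  apply: is_derive_eq; first by apply: is_deriveD; [exact: q1|exact: q2].
  rewrite -big_split /=; apply: eq_bigr => j _.
  by rewrite mpoly.mderivD /peval mpoly.mevalD mulrDr.
have QM P1 P2 : Q P1 -> Q P2 -> Q (P1 * P2).
  move=> q1 q2 y u; rewrite (_ : peval _ = peval P1 * peval P2); last first.
    by apply/funext => z; rewrite /peval mpoly.mevalM.
  apply: is_derive_eq; first by apply: is_deriveM; [exact: q1|exact: q2].
  rewrite -[_ *: _]/(_ * _) -[X in _ + X]/(_ * _) !mulr_sumr -big_split /=.
  apply: eq_bigr => j _.
  by rewrite mpoly.mderivM /peval mpoly.mevalD !mpoly.mevalM; ring.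
suff : Q P by apply.
rewrite (mpoly.mpolyE P); elim/big_ind: _ => //.
  by have := QC 0; rewrite mpoly.mpolyC0.
move=> m _; rewrite -mpoly.mul_mpolyC; apply: (QM) => //.
rewrite mpoly.mpolyXE_id; elim/big_ind: _ => // [|i _].
  by have := QC 1; rewrite mpoly.mpolyC1.
elim: (m i) => [|k IHk]; first by rewrite expr0; have := QC 1; rewrite mpoly.mpolyC1.
by rewrite exprS; exact: QM.
Qed.

Lemma ispoly_derivable n (f : 'rV[R]_n -> R) x v : ispoly f ->
  derivable (f : 'rV[R]_n -> R^o) x v.
Proof. by move=> [P ->]; have [] := is_derive_peval P x v. Qed.

Lemma peval_delta n (P : mpoly.mpoly n R) (x : 'rV[R]_n) j :
  'D_(delta_mx 0 j) (peval P : 'rV[R]_n -> R^o) x = peval (mpoly.mderiv j P) x.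
Proof.
have [_ ->] := is_derive_peval P x (delta_mx 0 j).
rewrite (bigD1 j)//= mxE !eqxx mul1r big1 ?addr0// => i ij.
by rewrite mxE eqxx (negbTE ij) mul0r.
Qed.

Lemma ispoly_deriveE n (f : 'rV[R]_n -> R) x v : ispoly f ->
  'D_v (f : 'rV[R]_n -> R^o) x
  = \sum_j v 0 j * 'D_(delta_mx 0 j) (f : 'rV[R]_n -> R^o) x.
Proof.
move=> [P ->]; have [_ ->] := is_derive_peval P x v.
by apply: eq_bigr => j _; rewrite peval_delta.
Qed.

Lemma ispoly_derive n (f : 'rV[R]_n -> R) v : ispoly f ->
  ispoly (fun x => 'D_v (f : 'rV[R]_n -> R^o) x).
Proof.
move=> [P ->].
rewrite (_ : (fun x => _) = (fun x => \sum_j v 0 j * peval (mpoly.mderiv j P) x)).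
  by apply: ispoly_sum => j; apply: ispolyZ; eexists.
by apply/funext => x; have [_ ->] := is_derive_peval P x v.
Qed.

Lemma derive_sumZ n (J : Type) (r : seq J) (c : J -> R) (F : J -> 'rV[R]_n -> R) x v :
  (forall j, ispoly (F j)) ->
  'D_v (fun y => \sum_(j <- r) c j * F j y : R^o) x
  = \sum_(j <- r) c j * 'D_v (F j : 'rV[R]_n -> R^o) x.
Proof.
move=> pF; elim: r => [|j r IHr].
  rewrite big_nil (_ : (fun y => _) = cst 0) ?derive_cst//.
  by apply/funext => y; rewrite big_nil.
rewrite big_cons -IHr (_ : (fun y => _) =
  (c j \*: (F j : 'rV[R]_n -> R^o)) + (fun y => \sum_(j <- r) c j * F j y : R^o)).
  rewrite deriveD; [|by apply: derivableZ; exact: ispoly_derivable|].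
    by rewrite deriveZ//; exact: ispoly_derivable.
  by apply: ispoly_derivable; apply: ispoly_sum => i; exact: ispolyZ.
by apply/funext => y; rewrite big_cons.
Qed.

Lemma derive_ispolyM n (f g : 'rV[R]_n -> R) x v : ispoly f -> ispoly g ->
  'D_v (fun y => f y * g y : R^o) x
  = 'D_v (f : 'rV[R]_n -> R^o) x * g x + f x * 'D_v (g : 'rV[R]_n -> R^o) x.
Proof.
move=> pf pg; rewrite (_ : (fun y => _) = (f : 'rV[R]_n -> R^o) * (g : 'rV[R]_n -> R^o))//.
rewrite deriveM; try exact: ispoly_derivable.
by rewrite addrC -[_ *: _]/(_ * _) -[X in _ + X]/(_ * _) mulrC.
Qed.

Lemma continuous_big_sum (X : topologicalType) (J : Type) (r : seq J)
    (F : J -> X -> R) x : (forall j, {for x, continuous (F j)}) ->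
  {for x, continuous (fun y => \sum_(j <- r) F j y)}.
Proof.
move=> cF; elim: r => [|j r IHr].
  rewrite (_ : (fun y => _) = (fun=> 0)); first exact: cvg_cst.
  by apply/funext => y; rewrite big_nil.
rewrite (_ : (fun y => _) = (fun y => F j y + \sum_(i <- r) F i y)).
  by apply: cvgD; [exact: cF|exact: IHr].
by apply/funext => y; rewrite big_cons.
Qed.

Lemma continuous_big_prod (X : topologicalType) (J : Type) (r : seq J)
    (F : J -> X -> R) x : (forall j, {for x, continuous (F j)}) ->
  {for x, continuous (fun y => \prod_(j <- r) F j y)}.
Proof.
move=> cF; elim: r => [|j r IHr].
  rewrite (_ : (fun y => _) = (fun=> 1)); first exact: cvg_cst.
  by apply/funext => y; rewrite big_nil.
rewrite (_ : (fun y => _) = (fun y => F j y * \prod_(i <- r) F i y)).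
  by apply: cvgM; [exact: cF|exact: IHr].
by apply/funext => y; rewrite big_cons.
Qed.

Lemma ispoly_continuous n (f : 'rV[R]_n -> R) : ispoly f -> continuous f.
Proof.
move=> /ispolyP [J [c [m ->]]] x; apply: continuous_big_sum => j.
apply: (@continuousM R _ (fun=> c j) (mono (m j))); first exact: cst_continuous.
apply: continuous_big_prod => i.
elim: (m j i) => [|k IHk].
  rewrite (_ : (fun y => _) = (fun=> 1)); first exact: cst_continuous.
  by apply/funext => y; rewrite expr0.
rewrite (_ : (fun y => _) = (fun y : 'rV[R]_n => y 0 i * y 0 i ^+ k)).
  apply: (@continuousM R _ (fun y : 'rV[R]_n => y 0 i)); last exact: IHk.
  exact: coord_continuous.
by apply/funext => y; rewrite exprS.
Qed.

(** [msize] is the degree plus one, and 0 for the zero polynomial; each monomial either disappears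
    or loses one degree. *)
Lemma msize_mderiv n (P : mpoly.mpoly n R) j :
  (mpoly.msize (mpoly.mderiv j P) <= (mpoly.msize P).-1)%N.
Proof.
rewrite /mpoly.mderiv; apply: (leq_trans (@mpoly.mmeasure_sum n R mpoly.mdeg _ _ _ _)).
rewrite big_seq_cond; apply: (big_ind (fun k => (k <= (mpoly.msize P).-1)%N)) => //.
  by move=> a b ha hb; rewrite geq_max ha.
move=> m /andP[mP _].
have [mj|mj] := eqVneq (m j) 0%N; first by rewrite mj mul0r scale0r mpoly.msize0.
apply: (leq_trans (mpoly.msizeZ_le _ _)); rewrite mpoly.msizeX.
have mE : m = mpoly.mnm_add (mpoly.mnm_sub m (mpoly.mnm1 j)) (mpoly.mnm1 j).
  apply/mpoly.mnmP => i; rewrite mpoly.mnmDE mpoly.mnmBE mpoly.mnm1E subnK//.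
  by have [<-|//] := eqVneq j i; rewrite lt0n.
have := mpoly.msize_mdeg_lt mP; rewrite {1}mE mpoly.mdegD mpoly.mdeg1 addn1.
by case: (mpoly.mmeasure _ _).
Qed.

End PolynomialFunctions.

(** * Exterior derivative, pullback and trimmed spaces *)

Section PolynomialForms.
Context {R : realType}.
Implicit Types n m k l : nat.

(** Forgets the degree of the coefficients, which matters only for the inclusion of d of a trimmed
    space in the next one. *)
Definition polyform n k (w : form R n) : Prop :=
  (forall x, alternating k (w x)) /\
  (forall I : seq 'I_n, ispoly (fun x => w x (ebasis I))).

Lemma polyform_ispoly n k (w : form R n) vs : polyform k w -> ispoly (fun x => w x vs).
Proof.
move=> [aw pw]; have [sz|sz] := eqVneq (size vs) k; last first.
  rewrite (_ : (fun x => _) = (fun=> 0)); first exact: ispoly_cst.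
  by apply/funext => x; have [w0 _ _] := aw x; rewrite w0.
rewrite (_ : (fun x => _)
    = (fun x => \sum_(I : k.-tuple 'I_n) tensor I vs * w x (ebasis I))).
  by apply: ispoly_sum => I; exact: ispolyZ.
by apply/funext => x; exact: alt_expand.
Qed.

Lemma poly_form_polyform n j k (w : form R n) : poly_form j k w -> polyform k w.
Proof.
by move=> [aw pw]; split => // I; have [P [_ EP]] := pw I; exists P; apply/funext.
Qed.

Lemma polyformD n k (w1 w2 : form R n) : polyform k w1 -> polyform k w2 ->
  polyform k (w1 + w2).
Proof.
move=> [a1 p1] [a2 p2]; split=> [x|I]; first exact: alternatingD.
exact: ispolyD.
Qed.

Lemma koszul_polyform n k (w : form R n) : polyform k.+1 w -> polyform k (koszul w).
Proof.
move=> pw; have [aw _] := pw; split=> [x|I].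
  have [w0 lin alt] := aw x; split => [vs sz|s1 s2 c u v|s1 s2 s3 u].
  - by rewrite /koszul w0.
  - by rewrite /koszul -!cat_cons lin.
  - by rewrite /koszul -!cat_cons alt.
rewrite (_ : (fun x => _)
    = (fun x : 'rV[R]_n => \sum_(j < n) x 0 j * w x (delta_mx 0 j :: ebasis I))).
  apply: ispoly_sum => j; apply: ispolyM; first exact: ispoly_coord.
  exact: polyform_ispoly pw.
apply/funext => x; rewrite /koszul {2}[x]row_sum_delta.
exact: (alt_sum [::] _ _ _ (aw x)).
Qed.

Lemma trimmed_polyform n s k (w : form R n) : trimmed_form s k w -> polyform k w.
Proof.
move=> [mu [nu [pmu pnu ->]]]; apply: polyformD.
  exact: poly_form_polyform pmu.
apply: koszul_polyform; exact: poly_form_polyform pnu.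
Qed.

Lemma nth_del (T : Type) (x0 : T) i (s : seq T) l :
  (i < size s)%N -> nth x0 (del i s) l = nth x0 s (bump i l).
Proof.
move=> si; rewrite /del nth_cat (size_takel (ltnW si)) /bump.
case: (ltnP l i) => li; first by rewrite nth_take.
by rewrite nth_drop addSn subnKC.
Qed.

Lemma size_del (T : Type) i (s : seq T) : (i < size s)%N -> size (del i s) = (size s).-1.
Proof. by move=> si; rewrite size_cat (size_takel (ltnW si)) size_drop; lia. Qed.

Lemma map_del (T1 T2 : Type) (f : T1 -> T2) i s : map f (del i s) = del i (map f s).
Proof. by rewrite /del map_cat map_take map_drop. Qed.

(** Laplace expansion along the column of [j]. The result is the alternating sum over omitted
    arguments that defines [ext_d], which yields d(f dx_K) = sum_j (d_j f) dx_(j :: K). *)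
Lemma dx_cons n (j : 'I_n) (K : seq 'I_n) (vs : seq 'rV[R]_n) :
  dx (j :: K) vs = \sum_(i < size vs) (-1) ^+ i * nth 0 vs i 0 j * dx K (del i vs).
Proof.
have [sz|sz] := eqVneq (size vs) (size K).+1; last first.
  rewrite dx_size// big1// => i _; rewrite dx_size ?mulr0//.
  by rewrite size_del//; apply: contra sz => /eqP <-; case: (size vs) i => [[]|].
rewrite /dx {1}/gram sz eqxx /detrows (expand_det_col _ ord0).
apply: eq_bigr => i _; rewrite !mxE /=.
have iv : (i < size vs)%N by rewrite sz.
have szd : size (del i vs) = size K by rewrite size_del// sz.
rewrite (nth_map 0)//= /gram szd eqxx /cofactor addn0 /detrows mulrCA !mulrA.
congr (_ * \det _); apply/matrixP => l m; rewrite !mxE /=.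
rewrite [in RHS](nth_map 0) ?szd// nth_del// [in LHS](nth_map 0)//.
have lK : (l < size K)%N by [].
by rewrite sz /bump; case: (i <= l)%N; rewrite ?add1n ?add0n ltnS// ltnW.
Qed.

Lemma ext_d_dx n (J : finType) (c : J -> R) (f : J -> 'rV[R]_n -> R)
    (K : J -> seq 'I_n) x vs : (forall t, ispoly (f t)) ->
  ext_d (fun x vs => \sum_t c t * f t x * dx (K t) vs : R^o) x vs
  = \sum_t c t * \sum_j 'D_(delta_mx 0 j) (f t : 'rV[R]_n -> R^o) x * dx (j :: K t) vs.
Proof.
move=> pf; rewrite /ext_d.
transitivity (\sum_(i < size vs) \sum_t \sum_j
    c t * ('D_(delta_mx 0 j) (f t : 'rV[R]_n -> R^o) x *
       ((-1) ^+ i * nth 0 vs i 0 j * dx (K t) (del i vs)))).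
  apply: eq_bigr => i _.
  rewrite (_ : (fun y => _) =
    (fun y => \sum_t (c t * dx (K t) (del i vs)) * f t y : R^o)); last first.
    by apply/funext => y; apply: eq_bigr => t _; rewrite mulrAC.
  rewrite derive_sumZ// mulr_sumr; apply: eq_bigr => t _.
  rewrite ispoly_deriveE// !mulr_sumr; apply: eq_bigr => j _.
  by ring.
rewrite exchange_big; apply: eq_bigr => t _; rewrite exchange_big mulr_sumr.
by apply: eq_bigr => j _; rewrite dx_cons -!mulr_sumr.
Qed.

Lemma polyformE n k (w : form R n) : polyform k w ->
  w = fun x vs => \sum_(I : k.-tuple 'I_n) k`!%:R^-1 * w x (ebasis I) * dx I vs.
Proof.
move=> [aw _]; apply/funext => x; apply/funext => vs.
have [sz|sz] := eqVneq (size vs) k; last first.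
  have [w0 _ _] := aw x; rewrite w0// big1// => I _.
  by rewrite dx_size ?mulr0// size_tuple.
by rewrite (alt_dx (aw x) sz) mulr_sumr; apply: eq_bigr => I _; rewrite mulrA.
Qed.

Definition pd n (j : 'I_n) (f : 'rV[R]_n -> R) (x : 'rV[R]_n) : R :=
  'D_(delta_mx 0 j) (f : 'rV[R]_n -> R^o) x.

Lemma ext_dE n k (w : form R n) : polyform k w ->
  ext_d w = fun x vs => \sum_(I : k.-tuple 'I_n) k`!%:R^-1 *
    \sum_j pd j (fun y => w y (ebasis I)) x * dx (j :: I) vs.
Proof.
move=> pw; apply/funext => x; apply/funext => vs; rewrite {1}(polyformE pw).
by rewrite (ext_d_dx (fun _ => k`!%:R^-1) (fun I : k.-tuple 'I_n => val I))// => I; case: pw.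
Qed.

Lemma ext_d_alternating n k (w : form R n) x : polyform k w ->
  alternating k.+1 (ext_d w x).
Proof.
move=> pw; rewrite (ext_dE pw); apply: alternating_sum => I; apply: alternatingZ.
apply: alternating_sum => j; apply: alternatingZ.
by have := dx_alternating (R := R) (j :: I); rewrite /= size_tuple.
Qed.

Lemma ext_d_polyform n k (w : form R n) : polyform k w -> polyform k.+1 (ext_d w).
Proof.
move=> pw; split=> [x|K]; first exact: ext_d_alternating.
rewrite (ext_dE pw); apply: ispoly_sum => I; apply: ispolyZ.
apply: ispoly_sum => j; apply: ispolyM; last exact: ispoly_cst.
by apply: ispoly_derive; case: pw.
Qed.

(** The coefficients of d a are combinations of generalized Kronecker symbols; contracting them with
    [sum_dx_ebasis] produces the factor (k+1)! that cancels the one in the wedge product. *)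
Lemma wedge_ext_d n k l (a : form R n) (b : covector R n) x vs :
  polyform k a -> alternating l b ->
  wedge_prod (ext_d a x) b vs = (k`! * l`!)%:R^-1 *
    \sum_(I : k.-tuple 'I_n) \sum_(J : l.-tuple 'I_n) \sum_j
      pd j (fun y => a y (ebasis I)) x * b (ebasis J) * dx (j :: I ++ J) vs.
Proof.
move=> pa ab; rewrite (wedge_dx (ext_d_alternating x pa) ab).
transitivity ((k.+1`! * l`!)%:R^-1 * (k`!%:R^-1 *
  \sum_(J : l.-tuple 'I_n) \sum_(I : k.-tuple 'I_n) \sum_j
    pd j (fun y => a y (ebasis I)) x * b (ebasis J) *
    \sum_(K : k.+1.-tuple 'I_n) dx (j :: I) (ebasis K) * dx (K ++ J) vs)).
  congr (_ * _); rewrite exchange_big mulr_sumr; apply: eq_bigr => J _.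
  rewrite (ext_dE pa).
  transitivity (\sum_(K : k.+1.-tuple 'I_n) \sum_(I : k.-tuple 'I_n) \sum_j
    k`!%:R^-1 * (pd j (fun y => a y (ebasis I)) x * b (ebasis J) *
      (dx (j :: I) (ebasis K) * dx (K ++ J) vs))).
    apply: eq_bigr => K _; rewrite !mulr_suml; apply: eq_bigr => I _.
    rewrite mulr_sumr !mulr_suml; apply: eq_bigr => j _.
    have mulE (c u v y z : R) : c * (u * v) * y * z = c * (u * y * (v * z)) by ring.
    exact: mulE.
  rewrite exchange_big mulr_sumr; apply: eq_bigr => I _.
  rewrite exchange_big mulr_sumr; apply: eq_bigr => j _.
  by rewrite !mulr_sumr.
rewrite mulrA exchange_big.
transitivity ((k.+1`! * l`!)%:R^-1 / k`!%:R * (k.+1`!%:R *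
  \sum_(I : k.-tuple 'I_n) \sum_(J : l.-tuple 'I_n) \sum_j
    pd j (fun y => a y (ebasis I)) x * b (ebasis J) * dx (j :: I ++ J) vs)).
  congr (_ * _); rewrite mulr_sumr; apply: eq_bigr => I _.
  rewrite mulr_sumr; apply: eq_bigr => J _.
  rewrite mulr_sumr; apply: eq_bigr => j _.
  have aJ : antisym (fun K : seq 'I_n => dx (K ++ J) vs).
    by move=> s1 y z s2; rewrite -!catA /= dx_antisymr.
  by rewrite (sum_dx_ebasis [tuple of j :: I] aJ) mulrCA.
rewrite mulrA; congr (_ * _).
have mulE (y A B : R) : y != 0 -> (y * B)^-1 / A * y = (A * B)^-1.
  move=> y0; rewrite !invfM (_ : _ * _ = (y^-1 * y) * (A^-1 * B^-1)); last by ring.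
  by rewrite mulVf// mul1r.
by rewrite (natrM R k.+1`! l`!) (natrM R k`! l`!) mulE// factR_neq0.
Qed.

(** In coordinates this is the product rule for the coefficients. The term with d b is brought to
    the form of [wedge_ext_d] by graded commutativity. *)
Lemma leibniz n k l (a b : form R n) x vs : polyform k a -> polyform l b ->
  ext_d (fun x => wedge_prod (a x) (b x)) x vs
  = wedge_prod (ext_d a x) (b x) vs + (-1) ^+ k * wedge_prod (a x) (ext_d b x) vs.
Proof.
move=> pa pb; have [aa ca] := pa; have [ab cb] := pb.
rewrite (_ : (fun x => _) = (fun x vs =>
   \sum_(p : k.-tuple 'I_n * l.-tuple 'I_n) (k`! * l`!)%:R^-1 *
     (a x (ebasis p.1) * b x (ebasis p.2)) * dx (p.1 ++ p.2) vs : R^o)); last first.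
  apply/funext => y; apply/funext => us; rewrite (wedge_dx (aa y) (ab y)).
  rewrite -(pair_bigA _ (fun (I : k.-tuple 'I_n) (J : l.-tuple 'I_n) => (k`! * l`!)%:R^-1 *
     (a y (ebasis I) * b y (ebasis J)) * dx (I ++ J) us)) mulr_sumr.
  apply: eq_bigr => I _.
  by rewrite mulr_sumr; apply: eq_bigr => J _; rewrite mulrA.
rewrite (ext_d_dx (fun _ => (k`! * l`!)%:R^-1)
  (f := fun (p : k.-tuple 'I_n * l.-tuple 'I_n) y => a y (ebasis p.1) * b y (ebasis p.2))
  (fun p : k.-tuple 'I_n * l.-tuple 'I_n => p.1 ++ p.2)); last first.
  by move=> p; exact: ispolyM.
rewrite -(pair_bigA _ (fun (I : k.-tuple 'I_n) (J : l.-tuple 'I_n) => (k`! * l`!)%:R^-1 *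
  \sum_j 'D_(delta_mx 0 j) (fun y => a y (ebasis I) * b y (ebasis J) : R^o) x
     * dx (j :: I ++ J) vs)) /=.
rewrite (wedge_comm _ (ext_d_alternating x pb) (aa x)).
rewrite (wedge_ext_d _ _ pa (ab x)) (wedge_ext_d _ _ pb (aa x)).
set C := (k`! * l`!)%:R^-1.
rewrite (_ : (-1) ^+ k * _ = C *
    \sum_(I : k.-tuple 'I_n) \sum_(J : l.-tuple 'I_n) \sum_j
      a x (ebasis I) * pd j (fun y => b y (ebasis J)) x * dx (j :: I ++ J) vs); last first.
  rewrite (mulnC l`!) -/C exchange_big.
  rewrite mulrA mulrCA; congr (_ * _); rewrite mulr_sumr.
  apply: eq_bigr => I _; rewrite mulr_sumr; apply: eq_bigr => J _.
  rewrite mulr_sumr; apply: eq_bigr => j _.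
  have := antisym_catCA [:: j] J I [::] (dx_antisymr vs).
  rewrite /= !cats0 !size_tuple => ->.
  have mulE (e1 e2 e3 d f t : R) : e1 * e2 * e3 = 1 ->
      e1 * e2 * (f * d * (e3 * t)) = d * f * t.
    move=> e; have -> : e1 * e2 * (f * d * (e3 * t)) = e1 * e2 * e3 * (d * f * t) by ring.
    by rewrite e mul1r.
  (* The exponents are k from the Leibniz rule, (l+1)k from commuting a with d b, and lk from
     exchanging the index lists; their sum is even. *)
  by apply: mulE; rewrite mulSn exprD mulrA -expr2 sqrr_sign mul1r -expr2 sqrr_sign.
rewrite -mulrDr -big_split mulr_sumr; apply: eq_bigr => I _ /=.
rewrite -big_split mulr_sumr; apply: eq_bigr => J _ /=; congr (_ * _).
rewrite -big_split; apply: eq_bigr => j _ /=.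
by rewrite derive_ispolyM// mulrDl.
Qed.

(** The chart is affine, so the difference quotients on both sides already agree before the limit is
    taken; this holds for every form, without a chain rule. *)
Lemma pull_ext_d n m (s : seq 'rV[R]_n) (w : form R n) :
  pull m s (ext_d w) = ext_d (pull m s w).
Proof.
apply/funext => t; apply/funext => us; rewrite /pull /ext_d size_map.
apply: eq_bigr => i _; congr (_ * _); rewrite (nth_map 0)//.
rewrite /derive; apply: (congr1 (fun f : R -> R^o => lim (f h @[h --> (0 : R)^']))).
apply/funext => h /=.
rewrite !map_del; congr (_ *: (_ - _)); congr (w _ _).
by rewrite mulmxDl scalemxAl addrCA.
Qed.

Lemma pull_wedge n m (s : seq 'rV[R]_n) (a b : form R n) :
  pull m s (fun x => wedge_prod (a x) (b x))
  = fun t => wedge_prod (pull m s a t) (pull m s b t).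
Proof.
apply/funext => t; apply/funext => us; rewrite /pull /wedge_prod size_map.
apply: eq_bigr => k _; congr (_ * _); apply: eq_bigr => sg _.
set us' := [seq nth 0 us (sg i) | i <- enum 'I_(size us)].
have -> : [seq nth 0 [seq u *m edges m s | u <- us] (sg i) | i <- enum 'I_(size us)]
   = [seq u *m edges m s | u <- us'].
  rewrite /us' -(map_comp _ _ (enum _)); apply: eq_map => i /=.
  by rewrite (nth_map 0).
by rewrite /= map_take map_drop.
Qed.

Lemma pull_polyform n m (s : seq 'rV[R]_n) k (w : form R n) :
  polyform k w -> polyform k (pull m s w).
Proof.
move=> pw; have [aw _] := pw; split=> [t|I].
  have [w0 lin alt] := aw (nth 0 s 0 + t *m edges m s).
  split => [vs sz|s1 s2 c u v|s1 s2 s3 u]; rewrite /pull.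
  - by rewrite w0// size_map.
  - by rewrite !map_cat /= mulmxDl -scalemxAl lin.
  - by rewrite map_cat /= map_cat /= alt.
rewrite /pull; apply: (ispoly_comp (polyform_ispoly _ pw)) => i.
rewrite (_ : (fun t => _) = (fun t : 'rV[R]_m =>
   nth 0 s 0 0 i + \sum_(j < m) t 0 j * edges m s j i)); last first.
  by apply/funext => t; rewrite !mxE.
apply: ispolyD; first exact: ispoly_cst.
apply: ispoly_sum => j; apply: ispolyM; first exact: ispoly_coord.
exact: ispoly_cst.
Qed.

Lemma poly_formD n j k (w1 w2 : form R n) : poly_form j k w1 -> poly_form j k w2 ->
  poly_form j k (w1 + w2).
Proof.
move=> [a1 p1] [a2 p2]; split=> [x|I]; first exact: alternatingD.
have [P [sP EP]] := p1 I; have [Q [sQ EQ]] := p2 I.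
exists (P + Q); split => [|x].
  by rewrite (leq_trans (mpoly.msizeD_le _ _))// geq_max sP.
by rewrite mpoly.mevalD -EP -EQ.
Qed.

Lemma poly_formZ n j k c (w : form R n) : poly_form j k w -> poly_form j k (c *: w).
Proof.
move=> [aw pw]; split=> [x|I]; first exact: alternatingZ.
have [P [sP EP]] := pw I; exists (c *: P); split => [|x].
  by rewrite (leq_trans (mpoly.msizeZ_le _ _)).
by rewrite mpoly.mevalZ -EP.
Qed.

Lemma poly_form0 n j k : poly_form j k (0 : form R n).
Proof.
split=> [x|I]; first exact: alternating0.
by exists 0; split => [|x]; rewrite ?mpoly.msize0 ?mpoly.meval0.
Qed.

(** [d] bounds [msize], that is, the degree plus one. *)
Definition poly_le n d (f : 'rV[R]_n -> R) : Prop :=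
  exists P : mpoly.mpoly n R, (mpoly.msize P <= d)%N /\ f = peval P.

Lemma poly_le_sumZ n d (J : Type) (r : seq J) (c : J -> R) (F : J -> 'rV[R]_n -> R) :
  (forall j, poly_le d (F j)) -> poly_le d (fun x => \sum_(j <- r) c j * F j x).
Proof.
move=> pF; elim: r => [|j r [P [sP EP]]].
  exists 0; split; first by rewrite mpoly.msize0.
  by apply/funext => x; rewrite big_nil /peval mpoly.meval0.
have [Q [sQ EQ]] := pF j; exists (c j *: Q + P); split.
  rewrite (leq_trans (mpoly.msizeD_le _ _))// geq_max sP andbT.
  by rewrite (leq_trans (mpoly.msizeZ_le _ _)).
apply/funext => x; rewrite big_cons /peval mpoly.mevalD mpoly.mevalZ.
by rewrite EQ -[in RHS]/(peval P x) -EP.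
Qed.

Lemma ext_d_poly_form n j k (w : form R n) : poly_form j.+1 k w ->
  poly_form j k.+1 (ext_d w).
Proof.
move=> pw; have pw' := poly_form_polyform pw.
split=> [x|K]; first exact: ext_d_alternating.
suff [P [sP EP]] : poly_le j.+1 (fun x => ext_d w x (ebasis K)).
  by exists P; split => // x; rewrite -[LHS]/((fun x => ext_d w x (ebasis K)) x) EP.
rewrite (ext_dE pw'); apply: poly_le_sumZ => I.
rewrite (_ : (fun x => _) = (fun x => \sum_i dx (i :: I) (ebasis K) *
    pd i (fun y => w y (ebasis I)) x)); last first.
  by apply/funext => x; apply: eq_bigr => i _; rewrite mulrC.
apply: poly_le_sumZ => i; have [_ /(_ I) [P [sP EP]]] := pw.
exists (mpoly.mderiv i P); split.
  by apply: (leq_trans (msize_mderiv _ _)); case: (mpoly.msize P) sP.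
have -> : (fun y => w y (ebasis I)) = peval P by apply/funext => y; exact: EP.
by apply/funext => x; rewrite /pd peval_delta.
Qed.

(** Contraction with the position vector multiplies coefficients by coordinates and raises the
    degree by at most one. The bound [s.-1.+1] is s for s >= 1. *)
Lemma trimmed_poly_form n s k (w : form R n) : trimmed_form s k w ->
  poly_form s.-1.+1 k w.
Proof.
move=> tw; have pw := trimmed_polyform tw.
case: tw pw => mu [nu [pmu pnu ->]] pw; split=> [x|I]; first by case: pw.
have [_ /(_ I) [P [sP EP]]] := pmu.
suff [Q [sQ EQ]] : poly_le s.-1.+2 (fun x => koszul nu x (ebasis I)).
  exists (P + Q); split => [|x].
    by rewrite (leq_trans (mpoly.msizeD_le _ _))// geq_max sQ andbT ltnW.
  by rewrite mpoly.mevalD -EP -[in RHS]/(peval Q x) -EQ.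
rewrite (_ : (fun x => _) = (fun x : 'rV[R]_n =>
    \sum_(j < n) 1 * (x 0 j * nu x (ebasis (j :: I))))); last first.
  apply/funext => x; rewrite /koszul {2}[x]row_sum_delta.
  rewrite (alt_sum [::] _ _ _ (proj1 pnu x)).
  by apply: eq_bigr => j _; rewrite mul1r.
apply: poly_le_sumZ => j.
have [_ /(_ (j :: I)) [Q [sQ EQ]]] := pnu.
exists (mpoly.mpolyX R (mpoly.mnm1 j) * Q); split.
  have [->|Q0] := eqVneq Q 0; first by rewrite mulr0 mpoly.msize0.
  rewrite mpoly.msizeM// ?mpoly.msizeX ?mpoly.mdeg1//.
  by rewrite -mpoly.msize_poly_eq0 mpoly.msizeX.
by apply/funext => x; rewrite /peval mpoly.mevalM mpoly.mevalXU /ebasis EQ.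
Qed.

Lemma koszulD n (w1 w2 : form R n) : koszul (w1 + w2) = koszul w1 + koszul w2.
Proof. by []. Qed.

Lemma koszulZ n c (w : form R n) : koszul (c *: w) = c *: koszul w.
Proof. by []. Qed.

Lemma trimmed_formD n s k (w1 w2 : form R n) :
  trimmed_form s k w1 -> trimmed_form s k w2 -> trimmed_form s k (w1 + w2).
Proof.
move=> [m1 [n1 [pm1 pn1 ->]]] [m2 [n2 [pm2 pn2 ->]]].
exists (m1 + m2), (n1 + n2); split; [exact: poly_formD|exact: poly_formD|].
by rewrite koszulD addrACA.
Qed.

Lemma trimmed_formZ n s k c (w : form R n) :
  trimmed_form s k w -> trimmed_form s k (c *: w).
Proof.
move=> [m1 [n1 [pm1 pn1 ->]]].
exists (c *: m1), (c *: n1); split; [exact: poly_formZ|exact: poly_formZ|].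
by rewrite koszulZ scalerDr.
Qed.

(** The derivative lowers the degree again, so d w lies in the first summand of the trimmed space
    and the contracted part can be taken to be 0. *)
Lemma ext_d_trimmed n s k (w : form R n) : trimmed_form s k w ->
  trimmed_form s k.+1 (ext_d w).
Proof.
move=> /trimmed_poly_form tw; exists (ext_d w), 0; split.
- exact: ext_d_poly_form.
- exact: poly_form0.
- by apply/funext => x; apply/funext => vs; rewrite -[RHS]/(ext_d w x vs + 0) addr0.
Qed.

End PolynomialForms.

(** * Stokes' theorem on a simplex *)

Section SimplexIntegrals.
Context {R : realType}.
Implicit Types n m : nat.

Lemma continuous_to_rV (Y : topologicalType) m (h : Y -> 'rV[R]_m) y :
  (forall i, {for y, continuous (fun z => h z 0 i)}) -> {for y, continuous h}.
Proof.
move=> ch A [P Ph sPA].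
have : \forall z \near y, forall i, P 0 i (h z 0 i).
  apply: filter_forall => i; exact: (ch i _ (Ph 0 i)).
apply: filterS => z Pz; apply: sPA => i j; rewrite ord1; exact: Pz.
Qed.

Definition rowof m (ts : seq R) : 'rV[R]_m := \row_i nth 0 ts i.

Definition cons_row m (t : R) (v : 'rV[R]_m) : 'rV[R]_m.+1 :=
  \row_i oapp (fun k => v 0 k) t (unlift ord0 i).

Lemma rowof_cons m t ts : rowof m.+1 (t :: ts) = cons_row t (rowof m ts).
Proof.
apply/rowP => i; rewrite !mxE; case: unliftP => [k ->|->] //=.
by rewrite !mxE.
Qed.

(** Links integrands on lists to functions of row vectors: each entry that moves into the parameter
    is put back in front by [cons_row]. *)
Lemma jcont_rowof m (X : topologicalType) (F : X * 'rV[R]_m -> R) :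
  continuous F -> jcont m (fun x ts => F (x, rowof m ts)).
Proof.
elim: m X F => [|m IHm] X F cF /=.
  move=> x; apply: (@continuous2_cvg X X _ R (nbhs x) _ id (fun=> rowof 0 [::])
    (fun x v => F (x, v)) x (rowof 0 [::])).
  - have := cF (x, rowof 0 [::]).
    by rewrite (_ : F = (fun xy : X * 'rV[R]_0 => F (xy.1, xy.2)))//; apply/funext => -[].
  - exact: cvg_id.
  - exact: cvg_cst.
pose G (p : (X * R) * 'rV[R]_m) := F (p.1.1, cons_row p.1.2 p.2).
rewrite (_ : (fun xt ts => _) = (fun xt ts => G (xt, rowof m ts))); last first.
  by apply/funext => -[x t]; apply/funext => ts; rewrite /G /= rowof_cons.
apply: IHm => p.
apply: (@continuous2_cvg _ X _ R (nbhs p) _ (fun p : (X * R) * 'rV[R]_m => p.1.1)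
  (fun p => cons_row p.1.2 p.2) (fun x v => F (x, v)) p.1.1 (cons_row p.1.2 p.2)).
- have := cF (p.1.1, cons_row p.1.2 p.2).
  by rewrite (_ : F = (fun xy : X * 'rV[R]_m.+1 => F (xy.1, xy.2)))//; apply/funext => -[].
- apply: (@continuous_comp _ _ _ fst fst); exact: cvg_fst.
apply: (@continuous_to_rV _ _ (fun p : (X * R) * 'rV[R]_m => cons_row p.1.2 p.2) p) => i.
rewrite /cons_row (_ : (fun z => _) = (fun z : (X * R) * 'rV[R]_m =>
    oapp (fun k => z.2 0 k) z.1.2 (unlift ord0 i))); last first.
  by apply/funext => z; rewrite mxE.
case: (unlift ord0 i) => [k|] /=.
  apply: (@continuous_comp _ _ _ snd (fun v : 'rV[R]_m => v 0 k)); first exact: cvg_snd.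
  exact: coord_continuous.
apply: (@continuous_comp _ _ _ fst snd); [exact: cvg_fst|exact: cvg_snd].
Qed.

Definition Int m (f : 'rV[R]_m -> R) : R := int_std m 1 (fun ts => f (rowof m ts)).

Lemma jcont_row m (f : 'rV[R]_m -> R) : continuous f ->
  jcont m (fun (_ : R) ts => f (rowof m ts)).
Proof.
move=> cf; apply: (@jcont_rowof m R (fun p => f p.2)) => p.
apply: (@continuous_comp _ _ _ snd f); [exact: cvg_snd|exact: cf].
Qed.

Lemma IntD m (f g : 'rV[R]_m -> R) : continuous f -> continuous g ->
  Int (fun t => f t + g t) = Int f + Int g.
Proof.
by move=> cf cg; rewrite /Int (int_stdD 1 0 (jcont_row cf) (jcont_row cg)).
Qed.

Lemma IntZ m (f : 'rV[R]_m -> R) c : continuous f ->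
  Int (fun t => c * f t) = c * Int f.
Proof. by move=> cf; rewrite /Int (int_stdZ 1 c 0 (jcont_row cf)). Qed.

Lemma Int_sumZ m (J : Type) (r : seq J) (c : J -> R) (F : J -> 'rV[R]_m -> R) :
  (forall j, continuous (F j)) ->
  Int (fun t => \sum_(j <- r) c j * F j t) = \sum_(j <- r) c j * Int (F j).
Proof.
move=> cF.
have cc j : continuous (fun t => c j * F j t).
  by move=> t; apply: (@continuousM R _ (fun=> c j) (F j)); [exact: cst_continuous|exact: cF].
elim: r => [|j r IHr].
  rewrite big_nil (_ : (fun t => _) = (fun t => 0 * 0)); last first.
    by apply/funext => t; rewrite big_nil mul0r.
  by rewrite (@IntZ _ (fun=> 0)) ?mul0r//; exact: cst_continuous.
rewrite big_cons -IHr -IntZ// -IntD//.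
  by congr Int; apply/funext => t; rewrite big_cons.
by move=> t; apply: continuous_big_sum => i; exact: cc.
Qed.

Definition inS m (t : 'rV[R]_m) : Prop := (forall i, 0 <= t 0 i) /\ \sum_i t 0 i <= 1.

Lemma sum_rowof m ts : size ts = m -> \sum_(t <- ts) t = \sum_i (rowof m ts) 0 i.
Proof.
move=> sz; rewrite (big_nth 0) sz big_mkord; apply: eq_bigr => i _; by rewrite mxE.
Qed.

Lemma in_simplex_rowof m ts : in_simplex m 1 ts -> inS (rowof m ts).
Proof.
move=> [sz ge0 le1]; split; last by rewrite -sum_rowof.
by move=> i; rewrite mxE; apply: (allP ge0); rewrite mem_nth// sz.
Qed.

Lemma eq_Int m (f g : 'rV[R]_m -> R) : (forall t, inS t -> f t = g t) -> Int f = Int g.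
Proof.
move=> fg; apply: eq_int_std => // ts h; apply: fg; exact: in_simplex_rowof.
Qed.

Lemma rowofK m (t : 'rV[R]_m) : rowof m [seq t 0 i | i <- enum 'I_m] = t.
Proof. by apply/rowP => i; rewrite mxE nth_enum_map. Qed.

Lemma inS_simplex m (t : 'rV[R]_m) : inS t -> in_simplex m 1 [seq t 0 i | i <- enum 'I_m].
Proof.
move=> [ge0 le1]; split; first by rewrite size_enum_map.
  by apply/allP => x /mapP [i _ ->]; exact: ge0.
by rewrite (sum_rowof (size_enum_map _)) rowofK.
Qed.

(** Points with coordinate sum less than 1 are covered by [int_std_eq0]; the others are reached
    along the segment from the origin. *)
Lemma Int_ge0_eq0 m (f : 'rV[R]_m -> R) : continuous f ->
  (forall t, inS t -> 0 <= f t) -> Int f = 0 -> forall t, inS t -> f t = 0.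
Proof.
move=> cf f0 If.
have lt1 t : inS t -> \sum_i t 0 i < 1 -> f t = 0.
  move=> St tl; rewrite -[t]rowofK.
  apply: (int_std_eq0 (x := 0) ltr01 (jcont_row cf) _ If (inS_simplex St)).
    by move=> ts h; apply: f0; exact: in_simplex_rowof.
  by rewrite (sum_rowof (size_enum_map _)) rowofK.
move=> t [t0 t1].
have := @continuous_zero_closure R (fun s => f (s *: t)); rewrite scale1r; apply.
  move=> s; apply: (@continuous_comp _ _ _ (fun s : R => s *: t) f); last exact: cf.
  by apply: cvgZr_tmp; exact: cvg_id.
move=> s /andP[s0 s1].
have sum_s : \sum_i (s *: t) 0 i = s * \sum_i t 0 i.
  by rewrite mulr_sumr; apply: eq_bigr => i _; rewrite mxE.
have st0 : 0 <= \sum_i t 0 i by apply: sumr_ge0.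
apply: lt1; last by rewrite sum_s; nra.
by split => [i|]; [rewrite mxE mulr_ge0// ltW|rewrite sum_s; nra].
Qed.

(* Charts of the facets of the standard simplex: the one opposite to the origin,
   and the one on which the j-th coordinate vanishes. *)
Definition slantpt m (t : 'rV[R]_m) : 'rV[R]_m.+1 := cons_row (1 - \sum_i t 0 i) t.

Definition insert0 m (j : 'I_m.+1) (t : 'rV[R]_m) : 'rV[R]_m.+1 :=
  \row_i oapp (fun k => t 0 k) 0 (unlift j i).

(** This is also the integral over the standard m-simplex of a function of its m + 1 barycentric
    coordinates. It serves both as a face term in Stokes' theorem and as the symmetric form of the
    integral over a simplex. *)
Definition slant m (H : 'rV[R]_m.+1 -> R) : R := Int (fun t => H (slantpt t)).

Lemma slantpt_ispoly m i : ispoly (fun t : 'rV[R]_m => slantpt t 0 i).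
Proof.
rewrite /slantpt /cons_row (_ : (fun t => _) = (fun t : 'rV[R]_m =>
    oapp (fun k => t 0 k) (1 + -1 * \sum_k t 0 k) (unlift ord0 i))); last first.
  by apply/funext => t; rewrite mxE mulN1r.
case: (unlift ord0 i) => [k|] /=; first exact: ispoly_coord.
apply: ispolyD; first exact: ispoly_cst.
by apply: ispolyZ; apply: ispoly_sum => k; exact: ispoly_coord.
Qed.

Lemma insert0_ispoly m j i : ispoly (fun t : 'rV[R]_m => insert0 j t 0 i).
Proof.
rewrite /insert0 (_ : (fun t => _) = (fun t : 'rV[R]_m =>
    oapp (fun k => t 0 k) 0 (unlift j i))); last by apply/funext => t; rewrite mxE.
by case: (unlift j i) => [k|] /=; [exact: ispoly_coord|exact: ispoly_cst].
Qed.

Lemma monomE (al : seq nat) (ts : seq R) : size ts = size al ->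
  monom al ts = \prod_(p <- zip al ts) p.2 ^+ p.1.
Proof.
elim: al ts => [|a al IHal] [|t ts] //= => [_|[sz]]; first by rewrite big_nil.
by rewrite big_cons IHal.
Qed.

Lemma monom_mono m (al : 'I_m -> nat) ts : size ts = m ->
  monom [seq al i | i <- enum 'I_m] ts = mono al (rowof m ts).
Proof.
move=> sz; rewrite monomE ?size_enum_map// {1}(seq_enum 0 sz) zip_map big_map big_enum.
by apply: eq_bigr => i _; rewrite mxE.
Qed.

(** Dirichlet's formula, with the exponent of the first coordinate 1 - sum t as [b]. *)
Lemma slant_mono m (al : 'I_m.+1 -> nat) :
  slant (mono al) = (\prod_i (al i)`!)%:R / (m + \sum_i al i)`!%:R.
Proof.
pose be := [seq al (lift ord0 i) | i <- enum 'I_m].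
have szb : size be = m by rewrite size_enum_map.
have := @int_std_dirichlet R be (al ord0) 1 1 ler01.
rewrite mul1r expr1n mulr1 szb.
have -> : sumn be = \sum_i al (lift ord0 i) by rewrite sumnE big_map big_enum.
have -> : \prod_(a <- be) a`! = \prod_i (al (lift ord0 i))`! by rewrite big_map big_enum.
rewrite !big_ord_recl /= mulnC -addnA [(_ + al ord0)%N]addnC => <-.
apply: eq_int_std => // ts [sz _ _].
rewrite mul1r (monom_mono (fun i => al (lift ord0 i)) sz) mulrC /mono big_ord_recl.
rewrite /slantpt mxE unlift_none /= (sum_rowof sz); congr (_ * _).
by apply: eq_bigr => i _; rewrite mxE liftK.
Qed.

Lemma Int_mono m (al : 'I_m -> nat) :
  Int (mono al) = (\prod_i (al i)`!)%:R / (m + \sum_i al i)`!%:R.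
Proof.
pose be (i : 'I_m.+1) := oapp al 0%N (unlift ord0 i).
have := slant_mono be; rewrite !big_ord_recl /be unlift_none /= mul1n add0n.
under eq_bigr do rewrite liftK /=.
under [in X in _ = _ / X]eq_bigr do rewrite liftK /=.
move=> <-; rewrite /slant; congr Int; apply/funext => t.
rewrite /mono big_ord_recl unlift_none /= expr0 mul1r.
by apply: eq_bigr => i _; rewrite liftK mxE liftK.
Qed.

Lemma mono_ispoly m (k : 'I_m -> nat) : ispoly (mono k : 'rV[R]_m -> R).
Proof. by apply: ispoly_prod => i; apply: ispolyX; exact: ispoly_coord. Qed.

Lemma slant_ispoly m (J : finType) (c : J -> R) (k : J -> 'I_m.+1 -> nat) :
  slant (fun t => \sum_j c j * mono (k j) t) = \sum_j c j * slant (mono (k j)).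
Proof.
apply: (Int_sumZ _ _ (F := fun j t => mono (k j) (slantpt t))) => j.
apply: ispoly_continuous; apply: (ispoly_comp (mono_ispoly _)) => i.
exact: slantpt_ispoly.
Qed.

(** The value in [slant_mono] is a symmetric function of the exponents; polynomials follow by
    linearity. *)
Lemma slant_perm m (H : 'rV[R]_m.+1 -> R) (s : 'S_m.+1) : ispoly H ->
  slant (fun v => H (col_perm s v)) = slant H.
Proof.
move=> /ispolyP [J [c [k ->]]].
have E j v : mono (k j) (col_perm s v) = mono (fun i => k j (s^-1 i)%g) v.
  rewrite /mono (reindex_inj (@perm_inj _ s^-1%g)); apply: eq_bigr => i _.
  by rewrite mxE permKV.
under [X in slant X]eq_fun do under eq_bigr do rewrite E.
rewrite !slant_ispoly; apply: eq_bigr => j _; congr (_ * _); rewrite !slant_mono.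
congr (_%:R / _`!%:R).
  by rewrite [RHS](reindex_inj (@perm_inj _ s^-1%g)).
by congr (_ + _)%N; rewrite [RHS](reindex_inj (@perm_inj _ s^-1%g)).
Qed.

(** When [al j] is 0 the truncated exponent is wrong, but its coefficient vanishes. *)
Lemma pd_mono m (al : 'I_m -> nat) (j : 'I_m) (x : 'rV[R]_m) :
  pd j (mono al) x = (al j)%:R * mono (fun i => al i - (i == j))%N x.
Proof.
have mE (be : 'I_m -> nat) :
    mono be = peval (mpoly.mpolyX R (mpoly.Multinom [tuple be i | i < m])).
  apply/funext => y; rewrite /peval mpoly.mevalX; apply: eq_bigr => i _.
  by rewrite mpoly.mnmE.
rewrite /pd mE peval_delta mpoly.mderivX /peval mpoly.mevalZ mpoly.mevalX mpoly.mnmE.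
congr (_ * _); apply: eq_bigr => i _.
by rewrite mpoly.mnmBE mpoly.mnmE mpoly.mnm1E eq_sym.
Qed.

Lemma pd_sumZ m (J : finType) (c : J -> R) (k : J -> 'I_m -> nat) i x :
  pd i (fun t : 'rV[R]_m => \sum_j c j * mono (k j) t) x
  = \sum_j c j * pd i (mono (k j)) x.
Proof. by rewrite /pd derive_sumZ// => j; exact: mono_ispoly. Qed.

(** All three integrals are known explicitly. If [al j] is 0, the derivative vanishes and the two
    face terms are equal; otherwise the monomial vanishes on the coordinate face, and
    differentiation keeps both the numerator, as a (a-1)! = a!, and the denominator, as the
    dimension makes up for the lost degree. *)
Lemma stokes_mono m (al : 'I_m.+1 -> nat) (j : 'I_m.+1) :
  Int (pd j (mono al)) = slant (mono al) - Int (fun t => mono al (insert0 j t)).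
Proof.
have EI : (fun t => mono al (insert0 j t))
   = (fun t => (al j == 0%N)%:R * mono (fun i => al (lift j i)) t).
  apply/funext => t; rewrite /mono (bigD1_ord j)//= mxE unlift_none /= expr0n.
  by congr (_ * _); apply: eq_bigr => i _; rewrite mxE liftK.
have -> : pd j (mono al) = (fun t : 'rV[R]_m.+1 => (al j)%:R * mono (fun i => al i - (i == j))%N t).
  by apply/funext => t; rewrite pd_mono.
rewrite EI !IntZ; try by apply: ispoly_continuous; exact: mono_ispoly.
rewrite slant_mono !Int_mono.
have [a0|a0] := eqVneq (al j) 0%N.
  rewrite a0 mul0r mul1r (bigD1_ord j)// (bigD1_ord j (P := xpredT) (F := al))//= a0.
  by rewrite mul1n add0n subrr.
rewrite mul0r subr0 mulrA -natrM; congr (_%:R / _`!%:R).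
  rewrite [RHS](bigD1 j)//= (bigD1 j)//= eqxx mulnA; congr (_ * _)%N.
    by case: (al j) a0 => // a _; rewrite subn1.
  by apply: eq_bigr => i /negbTE ->; rewrite subn0.
rewrite [in RHS](bigD1 j)//= (bigD1 j)//= eqxx.
under eq_bigr => i /negbTE -> do rewrite subn0.
by rewrite !addnA; congr (_ + _)%N; case: (al j) a0 => // a _; rewrite subn1 addSnnS.
Qed.

Lemma stokes_fun m (f : 'rV[R]_m.+1 -> R) (j : 'I_m.+1) : ispoly f ->
  Int (pd j f) = slant f - Int (fun t => f (insert0 j t)).
Proof.
move=> /ispolyP [J [c [k ->]]].
have -> : pd j (fun x => \sum_i c i * mono (k i) x)
   = (fun x : 'rV[R]_m.+1 => \sum_i c i * pd j (mono (k i)) x).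
  by apply/funext => x; exact: pd_sumZ.
rewrite Int_sumZ => [|i]; last first.
  by apply: ispoly_continuous; apply: ispoly_derive; exact: mono_ispoly.
rewrite slant_ispoly (Int_sumZ _ _ (F := fun i t => mono (k i) (insert0 j t))).
  rewrite -sumrB; apply: eq_bigr => i _; by rewrite stokes_mono mulrBr.
move=> i; apply: ispoly_continuous; apply: (ispoly_comp (mono_ispoly _)) => l.
exact: insert0_ispoly.
Qed.

End SimplexIntegrals.

(** * From coordinate directions to an arbitrary simplex *)

Section Stokes.
Context {R : realType}.
Implicit Types n m k : nat.

Lemma alt_sub_repeat n k (a : covector R n) s1 s2 s3 u : alternating k a ->
  a (s1 ++ u :: s2 ++ [seq v - u | v <- s3]) = a (s1 ++ u :: s2 ++ s3).
Proof.
move=> aa; have [_ _ alt] := aa.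
elim: s3 s2 => [|v s3 IHs] s2 //=.
have -> : s1 ++ u :: s2 ++ (v - u) :: [seq w - u | w <- s3]
   = (s1 ++ u :: s2) ++ (v - u) :: [seq w - u | w <- s3] by rewrite -catA.
rewrite (alt_add _ _ _ _ aa) (alt_opp _ _ _ aa) -!catA /= alt subr0.
by rewrite -(cat_rcons v s2) IHs cat_rcons.
Qed.

Lemma alt_sub n k (a : covector R n) s1 s u : alternating k a ->
  a (s1 ++ [seq v - u | v <- s])
  = a (s1 ++ s) - \sum_(i < size s) a (s1 ++ take i s ++ u :: drop i.+1 s).
Proof.
move=> aa; elim: s s1 => [|v s IHs] s1 /=; first by rewrite big_ord0 subr0.
rewrite (alt_add _ _ _ _ aa) (alt_opp _ _ _ aa) -(cat_rcons v s1) IHs cat_rcons.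
rewrite (alt_sub_repeat s1 [::] s u aa) /= big_ord_recl /= drop0.
rewrite opprD addrA addrAC; congr (_ - _ - _).
by apply: eq_bigr => i _; rewrite cat_rcons.
Qed.

(** In the expansion of the differences, terms that contain [u] twice vanish; the sign comes from
    moving a single [u] to the front. It turns edge vectors of a simplex into its vertices, omitting
    one at a time. *)
Lemma alt_cone n k (a : covector R n) s u : alternating k a ->
  a [seq v - u | v <- s] = \sum_(j < (size s).+1) (-1) ^+ j * a (del j (u :: s)).
Proof.
move=> aa; rewrite -[LHS](congr1 a (cat0s _)) (alt_sub [::] _ _ aa) big_ord_recl.
rewrite expr0 mul1r; congr (_ + _); first by rewrite /del /= drop0.
rewrite -sumrN; apply: eq_bigr => i _.
have := antisym_catCA [::] (take i s) [:: u] (drop i.+1 s) (alt_antisym aa).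
rewrite /= => ->; rewrite muln1 size_takel 1?ltnW// exprS mulN1r mulNr.
by [].
Qed.

(* Despite the special role of the first vertex, this is antisymmetric in all the
   vertices. *)
Definition edgeval n (a : covector R n) (L : seq 'rV[R]_n) : R :=
  if L is x :: s then a [seq v - x | v <- s] else 0.

Lemma edgeval_antisym n k (a : covector R n) : alternating k a -> antisym (edgeval a).
Proof.
move=> aa [|z s1] x y s2 /=; last by rewrite !map_cat /= (alt_antisym aa).
rewrite -opprB (alt_opp [::] _ _ aa) /=; congr (- _).
rewrite -[RHS](alt_sub_repeat [::] [::] _ _ aa) -map_comp /=; congr (a (_ :: _)).
by apply: eq_map => v /=; rewrite opprB addrA subrK.
Qed.

Lemma int_refE m (w : form R m) : int_ref m w = Int (fun t => w t (ebasis (enum 'I_m))).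
Proof. by []. Qed.

Lemma rows_edges n m (s : seq 'rV[R]_n) : size s = m.+1 ->
  [seq u *m edges m s | u <- ebasis (enum 'I_m)] = [seq v - nth 0 s 0 | v <- behead s].
Proof.
case: s => [//|x s] [sz] /=; rewrite [in RHS](seq_enum 0 sz) -!map_comp; apply: eq_map => i /=.
by rewrite -rowE; apply/rowP => j; rewrite !mxE.
Qed.

Lemma pull_edgeval n m (s : seq 'rV[R]_n) (w : form R n) t : size s = m.+1 ->
  pull m s w t (ebasis (enum 'I_m)) = edgeval (w (nth 0 s 0 + t *m edges m s)) s.
Proof. by move=> sz; rewrite /pull rows_edges//; case: s sz. Qed.

Definition std n : seq 'rV[R]_n := 0 :: ebasis (enum 'I_n).

Lemma size_std n : size (std n) = n.+1.
Proof. by rewrite /= size_ebasis size_enum_ord. Qed.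

Lemma nth_ebasis n (i : 'I_n) : nth 0 (ebasis (enum 'I_n)) i = delta_mx 0 i :> 'rV[R]_n.
Proof. exact: nth_enum_map. Qed.

(** [stokes_fun] in direction j yields the coordinate face opposite to vertex j + 1 and an integral
    over the slanted face; the latter integrals add up to the whole term of the facet opposite to
    the origin. *)
Lemma stokes_ref m (w : form R m.+1) : polyform m w ->
  int_ref m.+1 (ext_d w)
  = \sum_(i < m.+2) (-1) ^+ i * int_ref m (pull m (del i (std m.+1)) w).
Proof.
move=> pw; have [aw _] := pw.
set E := @ebasis R _ (enum 'I_m.+1).
have szE : size E = m.+1 by rewrite size_ebasis size_enum_ord.
pose W (j : 'I_m.+1) x := w x (del j E).
have pW j : ispoly (W j) by exact: polyform_ispoly pw.
transitivity (\sum_(j < m.+1) (-1) ^+ j * (slant (W j) - Int (fun t => W j (insert0 j t)))).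
  rewrite int_refE /ext_d szE.
  transitivity (Int (fun t => \sum_(j < m.+1) (-1) ^+ j * pd j (W j) t)).
    congr Int; apply/funext => t; apply: eq_bigr => j _; congr (_ * _).
    by rewrite /E nth_ebasis.
  rewrite Int_sumZ => [|j]; last by apply: ispoly_continuous; exact: ispoly_derive.
  by apply: eq_bigr => j _; rewrite stokes_fun.
rewrite [RHS]big_ord_recl expr0 mul1r.
(* This facet is spanned by differences of basis vectors, on which [alt_cone] recovers the
   coefficients [W j]; its chart, based at the first basis vector, is [slantpt]. *)
have -> : int_ref m (pull m (del 0 (std m.+1)) w) = \sum_(j < m.+1) (-1) ^+ j * slant (W j).
  rewrite int_refE -(Int_sumZ (index_enum 'I_m.+1) (fun j : 'I_m.+1 => (-1) ^+ j)
    (F := fun j t => W j (slantpt t))) => [|j].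
    congr Int; apply/funext => t; rewrite pull_edgeval ?size_del ?size_std//.
    rewrite /del /= drop0 -/E.
    have -> : nth 0 E 0 + t *m edges m E = slantpt t.
      rewrite /E -[0%N]/(val (@ord0 m)) nth_ebasis.
      apply/rowP => i; rewrite !mxE /=.
      transitivity ((i == ord0)%:R + \sum_(l < m) (t 0 l * (lift ord0 l == i)%:R
            - t 0 l * (ord0 == i)%:R)).
        congr (_ + _); apply: eq_bigr => l _; rewrite !mxE -mulrBr.
        have -> : (l.+1 = val (lift ord0 l))%N by [].
        by rewrite nth_ebasis -[0%N]/(val (@ord0 m)) nth_ebasis !mxE eqxx /= ![i == _]eq_sym.
      have nl (l : 'I_m) : (lift ord0 l == ord0) = false.
        by rewrite eq_sym; exact: negbTE (neq_lift _ _).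
      case: unliftP => [k ->|->]; rewrite /oapp.
        rewrite nl add0r (bigD1 k)// eqxx mulr1 (eq_sym ord0) nl mulr0 subr0.
        rewrite big1 => [|l lk]; first by rewrite /= addr0.
        by rewrite (inj_eq lift_inj) (negbTE lk) !mulr0 subr0.
      rewrite eqxx -sumrN; congr (_ + _); apply: eq_bigr => l _.
      by rewrite nl mulr0 mulr1 sub0r.
    rewrite /W; clear pW W; clearbody E; case: E szE => [//|u s] [szs] /=.
    by rewrite (alt_cone _ _ (aw _)) szs.
  by apply: ispoly_continuous; apply: (ispoly_comp (pW j)) => i; exact: slantpt_ispoly.
(* The other facets contain the origin, and their charts are the maps [insert0 j]. The shift of the
   index by the origin accounts for the minus sign. *)
rewrite -big_split; apply: eq_bigr => j _ /=.
rewrite mulrBr; congr (_ + _); rewrite exprS mulN1r mulNr; congr (- (_ * _)).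
rewrite int_refE; congr Int; apply/funext => t.
have -> : del (lift ord0 j) (std m.+1) = 0 :: del j E by [].
rewrite pull_edgeval /=; last by rewrite size_del szE.
rewrite add0r /W; congr (w _ _); last first.
  by rewrite -[LHS]map_id; apply: eq_map => v; rewrite subr0.
apply/rowP => i; rewrite !mxE.
transitivity (\sum_(l < m) t 0 l * (lift j l == i)%:R).
  case: unliftP => [k ->|->]; rewrite /oapp.
    rewrite (bigD1 k)//= eqxx mulr1 big1 ?addr0// => l lk.
    by rewrite (inj_eq lift_inj) (negbTE lk) mulr0.
  by rewrite big1// => l _; rewrite eq_sym (negbTE (neq_lift _ _)) mulr0.
apply: eq_bigr => l _; congr (_ * _); rewrite !mxE /=.
rewrite nth_del ?szE// -[bump j l]/(val (lift j l)) nth_ebasis !mxE eqxx /= subr0.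
by rewrite eq_sym.
Qed.

Lemma pull_pull n m k (s : seq 'rV[R]_n) (p : seq 'rV[R]_m) (s' : seq 'rV[R]_n) (w : form R n) :
  (forall i, (i <= k)%N -> nth 0 s' i = nth 0 s 0 + nth 0 p i *m edges m s) ->
  pull k p (pull m s w) = pull k s' w.
Proof.
move=> h; apply/funext => t; apply/funext => us.
have eE : edges k p *m edges m s = edges k s'.
  apply/row_matrixP => i; rewrite row_mul.
  have -> : row i (edges k p) = nth 0 p i.+1 - nth 0 p 0 by apply/rowP => j; rewrite !mxE.
  have -> : row i (edges k s') = nth 0 s' i.+1 - nth 0 s' 0 by apply/rowP => j; rewrite !mxE.
  by rewrite !h// mulmxBl opprD addrACA subrr add0r.
rewrite /pull -map_comp; congr (w _ _).
  by rewrite mulmxDl addrA -h// -mulmxA eE.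
by apply: eq_map => u /=; rewrite -mulmxA eE.
Qed.

Lemma nth_std n (s : seq 'rV[R]_n) i : (i <= n)%N ->
  nth 0 s i = nth 0 s 0 + nth 0 (std n) i *m edges n s.
Proof.
case: i => [|i] ni /=; first by rewrite mul0mx addr0.
rewrite -[i]/(val (Ordinal ni)) nth_ebasis -rowE.
have -> : row (Ordinal ni) (edges n s) = nth 0 s i.+1 - nth 0 s 0.
  by apply/rowP => j; rewrite !mxE.
by rewrite addrC subrK.
Qed.

Lemma stokes_cell m (s : seq 'rV[R]_m.+1) (w : form R m.+1) : size s = m.+2 ->
  polyform m w ->
  int_ref m.+1 (pull m.+1 s (ext_d w))
  = \sum_(i < m.+2) (-1) ^+ i * int_ref m (pull m (del i s) w).
Proof.
move=> sz pw; rewrite pull_ext_d stokes_ref; last exact: pull_polyform.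
apply: eq_bigr => i _; congr (_ * int_ref _ _); apply: pull_pull => l lm.
rewrite !nth_del ?size_std ?sz//; apply: nth_std.
by rewrite /bump; case: (i <= l)%N; rewrite ?add1n ?add0n// (leq_trans lm).
Qed.

End Stokes.

(** * Dependence on the order of the vertices *)

Section Facets.
Context {R : realType}.
Implicit Types n m k : nat.

Lemma edgeval_dx n m (a : covector R n) (L : seq 'rV[R]_n) : size L = m.+1 ->
  alternating m a ->
  edgeval a L = \sum_(I : m.-tuple 'I_n) m`!%:R^-1 * a (ebasis I) * edgeval (dx I) L.
Proof.
case: L => [//|x s] [sz] aa /=.
rewrite (alt_dx (k := m) aa) ?size_map// mulr_sumr.
by apply: eq_bigr => I _; rewrite mulrA.
Qed.

Definition bary n N (L : seq 'rV[R]_n) (l : 'rV[R]_N) : 'rV[R]_n :=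
  \sum_i l 0 i *: nth 0 L i.

Lemma bary_slantpt n m (L : seq 'rV[R]_n) (t : 'rV[R]_m) :
  bary L (slantpt t) = nth 0 L 0 + t *m edges m L.
Proof.
rewrite /bary big_ord_recl mulmx_sum_row /slantpt mxE unlift_none /=.
rewrite scalerBl scale1r -addrA; congr (_ + _).
rewrite scaler_suml addrC -sumrB; apply: eq_bigr => i _.
rewrite mxE liftK /= -scalerBr; congr (_ *: _).
by apply/rowP => j; rewrite !mxE.
Qed.

Lemma bary_ispoly n N (L : seq 'rV[R]_n) (f : 'rV[R]_n -> R) : ispoly f ->
  ispoly (fun l : 'rV[R]_N => f (bary L l)).
Proof.
move=> pf; apply: (ispoly_comp pf) => i; rewrite /bary.
rewrite (_ : (fun t => _) = (fun t : 'rV[R]_N => \sum_(j < N) t 0 j * nth 0 L j 0 i)).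
  apply: ispoly_sum => j; apply: ispolyM; [exact: ispoly_coord|exact: ispoly_cst].
by apply/funext => t; rewrite summxE; apply: eq_bigr => j _; rewrite mxE.
Qed.

(** Separates an antisymmetric function of the vertices from an integral in barycentric coordinates,
    which is symmetric in them. *)
Lemma int_ref_pull n m (L : seq 'rV[R]_n) (w : form R n) : size L = m.+1 ->
  polyform m w ->
  int_ref m (pull m L w) = \sum_(I : m.-tuple 'I_n)
    (m`!%:R^-1 * edgeval (dx I) L) * slant (fun l : 'rV[R]_m.+1 => w (bary L l) (ebasis I)).
Proof.
move=> sz [aw pw]; rewrite int_refE.
rewrite -(Int_sumZ _ _ (F := fun (I : m.-tuple 'I_n) t => w (bary L (slantpt t)) (ebasis I))).
  congr Int; apply/funext => t; rewrite pull_edgeval// (edgeval_dx sz)//.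
  by apply: eq_bigr => I _; rewrite bary_slantpt mulrAC.
move=> I; apply: ispoly_continuous.
apply: (@ispoly_comp _ _ _ (fun l => w (bary L l) (ebasis I)) (@slantpt R m)).
  exact: (bary_ispoly _ L (pw I)).
by move=> i; exact: slantpt_ispoly.
Qed.

Lemma slant_bary_perm n m (L L' : seq 'rV[R]_n) (f : 'rV[R]_n -> R) :
  size L = m.+1 -> perm_eq L' L -> ispoly f ->
  slant (fun l : 'rV[R]_m.+1 => f (bary L' l)) = slant (fun l : 'rV[R]_m.+1 => f (bary L l)).
Proof.
move=> sz pL pf.
have /tuple_permP[s Es] : perm_eq L' (tcast sz (in_tuple L)) by rewrite val_tcast.
rewrite -(slant_perm s^-1%g (bary_ispoly _ L pf)); congr slant; apply/funext => l.
have nL' (i : 'I_m.+1) : nth 0 L' i = nth 0 L (s i).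
  by rewrite Es -tnth_nth tnth_mktuple (tnth_nth 0) val_tcast.
congr (f _); rewrite /bary [RHS](reindex_inj (@perm_inj _ s)); apply: eq_bigr => i _.
by rewrite mxE permK nL'.
Qed.

(** Reordering changes the integral by the sign of the permutation, which [D] compensates. [D] will
    be the sign of the side of the facet on which an apex lies. *)
Lemma int_ref_perm n m (L L' : seq 'rV[R]_n) (w : form R n) (D : seq 'rV[R]_n -> R) :
  size L = m.+1 -> perm_eq L' L -> polyform m w -> antisym D ->
  int_ref m (pull m L' w) * D L' = int_ref m (pull m L w) * D L.
Proof.
move=> sz pL pw aD; have sz' : size L' = m.+1 by rewrite (perm_size pL).
rewrite !int_ref_pull// !mulr_suml; apply: eq_bigr => I _.
rewrite (slant_bary_perm (f := fun x => w x (ebasis I)) sz pL); last by case: pw.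
rewrite -!mulrA [edgeval _ L' * _]mulrCA [edgeval _ L * _]mulrCA.
by rewrite (antisym_perm (edgeval_antisym (dx_alternating I)) aD pL).
Qed.

(* n! times the signed volume of an ordered simplex. *)
Definition orient n (L : seq 'rV[R]_n) : R := edgeval (dx (enum 'I_n)) L.

Arguments orient : simpl never.

Lemma dxenum_alternating n : alternating n (dx (enum 'I_n) : covector R n).
Proof. by have := dx_alternating (R := R) (enum 'I_n); rewrite size_enum_ord. Qed.

Lemma orient_antisym n : antisym (@orient n).
Proof. exact: edgeval_antisym (dxenum_alternating n). Qed.

Lemma det_edges n (L : seq 'rV[R]_n) : size L = n.+1 -> \det (edges n L) = orient L.
Proof.
case: L => [//|x s] [sz]; rewrite /orient /= /dx /gram size_map sz size_enum_ord eqxx.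
rewrite /detrows; congr (\det _); apply/matrixP => i j; rewrite !mxE /=.
by rewrite (nth_map 0) ?size_map ?sz// nth_enum_map (nth_map 0) ?sz// !mxE.
Qed.

Lemma orient_del n (s : seq 'rV[R]_n) i : (i < size s)%N ->
  orient (nth 0 s i :: del i s) = (-1) ^+ i * orient s.
Proof.
move=> si; have := antisym_catCA [::] (take i s) [:: nth 0 s i] (drop i.+1 s) (@orient_antisym n).
rewrite /= -drop_nth// cat_take_drop => ->.
by rewrite muln1 (size_takel (ltnW si)) mulrA -expr2 sqrr_sign mul1r.
Qed.

(** In the expansion [alt_cone] one term is free of the first vertex and is preserved because the
    coefficients sum to 1; the others are linear in this vertex. *)
Lemma orient_affine n (F : seq 'rV[R]_n) (J : finType) (c : J -> R) (u : J -> 'rV[R]_n) :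
  \sum_j c j = 1 ->
  orient ((\sum_j c j *: u j) :: F) = \sum_j c j * orient (u j :: F).
Proof.
move=> c1; have aa := dxenum_alternating n.
rewrite /orient /=; under [in RHS]eq_bigr do rewrite (alt_cone _ _ aa) mulr_sumr.
rewrite (alt_cone _ _ aa) exchange_big; apply: eq_bigr => i _ /=.
transitivity (\sum_j (-1) ^+ i * (c j * dx (enum 'I_n) (del i (u j :: F)))); last first.
  by apply: eq_bigr => j _; rewrite mulrCA.
rewrite -mulr_sumr; congr (_ * _); case: i => [[|i] iF].
  by rewrite /del /= -mulr_suml c1 mul1r.
exact: (alt_sum [::] _ _ _ aa).
Qed.

Lemma orient_mem n (F : seq 'rV[R]_n) u : u \in F -> orient (u :: F) = 0.
Proof.
move=> uF; rewrite (antisym_notuniq (@orient_antisym n))//= uF //.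
Qed.

(** Several members of the family may be the same vertex, so the coefficients are collected
    according to their index in [s]. *)
Lemma hull_mem n (s : seq 'rV[R]_n) (J : finType) (a : J -> R) (u : J -> 'rV[R]_n) :
  (forall j, 0 <= a j) -> \sum_j a j = 1 -> (forall j, u j \in s) ->
  hull s (\sum_j a j *: u j).
Proof.
move=> a0 a1 us.
have iu j : (index (u j) s < size s)%N by rewrite index_mem.
exists (fun k : 'I_(size s) => \sum_(j | Ordinal (iu j) == k) a j); split.
- by move=> k; apply: sumr_ge0.
- rewrite -[RHS]a1 [RHS](partition_big (fun j => Ordinal (iu j)) xpredT)//=.
- rewrite (partition_big (fun j => Ordinal (iu j)) xpredT)//=; apply: eq_bigr => k _.
  rewrite scaler_suml; apply: eq_bigr => j /eqP <-.
  by rewrite /= nth_index.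
Qed.

End Facets.
Arguments orient : simpl never.

(** * Facets of the mesh *)

Section MeshGeometry.
Context {R : realType} {n : nat} (T : mesh R n.+1).
Implicit Types f : cell T * 'I_n.+2.

Definition apex f : 'rV[R]_n.+1 := nth 0 (vertices f.1) f.2.

Lemma size_facet f : size (facet f) = n.+1.
Proof. by rewrite /facet size_del size_tuple. Qed.

Lemma orient_vertices c : orient (vertices (m := T) c) != 0.
Proof.
rewrite -det_edges ?size_tuple// -unitfE -unitmxE.
exact: mesh_nondegenerate.
Qed.

Lemma orient_apex f : orient (apex f :: facet f) = (-1) ^+ f.2 * orient (vertices f.1).
Proof. by rewrite /apex /facet orient_del// size_tuple. Qed.

Lemma orient_apex_neq0 f : orient (apex f :: facet f) != 0.
Proof. by rewrite orient_apex mulf_neq0 ?signr_eq0 ?orient_vertices. Qed.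

Lemma perm_apex_facet f : perm_eq (apex f :: facet f) (vertices f.1).
Proof.
rewrite /apex /facet /del -[X in perm_eq _ X](cat_take_drop f.2).
rewrite (drop_nth 0 (n := f.2)) ?size_tuple// -cat1s -(cat1s _ (drop _ _)).
by rewrite perm_catCA.
Qed.

Lemma uniq_vertices c : uniq (vertices (m := T) c).
Proof.
apply: contraNT (orient_vertices c) => h.
by rewrite (antisym_notuniq (@orient_antisym R _) h).
Qed.

Lemma facet_same_cell f f' : f.1 = f'.1 -> perm_eq (facet f) (facet f') -> f = f'.
Proof.
case: f f' => [c i] [d j] /= -> {c} pF; congr (_, _).
have ud := uniq_vertices d.
have : apex (d, i) = apex (d, j).
  have ui : uniq (apex (d, i) :: facet (d, i)) by rewrite (perm_uniq (perm_apex_facet (d, i))).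
  have : apex (d, i) \in apex (d, j) :: facet (d, j).
    rewrite (perm_mem (perm_apex_facet (d, j))) -(perm_mem (perm_apex_facet (d, i))).
    by rewrite inE eqxx.
  rewrite inE => /predU1P[//|]; rewrite -(perm_mem pF).
  by move: ui => /= /andP[/negbTE ->].
move=> /eqP; rewrite /apex /= nth_uniq ?size_tuple// => /eqP ij.
exact: val_inj.
Qed.

(** The apex of [f] is not a vertex of the other cell, since otherwise both cells would have the
    same vertices. Conformity then confines the intersection of the cells to the hull of the facet,
    where the orientation relative to the facet is 0. *)
Lemma opposite_sides f f' : perm_eq (facet f) (facet f') -> f.1 != f'.1 ->
  orient (apex f :: facet f) * orient (apex f' :: facet f) < 0.
Proof.
move=> pF ne; set F := facet f; set x := apex f; set y := apex f'.
have szF : size F = n.+1 by exact: size_facet.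
have px : perm_eq (x :: F) (vertices f.1) by exact: perm_apex_facet.
have py : perm_eq (y :: F) (vertices f'.1).
  by apply: perm_trans (perm_apex_facet f'); rewrite perm_cons.
have ox : orient (x :: F) != 0 by exact: orient_apex_neq0.
have oy : orient (y :: F) != 0.
  have ua : uniq (y :: F) by rewrite (perm_uniq py) uniq_vertices.
  have := antisym_perm (@orient_antisym R _) (@orient_antisym R _) py.
  apply: contra_eq_neq => ->; rewrite mul0r eq_sym mulf_neq0//; exact: orient_vertices.
have ux : x \notin F.
  by have := uniq_vertices f.1; rewrite -(perm_uniq px) /= => /andP[].
have xd : x \notin (vertices f'.1 : seq _).
  rewrite -(perm_mem py) inE negb_or ux andbT; apply: contra ne => /eqP xy.
  apply/eqP; apply: (mesh_distinct (m := T)).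
  by apply: perm_trans py; rewrite perm_sym -xy.
rewrite lt_neqAle mulf_neq0//= leNgt; apply/negP => pos.
pose A := edges n.+1 (y :: F).
have uA : A \in unitmx by rewrite unitmxE unitfE det_edges /= ?szF.
pose mu := (x - y) *m invmx A.
have Ex : x = (1 - \sum_k mu 0 k) *: y + \sum_k mu 0 k *: nth 0 F k.
  have : x - y = mu *m A by rewrite mulmxKV.
  rewrite mulmx_sum_row => /eqP; rewrite subr_eq => /eqP ->.
  rewrite scalerBl scale1r scaler_suml addrC -addrA; congr (_ + _).
  rewrite addrC -sumrB; apply: eq_bigr => k _; rewrite -scalerBr; congr (_ *: _).
  by apply/rowP => j; rewrite !mxE.
set l0 := 1 - \sum_k mu 0 k in Ex.
have oF (k : 'I_n.+1) : orient (nth 0 F k :: F) = 0.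
  by apply: orient_mem; rewrite mem_nth ?szF.
(* If both apexes lay on the same side of F, a point between the barycenter
   of F and the apex of f would lie in both simplices but not in the hull of F.
   Points are described by their coefficients on a vertex v and on F. *)
pose pt (v : 'rV[R]_n.+1) (a : option 'I_n.+1 -> R) :=
  \sum_j a j *: oapp (fun k : 'I_n.+1 => nth 0 F k) v j.
have sum_opt (E : nmodType) (a : option 'I_n.+1 -> E) :
    \sum_j a j = a None + \sum_k a (Some k).
  rewrite (bigD1 None)//=; congr (_ + _).
  rewrite (reindex_omap Some id)//=; last by case.
  by apply: eq_bigl => k; rewrite eqxx.
have opt v a : \sum_j a j = 1 -> orient (pt v a :: F) = a None * orient (v :: F).
  move=> a1; rewrite orient_affine// sum_opt /= big1 ?addr0// => k _.
  by rewrite oF mulr0.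
pose a0 j : R := oapp (fun k => mu 0 k) l0 j.
have a0s : \sum_j a0 j = 1 by rewrite sum_opt /= /l0 subrK.
have xE : x = pt y a0 by rewrite /pt sum_opt.
(* [l0] is the ratio of the orientations of [x] and [y] relative to F. *)
have l0_gt0 : 0 < l0.
  move: pos; rewrite [x in orient (x :: F) * _]xE opt// -mulrA pmulr_lgt0//.
  by rewrite -expr2 exprn_even_gt0.
pose N : R := n.+1%:R.
have N0 : 0 < N by rewrite ltr0n.
pose S := \sum_k `|mu 0 k|.
have S0 : 0 <= S by apply: sumr_ge0.
have muS k : `|mu 0 k| <= S.
  by rewrite /S (bigD1 k)//= lerDl sumr_ge0.
(* Chosen such that (1 - e) / N = e S, which bounds e |mu_k|; this makes the coefficients in [a2]
   nonnegative. *)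
pose e := (1 + N * S)^-1.
have d0 : 0 < 1 + N * S by rewrite ltr_pwDl// mulr_ge0// ltW.
have e0 : 0 < e by rewrite invr_gt0.
have eE : e * (1 + N * S) = 1 by rewrite mulVf// gt_eqF.
have e1 : e <= 1 by rewrite invf_le1// lerDl mulr_ge0// ltW.
(* The same point twice: [a1] are its coefficients on [x] and F, [a2] those on [y] and F. *)
pose a1 (j : option 'I_n.+1) : R := oapp (fun=> (1 - e) / N) e j.
pose a2 j : R := oapp (fun k => (1 - e) / N + e * mu 0 k) (e * l0) j.
have sN : \sum_(k < n.+1) (1 - e) / N = 1 - e.
  by rewrite sumr_const card_ord -mulr_natr divfK// gt_eqF.
have a1s : \sum_j a1 j = 1 by rewrite sum_opt /= sN addrC subrK.
have a2s : \sum_j a2 j = 1.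
  rewrite sum_opt /= big_split /= sN -mulr_sumr /l0; ring.
have zE : pt x a1 = pt y a2.
  rewrite /pt !sum_opt /= Ex scalerDr !scalerA -addrA; congr (_ + _).
  rewrite scaler_sumr -big_split /=; apply: eq_bigr => k _.
  by rewrite scalerA -scalerDl addrC.
have hc : hull (vertices f.1) (pt x a1).
  apply: hull_mem => // [[k|]|[k|]] /=.
  - by rewrite divr_ge0 ?subr_ge0// ltW.
  - exact: ltW.
  - by rewrite -(perm_mem px) inE mem_nth ?orbT// szF.
  - by rewrite -(perm_mem px) inE eqxx.
have hd : hull (vertices f'.1) (pt x a1).
  rewrite zE; apply: hull_mem => // [[k|]|[k|]] /=.
  - rewrite -(pmulr_lge0 _ N0) mulrDl divfK ?gt_eqF//.
    have h1 : - mu 0 k <= S by apply: le_trans (muS k); rewrite -normrN ler_norm.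
    have h2 : e * N * (- mu 0 k) <= e * N * S by rewrite ler_wpM2l// mulr_ge0// ltW.
    by move: eE; rewrite mulrDr mulr1 mulrA => eE; lra.
  - by rewrite mulr_ge0// ltW.
  - by rewrite -(perm_mem py) inE mem_nth ?orbT// szF.
  - by rewrite -(perm_mem py) inE eqxx.
have [b [b0 b1 zb]] : hull [seq v <- vertices f.1 | v \in (vertices f'.1 : seq _)] (pt x a1).
  by rewrite -(mesh_conforming (m := T)).
have : orient (pt x a1 :: F) = 0.
  rewrite zb orient_affine// big1// => i _.
  rewrite orient_mem ?mulr0//.
  have := mem_nth 0 (ltn_ord i); set v := nth _ _ _; rewrite mem_filter => /andP[vd].
  rewrite -(perm_mem px) inE => /predU1P[vx|//].
  by move: xd; rewrite -vx vd.
by apply/eqP; rewrite opt// mulf_neq0//= gt_eqF.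
Qed.

End MeshGeometry.

(** * Definiteness of the inner product *)

Section Retraction.
Context {R : realType} {m : nat}.

(* The metric is controlled on M only: precomposing with this retraction onto the
   standard simplex makes the densities continuous everywhere. *)
Definition retr (t : 'rV[R]_m) : 'rV[R]_m :=
  (Num.max 1 (\sum_i Num.max (t 0 i) 0))^-1 *: \row_i Num.max (t 0 i) 0.

Lemma retr_den_gt0 (t : 'rV[R]_m) : 0 < Num.max 1 (\sum_i Num.max (t 0 i) 0).
Proof. by rewrite lt_max ltr01. Qed.

Lemma retr_inS t : inS (retr t).
Proof.
have d0 := retr_den_gt0 t; split => [i|].
  by rewrite !mxE mulr_ge0 ?invr_ge0 ?(ltW d0)// le_max lexx orbT.
under eq_bigr do rewrite !mxE.
by rewrite -mulr_sumr mulrC ler_pdivrMr// mul1r le_max lexx orbT.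
Qed.

Lemma retr_id t : inS t -> retr t = t.
Proof.
move=> [t0 t1]; have E i : Num.max (t 0 i) 0 = t 0 i by apply/max_idPl.
rewrite /retr; under eq_bigr do rewrite E.
have -> : Num.max 1 (\sum_i t 0 i) = 1 by apply/max_idPl.
by rewrite invr1 scale1r; apply/rowP => i; rewrite mxE E.
Qed.

Lemma retr_continuous : continuous retr.
Proof.
move=> t.
have cm i : {for t, continuous (fun t : 'rV[R]_m => Num.max (t 0 i) 0)}.
  by apply: continuous_max; [exact: coord_continuous|exact: cst_continuous].
apply: continuous_to_rV => i.
rewrite (_ : (fun z => _) = (fun t : 'rV[R]_m =>
   (Num.max 1 (\sum_i Num.max (t 0 i) 0))^-1 * Num.max (t 0 i) 0)); last first.
  by apply/funext => z; rewrite !mxE.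
apply: (@continuousM R _ (fun t : 'rV[R]_m =>
   (Num.max 1 (\sum_i Num.max (t 0 i) 0))^-1)); last exact: cm.
apply: (@continuousV R _ (fun t : 'rV[R]_m => Num.max 1 (\sum_i Num.max (t 0 i) 0))).
  by rewrite gt_eqF// retr_den_gt0.
apply: (@continuous_max _ _ (fun=> 1)); first exact: cst_continuous.
exact: continuous_big_sum.
Qed.

Definition continuous_on_simplex (f : 'rV[R]_m -> R) : Prop :=
  forall t, inS t -> {for t, continuous f}.

Lemma retr_comp_continuous f : continuous_on_simplex f ->
  continuous (fun t => f (retr t)).
Proof.
move=> cf t; apply: (@continuous_comp _ _ _ retr f); first exact: retr_continuous.
by apply: cf; exact: retr_inS.
Qed.

Lemma Int_retr f : Int (fun t => f (retr t)) = Int f.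
Proof. by apply: eq_Int => t /retr_id ->. Qed.

Lemma IntD_on f g : continuous_on_simplex f -> continuous_on_simplex g ->
  Int (fun t => f t + g t) = Int f + Int g.
Proof.
move=> /retr_comp_continuous cf /retr_comp_continuous cg.
by rewrite -(Int_retr (fun t => f t + g t)) IntD// !Int_retr.
Qed.

Lemma IntZ_on f c : continuous_on_simplex f -> Int (fun t => c * f t) = c * Int f.
Proof.
move=> /retr_comp_continuous cf.
by rewrite -(Int_retr (fun t => c * f t)) IntZ// Int_retr.
Qed.

Lemma Int_eq0_on f : continuous_on_simplex f -> (forall t, inS t -> 0 <= f t) ->
  Int f = 0 -> forall t, inS t -> f t = 0.
Proof.
move=> /retr_comp_continuous cf f0; rewrite -Int_retr => If t St.
rewrite -(retr_id St); apply: (Int_ge0_eq0 cf _ If) => // u _.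
by apply: f0; exact: retr_inS.
Qed.

Lemma Int_ge0 (f : 'rV[R]_m -> R) : (forall t, inS t -> 0 <= f t) -> 0 <= Int f.
Proof.
by move=> f0; apply: int_std_ge0 => // ts h; apply: f0; exact: in_simplex_rowof.
Qed.

End Retraction.

(** * Continuity and definiteness of the metric density *)

Section MetricContinuity.
Context {R : realType} {n : nat}.
Implicit Types (X : topologicalType).

Lemma continuous_det X k (h : X -> 'M[R]_k) x :
  (forall i j, {for x, continuous (fun y => h y i j)}) ->
  {for x, continuous (fun y => \det (h y))}.
Proof.
move=> ch; rewrite /determinant; apply: continuous_big_sum => s.
apply: (@continuousM R _ (fun=> (-1) ^+ s)); first exact: cst_continuous.
by apply: continuous_big_prod => i; exact: ch.
Qed.

Lemma continuous_adj X k (h : X -> 'M[R]_k) x i j :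
  (forall i j, {for x, continuous (fun y => h y i j)}) ->
  {for x, continuous (fun y => (\adj (h y)) i j)}.
Proof.
move=> ch; rewrite (_ : (fun y => _) =
  (fun y => (-1) ^+ (j + i) * \det (row' j (col' i (h y))))); last first.
  by apply/funext => y; rewrite mxE.
apply: (@continuousM R _ (fun=> (-1) ^+ (j + i))); first exact: cst_continuous.
apply: continuous_det => i' j'.
rewrite (_ : (fun y => _) = (fun y => h y (lift j i') (lift i j')))//.
by apply/funext => y; rewrite !mxE.
Qed.

Lemma riemannian_continuous M (g : 'rV[R]_n -> 'M[R]_n) x i j :
  riemannian_metric M g -> M x -> {for x, continuous (fun y => g y i j)}.
Proof.
move=> [[U [_ MU] sm] _ _] Mx.
by have := sm i j [::] x (MU _ Mx); exact: differentiable_continuous.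
Qed.

Lemma riemannian_posdef M (g : 'rV[R]_n -> 'M[R]_n) x :
  riemannian_metric M g -> M x -> posdef (g x).
Proof. by move=> [_ sy po] Mx; split; [exact: sy|move=> v; exact: po]. Qed.

(* By Cramer's rule, the entries depend continuously on G when \det G != 0. *)
Definition ginv (G : 'M[R]_n) : 'M[R]_n := (\det G)^-1 *: \adj G.

Lemma ginvE G : posdef G -> invmx G = ginv G.
Proof.
by move=> /posdef_det G0; rewrite /invmx unitmxE unitfE gt_eqF.
Qed.

(* The density of (a , b)_M with respect to the Lebesgue measure, up to
   the factor k!. *)
Definition density k (g : 'rV[R]_n -> 'M[R]_n) (a b : form R n) x : R :=
  Num.sqrt (\det (g x)) * \sum_(I : k.-tuple 'I_n) a x (ebasis I) *
    \sum_(J : k.-tuple 'I_n) (\prod_(q <- zip I J) ginv (g x) q.1 q.2) * b x (ebasis J).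

Lemma densityE k M (g : 'rV[R]_n -> 'M[R]_n) (a b : form R n) x :
  riemannian_metric M g -> M x -> alternating k (b x) ->
  density k g a b x = Num.sqrt (\det (g x)) *
    \sum_(I : k.-tuple 'I_n) a x (ebasis I) * b x [seq row i (invmx (g x)) | i <- I].
Proof.
move=> hg Mx ab; congr (_ * _); apply: eq_bigr => I _; congr (_ * _).
rewrite (ginvE (riemannian_posdef hg Mx)).
have -> : [seq row i (ginv (g x)) | i <- I]
   = [seq \sum_j ginv (g x) t j *: delta_mx 0 j | t <- I].
  by apply: eq_map => i; rewrite [LHS]row_sum_delta; apply: eq_bigr => j _; rewrite mxE.
have := alt_family [::] (fun t j => ginv (g x) t j) (fun j => delta_mx 0 j) I ab.
by rewrite /= size_tuple => ->.
Qed.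

Lemma density_continuous k M (g : 'rV[R]_n -> 'M[R]_n) (a b : form R n) x :
  riemannian_metric M g -> M x -> polyform k a -> polyform k b ->
  {for x, continuous (density k g a b)}.
Proof.
move=> hg Mx [_ pa] [_ pb].
have cg i j : {for x, continuous (fun y => g y i j)} by exact: riemannian_continuous hg Mx.
have cd := continuous_det cg.
have d0 : \det (g x) != 0 by rewrite gt_eqF// posdef_det//; exact: riemannian_posdef hg Mx.
rewrite /density.
apply: (@continuousM R _ (fun x => Num.sqrt (\det (g x)))).
  by apply: (@continuous_comp _ _ _ (fun x => \det (g x)) Num.sqrt) => //; exact: sqrt_continuous.
apply: continuous_big_sum => I.
apply: (@continuousM R _ (fun x => a x (ebasis I))); first exact: ispoly_continuous.
apply: continuous_big_sum => J.
apply: (@continuousM R _ (fun x => \prod_(q <- zip I J) ginv (g x) q.1 q.2)); last first.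
  exact: ispoly_continuous.
apply: continuous_big_prod => q.
rewrite /ginv (_ : (fun y => _) = (fun y => (\det (g y))^-1 * (\adj (g y)) q.1 q.2)); last first.
  by apply/funext => y; rewrite mxE.
apply: (@continuousM R _ (fun y => (\det (g y))^-1)); last exact: continuous_adj.
exact: (@continuousV R _ (fun y => \det (g y))).
Qed.

Lemma densityD k (g : 'rV[R]_n -> 'M[R]_n) (a b1 b2 : form R n) c x :
  density k g a (b1 + c *: b2) x = density k g a b1 x + c * density k g a b2 x.
Proof.
rewrite /density mulrCA -mulrDr; congr (_ * _).
rewrite mulr_sumr -big_split; apply: eq_bigr => I _ /=.
rewrite mulrCA -mulrDr; congr (_ * _).
rewrite mulr_sumr -big_split; apply: eq_bigr => J _ /=.
rewrite -[(b1 + c *: b2) x (ebasis J)]/(b1 x (ebasis J) + c * b2 x (ebasis J)).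
by rewrite mulrDr mulrCA.
Qed.

Lemma density_ge0 k M (g : 'rV[R]_n -> 'M[R]_n) (a : form R n) x :
  riemannian_metric M g -> M x -> alternating k (a x) -> 0 <= density k g a a x.
Proof.
move=> hg Mx aa; rewrite (densityE _ hg Mx aa) mulr_ge0 ?sqrtr_ge0//.
by have [] := alt_norm_ge0 (riemannian_posdef hg Mx) aa.
Qed.

Lemma density_eq0 k M (g : 'rV[R]_n -> 'M[R]_n) (a : form R n) x :
  riemannian_metric M g -> M x -> alternating k (a x) -> density k g a a x = 0 ->
  a x = fun _ => 0.
Proof.
move=> hg Mx aa; rewrite (densityE _ hg Mx aa) => /eqP.
have pg := riemannian_posdef hg Mx.
rewrite mulf_eq0 gt_eqF ?sqrtr_gt0 ?posdef_det//= => /eqP.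
by have [_] := alt_norm_ge0 pg aa.
Qed.

End MetricContinuity.

(** * From weak to strong equations *)

Section Energy.
Context {R : realType} {n : nat} (T : mesh R n) (M : set 'rV[R]_n).
Context (hM : triangulates T M) (g : 'rV[R]_n -> 'M[R]_n).
Context (hg : riemannian_metric M g) (o : cell T -> bool).

Definition chart (c : cell T) (t : 'rV[R]_n) : 'rV[R]_n :=
  nth 0 (vertices c) 0 + t *m edges n (vertices c).

Lemma chart_in c t : inS t -> M (chart c t).
Proof.
move=> [t0 t1]; rewrite hM; exists c; rewrite /chart -bary_slantpt /bary.
apply: hull_mem => [i||i].
- by rewrite mxE; case: unliftP => [k _|_] /=; [exact: t0|rewrite subr_ge0].
- rewrite big_ord_recl mxE unlift_none /= [X in _ + X](_ : _ = \sum_i t 0 i) ?subrK//.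
  by apply: eq_bigr => i _; rewrite mxE liftK.
- by rewrite mem_nth// size_tuple.
Qed.

Lemma chart_continuous c : continuous (chart c).
Proof.
move=> t; apply: continuous_to_rV => i.
apply: (ispoly_continuous (f := fun t => chart c t 0 i)).
rewrite (_ : (fun t => _) = (fun t : 'rV[R]_n =>
   nth 0 (vertices c) 0 0 i + \sum_(j < n) t 0 j * edges n (vertices c) j i)).
  apply: ispolyD; first exact: ispoly_cst.
  apply: ispoly_sum => j; apply: ispolyM; [exact: ispoly_coord|exact: ispoly_cst].
by apply/funext => u; rewrite !mxE.
Qed.

Lemma density_chart_continuous k (a b : form R n) c : polyform k a -> polyform k b ->
  continuous_on_simplex (fun t => density k g a b (chart c t)).
Proof.
move=> pa pb t St; apply: (@continuous_comp _ _ _ (chart c) (density k g a b)).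
  exact: chart_continuous.
exact: density_continuous hg (chart_in c St) pa pb.
Qed.

(** The orientation occurs both in the Hodge star and in the sign of the cell and cancels; the sign
    of the determinant turns the determinant into its absolute value. Every cell thus gets a
    positive weight. *)
Lemma inner_density k (a b : mform T) : (k <= n)%N ->
  (forall c, polyform k (a c)) -> (forall c, polyform k (b c)) ->
  inner_M o g a b = \sum_c `|\det (edges n (vertices c))| / k`!%:R *
    Int (fun t => density k g (a c) (b c) (chart c t)).
Proof.
move=> kn pa pb; apply: eq_bigr => c _.
set E := edges n (vertices c).
rewrite int_refE (@eq_Int _ _ _ (fun t => ((-1) ^+ o c * \det E / k`!%:R)
   * density k g (a c) (b c) (chart c t))); last first.
  move=> t St; rewrite /pull -/(chart c t).
  have [aa _] := pa c; have [ab _] := pb c.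
  rewrite (densityE _ hg (chart_in c St) (ab _)).
  have -> : [seq u *m E | u <- ebasis (enum 'I_n)] = [seq row i E | i <- enum 'I_n].
    by rewrite /ebasis -map_comp; apply: eq_map => i /=; rewrite rowE.
  rewrite (wedge_hodge (g (chart c t)) (o c) E kn (aa _) (ab _)).
  have mulE (x y z u v : R) : x * y * z / u * v = x * z / u * (y * v) by ring.
  exact: mulE.
rewrite IntZ_on; last exact: density_chart_continuous.
rewrite mulrA; congr (_ * _); rewrite /cell_sign -/E normrEsg.
have mulE (x y z u : R) : x * x = 1 -> x * y * (x * z / u) = y * z / u.
  move=> x1; have -> : x * y * (x * z / u) = x * x * (y * z / u) by ring.
  by rewrite x1 mul1r.
by apply: mulE; rewrite -expr2 sqrr_sign.
Qed.

Lemma FE_polyform s k (w : mform T) c : FE s k w -> polyform k (w c).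
Proof. by move=> [tw _]; exact: trimmed_polyform (tw c). Qed.

Lemma FED s k (w1 w2 : mform T) c : FE s k w1 -> FE s k w2 ->
  FE s k (fun d => w1 d + c *: w2 d).
Proof.
move=> [t1 p1] [t2 p2]; split => [d|f f' ff].
  by apply: trimmed_formD => //; exact: trimmed_formZ.
apply/funext => t; apply/funext => us.
have := congr1 (fun F => F t us) (p1 _ _ ff); have := congr1 (fun F => F t us) (p2 _ _ ff).
rewrite /pull => e2 e1.
rewrite -[LHS]/(w1 f.1 _ _ + c * w2 f.1 _ _) -[RHS]/(w1 f'.1 _ _ + c * w2 f'.1 _ _).
by rewrite e1 e2.
Qed.

Lemma FEZ s k (w : mform T) c : FE s k w -> FE s k (fun d => c *: w d).
Proof.
move=> [t1 p1]; split => [d|f f' ff]; first exact: trimmed_formZ.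
apply/funext => t; apply/funext => us.
have := congr1 (fun F => F t us) (p1 _ _ ff); rewrite /pull => e1.
by rewrite -[LHS]/(c * w f.1 _ _) -[RHS]/(c * w f'.1 _ _) e1.
Qed.

Lemma FE_dh s k (w : mform T) : FE s k w -> FE s k.+1 (dh w).
Proof.
move=> [tw pw]; split => [c|f f' ff]; first exact: ext_d_trimmed.
by rewrite /dh !pull_ext_d (pw _ _ ff).
Qed.

Lemma FE_weak_eq s k (w1 w2 : mform T) : (k <= n)%N -> FE s k w1 -> FE s k w2 ->
  (forall v : mform T, FE s k v -> inner_M o g v w1 = inner_M o g v w2) ->
  forall c t, inS t -> w1 c (chart c t) = w2 c (chart c t).
Proof.
move=> kn F1 F2 weak.
pose u : mform T := fun c => w1 c + -1 *: w2 c.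
have Fu : FE s k u by exact: FED.
have pF (w : mform T) : FE s k w -> forall c, polyform k (w c).
  by move=> Fw c; exact: FE_polyform c Fw.
have pu := pF _ Fu; have p1 := pF _ F1; have p2 := pF _ F2.
have := weak _ Fu; rewrite !(inner_density kn)// => /eqP; rewrite -subr_eq0 -sumrB.
pose dE c := `|\det (edges n (vertices (m := T) c))| / k`!%:R.
have dE_gt0 c : 0 < dE c.
  rewrite divr_gt0 ?ltr0n ?fact_gt0// normr_gt0 -unitfE -unitmxE.
  exact: mesh_nondegenerate.
rewrite (eq_bigr (fun c => dE c * Int (fun t => density k g (u c) (u c) (chart c t)))); last first.
  move=> c _; rewrite -mulrBr; congr (_ * _).
  have -> : (fun t => density k g (u c) (u c) (chart c t))
     = (fun t => density k g (u c) (w1 c) (chart c t)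
               + -1 * density k g (u c) (w2 c) (chart c t)).
    by apply/funext => t; rewrite {2}/u densityD.
  have cc b : polyform k b ->
      continuous_on_simplex (fun t => density k g (u c) b (chart c t)).
    by move=> pb; exact: density_chart_continuous.
  rewrite IntD_on ?IntZ_on ?mulN1r//; try exact: cc.
  move=> t St; apply: (@continuousM R _ (fun=> -1)); first exact: cst_continuous.
  exact: (cc _ (p2 c) t St).
have ge0 c t : inS t -> 0 <= density k g (u c) (u c) (chart c t).
  by move=> St; apply: density_ge0 hg (chart_in c St) _; case: (pu c).
(* The energy of the difference [u] is a sum of nonnegative contributions of the cells, so each of
   them vanishes. *)
rewrite psumr_eq0 => [/allP z c t St|c _]; last first.
  by rewrite mulr_ge0 ?(ltW (dE_gt0 c))//; apply: Int_ge0; exact: ge0.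
have := z c (mem_index_enum c); rewrite /= mulf_eq0 gt_eqF//= => /eqP Iz.
have d0 : density k g (u c) (u c) (chart c t) = 0.
  by apply: (Int_eq0_on _ _ Iz) => //; [exact: density_chart_continuous|exact: ge0].
have uz := density_eq0 hg (chart_in c St) (proj1 (pu c) _) d0.
apply/funext => vs; have := congr1 (fun F => F vs) uz.
rewrite -[u c (chart c t) vs]/(w1 c (chart c t) vs + -1 * w2 c (chart c t) vs).
by rewrite mulN1r => /eqP; rewrite subr_eq0 => /eqP.
Qed.

End Energy.

(** * Stokes' theorem on the mesh *)

Section MeshStokes.
Context {R : realType} {m : nat} (T : mesh R m.+1) (o : cell T -> bool).
Context (ho : orientation o).
Implicit Types f : cell T * 'I_m.+2.

Definition conforming (w : mform T) : Prop := forall f f',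
  perm_eq (facet f) (facet f') -> pull m (facet f) (w f.1) = pull m (facet f) (w f'.1).

Definition facet_term (w : mform T) f : R :=
  (-1) ^+ f.2 * cell_sign o f.1 * int_ref m (pull m (facet f) (w f.1)).

(** The sign (-1)^i of the omitted vertex and the sign of the cell combine into the side of the
    facet on which the apex lies, which can be compared between two cells. *)
Lemma facet_termE w f : facet_term w f = (-1) ^+ o f.1 *
  (int_ref m (pull m (facet f) (w f.1)) * Num.sg (orient (apex f :: facet f))).
Proof.
rewrite /facet_term /cell_sign det_edges ?size_tuple// orient_apex sgrM.
rewrite sgrX sgrN1.
by rewrite mulrCA -!mulrA; congr (_ * _); rewrite mulrA mulrC.
Qed.

(** The same facet seen from another cell; the default [f] is taken at boundary facets. *)
Definition partner f : cell T * 'I_m.+2 :=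
  odflt f [pick f' | perm_eq (facet f) (facet f') & f'.1 != f.1].

Lemma partnerP f : ~~ boundary_facet f ->
  perm_eq (facet f) (facet (partner f)) /\ (partner f).1 != f.1.
Proof.
rewrite negb_forall => /existsP[f']; rewrite negb_imply => /andP[pf ne].
rewrite /partner; case: pickP => [f'' /andP[] //|/(_ f')].
by rewrite pf ne.
Qed.

Lemma partner_interior f : ~~ boundary_facet f -> ~~ boundary_facet (partner f).
Proof.
move=> /partnerP [pf ne]; rewrite negb_forall; apply/existsP; exists f.
by rewrite negb_imply perm_sym pf eq_sym.
Qed.

(** A facet belongs to at most two cells: three apexes cannot lie pairwise on opposite sides of
    it. *)
Lemma partnerK f : ~~ boundary_facet f -> partner (partner f) = f.
Proof.
move=> intf; have [pf ne] := partnerP intf.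
have [pg neg] := partnerP (partner_interior intf).
set g := partner f in pf ne pg neg *; set h := partner g in pg neg *.
have ph : perm_eq (facet f) (facet h) by exact: perm_trans pf pg.
apply/esym; apply: (facet_same_cell _ ph).
apply/eqP; apply: contraT => nfh.
have o1 := opposite_sides pf; have o2 := opposite_sides ph; have o3 := opposite_sides pg.
have {}o1 := o1 _; have {}o2 := o2 nfh.
rewrite eq_sym in ne; have {}o1 := o1 ne.
rewrite eq_sym in neg; have {}o3 := o3 neg.
have cons_antisym (x : 'rV[R]_m.+1) : antisym (fun L => orient (x :: L)).
  by move=> s1 y z s2; rewrite -!cat_cons orient_antisym.
(* The sides of the apexes of [g] and [h] were compared along the facet as [g] lists it; this passes
   to the list of [f]. *)
have := antisym_perm (cons_antisym (apex g)) (cons_antisym (apex h)) pf.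
move: o1 o2 o3.
move: (orient (apex f :: facet f)) (orient (apex g :: facet f)) (orient (apex h :: facet f)).
move=> x y z xy xz yz yzE; rewrite -yzE in yz.
by nra.
Qed.

(** The cells have the same orientation, the pullbacks of [w] agree, and the reordering of the facet
    is absorbed by [int_ref_perm]; only the opposite sides of the apexes remain. *)
Lemma facet_term_partner w f : (forall c, polyform m (w c)) -> conforming w ->
  ~~ boundary_facet f -> facet_term w (partner f) = - facet_term w f.
Proof.
move=> pw cw intf; have [pf ne] := partnerP intf.
set g := partner f in pf ne *.
rewrite !facet_termE (ho pf) -mulrN; congr (_ * _).
have sg_antisym (x : 'rV[R]_m.+1) : antisym (fun L => Num.sg (orient (x :: L))).
  by move=> s1 y z s2; rewrite -!cat_cons orient_antisym sgrN.
rewrite perm_sym in pf.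
rewrite (int_ref_perm (size_facet f) pf (pw _) (sg_antisym (apex g))).
rewrite perm_sym in pf.
rewrite -(cw _ _ pf) -mulrN; congr (_ * _).
have ne' : f.1 != g.1 by rewrite eq_sym.
have := opposite_sides pf ne'.
move: (orient (apex f :: facet f)) (orient (apex g :: facet f)) => x y.
case: (ltgtP x 0) => [x0|x0|->]; last by rewrite mul0r ltxx.
  by rewrite nmulr_rlt0// => y0; rewrite (ltr0_sg x0) (gtr0_sg y0) opprK.
by rewrite pmulr_rlt0// => y0; rewrite (gtr0_sg x0) (ltr0_sg y0).
Qed.

Lemma stokes_mesh (w : mform T) : (forall c, polyform m (w c)) -> conforming w ->
  int_M o (dh w) = int_bd o (tr w).
Proof.
move=> pw cw.
transitivity (\sum_f facet_term w f).
  rewrite -(pair_bigA _ (fun c i => facet_term w (c, i))); apply: eq_bigr => c _ /=.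
  rewrite stokes_cell ?size_tuple// mulr_sumr; apply: eq_bigr => i _.
  by rewrite /facet_term /facet /= mulrA [_ * (-1) ^+ _]mulrC.
rewrite (bigID (@boundary_facet _ _ T)) /= [X in _ + X](_ : _ = 0) ?addr0; last first.
  set S := \sum_(f | _) _.
  (* [partner] is an involution of the interior facets that changes the sign of each term. *)
  have : S = - S.
    rewrite {1}/S (reindex_onto partner partner) /=; last exact: partnerK.
    rewrite -sumrN; apply: eq_big => [f|f /andP[h /eqP fK]].
      apply/andP/idP => [[h /eqP <-]|h]; first exact: partner_interior.
      by rewrite partner_interior// partnerK.
    by rewrite facet_term_partner// -fK partner_interior.
  by move=> /eqP; rewrite -addr_eq0 -mulr2n mulrn_eq0 => /eqP.
rewrite /int_bd.
rewrite (reindex_omap (val : bfacet T -> _) insub) /=; last first.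
  by move=> f bf; rewrite insubT.
apply: eq_bigl => f; rewrite (valP f) valK eqxx //.
Qed.

End MeshStokes.

(** * The power balance *)

Section MainProof.
Context {R : realType}.

Lemma wedge_polyform n k l (a b : form R n) : polyform k a -> polyform l b ->
  polyform (k + l) (fun x => wedge_prod (a x) (b x)).
Proof.
move=> [aa pa] [ab pb]; split=> [x|K]; first exact: wedge_alternating.
rewrite (_ : (fun x => _) = (fun x => (k`! * l`!)%:R^-1 *
    \sum_(I : k.-tuple 'I_n) \sum_(J : l.-tuple 'I_n)
      a x (ebasis I) * b x (ebasis J) * dx (I ++ J) (ebasis K))).
  apply: ispolyZ; apply: ispoly_sum => I; apply: ispoly_sum => J.
  by apply: ispolyM; [exact: ispolyM|exact: ispoly_cst].
by apply/funext => x; rewrite (wedge_dx (aa x) (ab x)).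
Qed.

Lemma wedge_conforming m (T : mesh R m.+1) s k l (a b : mform T) :
  FE s k a -> FE s l b -> conforming (fun c x => wedge_prod (a c x) (b c x)).
Proof.
move=> [_ ca] [_ cb] f f' ff; rewrite !pull_wedge.
by rewrite (ca _ _ ff) (cb _ _ ff).
Qed.

Lemma wedge_scalel n c (a b : covector R n) vs :
  wedge_prod (fun us => c * a us) b vs = c * wedge_prod a b vs.
Proof.
rewrite /wedge_prod mulr_sumr; apply: eq_bigr => k _; rewrite mulrCA; congr (_ * _).
by rewrite mulr_sumr; apply: eq_bigr => s _ /=; rewrite mulrCA -!mulrA mulrCA.
Qed.

Lemma wedge_poly_continuous n k l (a b : form R n) (c : seq 'rV[R]_n) us :
  polyform k a -> polyform l b ->
  continuous (fun t => pull n c (fun x => wedge_prod (a x) (b x)) t us).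
Proof.
move=> pa pb; apply: ispoly_continuous.
exact: polyform_ispoly (pull_polyform _ _ (wedge_polyform pa pb)).
Qed.

(** Here [p] and [q] are the degrees of [a] and [b], one less than in the theorem, so that
    [p.+1 * q.+1 + 1] is its r. The equations for [fa] and [fb] are required on the simplices only,
    which is where the integrals evaluate them. *)
Lemma power_balance m (T : mesh R m.+1) (o : cell T -> bool) s p q
    (a b fa fb : mform T) : orientation o -> (p + q)%N = m ->
  FE s p a -> FE s q b ->
  (forall c t, inS t ->
     fa c (chart c t) = (-1) ^+ (p.+1 * q.+1 + 1) *: ext_d (a c) (chart c t)) ->
  (forall c t, inS t -> fb c (chart c t) = ext_d (b c) (chart c t)) ->
  pair_M o b fa + pair_M o a fb + pair_bd o ((-1) ^+ p.+1 *: tr a) (tr b) = 0.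
Proof.
move=> ho pq Fa Fb Efa Efb.
have pa c : polyform p (a c) by exact: FE_polyform c Fa.
have pb c : polyform q (b c) by exact: FE_polyform c Fb.
pose w : mform T := fun c x => wedge_prod (a c x) (b c x).
have pw c : polyform m (w c) by have := wedge_polyform (pa c) (pb c); rewrite pq.
have cw : conforming w by exact: wedge_conforming Fa Fb.
have -> : pair_bd o ((-1) ^+ p.+1 *: tr a) (tr b) = (-1) ^+ p.+1 * int_bd o (tr w).
  rewrite /pair_bd /int_bd mulr_sumr; apply: eq_bigr => f _.
  rewrite [RHS]mulrCA; congr (_ * _); rewrite !int_refE -IntZ.
    congr Int; apply/funext => t; rewrite /tr /w pull_wedge.
    exact: (wedge_scalel ((-1) ^+ p.+1) (pull m (facet (val f)) (a (val f).1) t)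
      (pull m (facet (val f)) (b (val f).1) t)).
  apply: ispoly_continuous; apply: polyform_ispoly; exact: pull_polyform (pw _).
have -> : pair_M o b fa + pair_M o a fb = (-1) ^+ p * int_M o (dh w).
  rewrite /pair_M /int_M -big_split mulr_sumr; apply: eq_bigr => c _ /=.
  rewrite -mulrDr [RHS]mulrCA; congr (_ * _); rewrite !int_refE.
  set E := ebasis _.
  set X := fun t => pull m.+1 (vertices c) (fun x => wedge_prod (ext_d (a c) x) (b c x)) t E.
  set Y := fun t => pull m.+1 (vertices c) (fun x => wedge_prod (a c x) (ext_d (b c) x)) t E.
  have cX : continuous X := wedge_poly_continuous (ext_d_polyform (pa c)) (pb c).
  have cY : continuous Y := wedge_poly_continuous (pa c) (ext_d_polyform (pb c)).
  (* The second sign comes from commuting the q-form [b] with the derivative of [a], of degree p +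
     1. *)
  have sgn : (-1) ^+ (p.+1 * q.+1 + 1) * (-1) ^+ (p.+1 * q) = (-1) ^+ p :> R.
    rewrite -exprD (_ : (_ + _)%N = p + 2 * (p.+1 * q).+1)%N; last by rewrite mulnS; lia.
    by rewrite exprD exprM sqrrN !expr1n mulr1.
  transitivity (Int (fun t => (-1) ^+ p * X t) + Int Y).
    congr (_ + _); apply: eq_Int => t St; last first.
      by rewrite /Y /pull -/(chart c t) Efb.
    rewrite /X /pull -/(chart c t) Efa// -sgn.
    have [ab _] := pb c.
    have aX := ext_d_alternating (chart c t) (pa c).
    rewrite (wedge_comm _ (alternatingZ ((-1) ^+ (p.+1 * q.+1 + 1)) aX) (ab _)).
    by rewrite wedge_scalel mulrA [_ ^+ _ * _ ^+ _]mulrC.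
  have -> : Int Y = (-1) ^+ p * ((-1) ^+ p * Int Y).
    by rewrite mulrA -expr2 sqrr_sign mul1r.
  rewrite IntZ// -mulrDr; congr (_ * _); rewrite -IntZ// -IntD//; last first.
    by move=> t; apply: (@continuousM R _ (fun=> (-1) ^+ p)); [exact: cst_continuous|exact: cY].
  congr Int; apply/funext => t; rewrite /X /Y /pull /dh /w.
  by rewrite (leibniz _ _ (pa c) (pb c)).
rewrite (stokes_mesh ho pw cw) -mulrDl exprS mulN1r subrr mul0r //.
Qed.

End MainProof.

Theorem proposition5
  (R : realType) (n p q r a1 s : nat)
  (hp : (1 <= p <= n)%N) (hq : (1 <= q <= n)%N) (hpq : (p + q = n + 1)%N)
  (hr : r = (p * q + 1)%N) (ha1 : a1 = (n * (p + 1) + 1)%N)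
  (hs : (1 <= s)%N)
  (M : set 'rV[R]_n) (T : mesh R n) (hM : triangulates T M)
  (o : cell T -> bool) (ho : orientation o)
  (g : 'rV[R]_n -> 'M[R]_n) (hg : riemannian_metric M g)
  (hf1 he1 hf2 he2 f1 e1 f2 e2 : mform T) (fb heb : bform T)
  (Vhf1 : FE s p hf1) (Vhe1 : FE s p he1)
  (Vhf2 : FE s p.-1 hf2) (Vhe2 : FE s p.-1 he2)
  (Vf1 : FE s q.-1 f1) (Ve1 : FE s q.-1 e1)
  (Vf2 : FE s q f2) (Ve2 : FE s q e2)
  (Vfb : trFE s q.-1 fb) (Vheb : trFE s p.-1 heb)
  (primal1 : forall v : mform T, FE s p v ->
     inner_M o g v hf1 = inner_M o g v ((-1) ^+ r *: dh he2))
  (primal2 : forall v : mform T, FE s p.-1 v ->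
     inner_M o g v hf2
     = (-1) ^+ a1 * inner_M o g (dh v) he1 - (-1) ^+ a1 * pair_bd o (tr v) fb)
  (primal3 : heb = (-1) ^+ p *: tr he2)
  (dual1 : forall v : mform T, FE s q.-1 v ->
     inner_M o g v f1
     = - inner_M o g (dh v) e2
       - (-1) ^+ ((p - 1) * (q - 1)) * pair_bd o (tr v) heb)
  (dual2 : forall v : mform T, FE s q v ->
     inner_M o g v f2 = inner_M o g v (dh e1))
  (dual3 : fb = tr e1) :
  pair_M o e1 hf1 + pair_M o he2 f2 + pair_bd o heb fb = 0.
Proof.
(* The degree bounds exclude n = 0; for n = m + 1 the boundary charts live in dimension m by
   computation. *)
destruct n as [|m]; first by case/andP: hp => /leq_trans /[apply].
move: hp hq => /andP[p0 pn] /andP[q0 qn].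
have dhe2 : FE s p (dh he2) by have := FE_dh Vhe2; rewrite prednK.
have de1 : FE s q (dh e1) by have := FE_dh Ve1; rewrite prednK.
have E1 := FE_weak_eq hM hg pn Vhf1 (FEZ ((-1) ^+ r) dhe2) primal1.
have E2 := FE_weak_eq hM hg qn Vf2 de1 dual2.
have pq : (p.-1 + q.-1)%N = m by lia.
have := power_balance ho pq Vhe2 Ve1 (fa := hf1) (fb := f2).
by rewrite !prednK// -hr dual3 primal3; apply.
Qed.
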